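(* Let $\Omega\subset\mathbb{R}^N$ ($N\ge 2$) be a bounded open set with Lipschitz boundary, let $a\in W^{1,1}(\Omega)$ with $a\ge\mu$ a.e. in $\Omega$ for some constant $\mu>0$, and let $b\in L^r(\Omega)$ for some $r>N$, with $b\ge 0$ and $b\not\equiv 0$. Let $\{p_m\}$ be a sequence with $1<p_m<p_0$ and $p_m\to1$ such that $\lambda_m:=\lambda_{p_m}(\Omega,a,b)$ converges to a value $\Lambda$, and let $u_m$ be the nonnegative eigenfunction associated with $\lambda_m$, normalized by $\int_\Omega b(x)|u_m|^{p_m}dx=1$. Then there exists a nonnegative $u\in BV(\Omega,a)$ such that, up to a subsequence, $$u_m\to u\quad\text{in }L^q(\Omega)\quad\text{for }1\le q<\frac N{N-1}.$$
   Context: The weight $a$ is identified with its precise representative, defined $\mathcal H^{N-1}$-a.e. in $\Omega$. Weighted $p$-Laplacian. For $p>1$, $W_0^{1,p}(\Omega,a)$ is the completion of $C_c^\infty(\Omega)$ in the norm $\left(\int_\Omega|w|^p\,dx+\int_\Omega a|\nabla w|^p\,dx\right)^{1/p}$, and $$\lambda_p(\Omega,a,b)=\inf\left\{\int_\Omega a|\nabla v|^p\,dx:\ v\in W_0^{1,p}(\Omega,a),\ \int_\Omega b|v|^p\,dx=1\right\}.$$ It is known that $\lambda_p>0$ and that the infimum is attained at a unique nonnegative $u_p$; it satisfies $\int_\Omega a|\nabla u_p|^{p-2}\nabla u_p\cdot\nabla\varphi\,dx=\lambda_p\int_\Omega b|u_p|^{p-2}u_p\varphi\,dx$ for all $\varphi\in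 W_0^{1,p}(\Omega,a)$. Write $u_m=u_{p_m}$. The number $p_0\in(1,2)$ is fixed so that $\lambda_p$ is bounded for $1<p<p_0$ (such $p_0$ exists). Weighted $BV$. For $w\in L^1(\Omega)$, $\mathrm{var}_a w=\sup\{\int_\Omega w\operatorname{div}\varphi\,dx:\varphi\in C^1_c(\Omega;\mathbb{R}^N),\ |\varphi(x)|\le a(x)\}$, and $BV(\Omega,a)=\{w\in L^1(\Omega):\mathrm{var}_a w<+\infty\}$. *)

(* Defs.v *)
From HB Require Import structures.
From mathcomp Require Import all_boot all_order all_algebra.
From mathcomp Require Import all_classical all_reals all_analysis.
From mathcomp Require Import measurable_realfun.
Import Order.TTheory GRing.Theory Num.Theory.
Import numFieldNormedType.Exports.
Set Implicit Arguments.
Unset Strict Implicit.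
Unset Printing Implicit Defensive.
Local Open Scope classical_set_scope.
Local Open Scope ring_scope.

Section borel_matrix.
Context (R : realType) (m n : nat).
Let B := <<s @open 'M[R]_(m, n) >>.
Let B0 : B set0. Proof. exact: sigma_algebra0. Qed.
Let BC A : B A -> B (~` A). Proof. exact: sigma_algebraC. Qed.
Let BU (F : _^nat) : (forall i, B (F i)) -> B (\bigcup_i F i).
Proof. exact: sigma_algebra_bigcup. Qed.
HB.instance Definition _ := @isMeasurable.Build (sigma_display (@open 'M[R]_(m, n)))
  'M[R]_(m, n) B B0 BC BU.

Lemma open_measurable_mx (U : set 'M[R]_(m, n)) : open U -> measurable U.
Proof. exact: sub_sigma_algebra. Qed.

Lemma continuous_measurable_mx (f : 'M[R]_(m, n) -> R) :
  continuous f -> measurable_fun setT f.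
Proof.
move=> /continuousP cf; apply: (measurability _ (RGenOpens.measurableE R)).
move=> _ [_ [a [b ->] <-]]; rewrite setTI; apply: open_measurable_mx.
exact/cf/interval_open.
Qed.
End borel_matrix.

Section cons_product.
Context (R : realType) (n : nat).

(* (t, w) |-> (t, w_0, ..., w_(n-1)), i.e. R x R^n ~ R^(n+1) *)
Definition consv (p : measurableTypeR R * 'rV[R]_n) : 'rV[R]_(n.+1) :=
  row_mx p.1%:M p.2 : 'rV[R]_(1 + n).
Definition unconsv (v : 'rV[R]_(n.+1)) :
    measurableTypeR R * 'rV[R]_n :=
  (v 0 0, \row_i v 0 (lift 0 i)).

Lemma consv0 p : consv p 0 0 = p.1.
Proof.
have -> : (0 : 'I_n.+1) = lshift n (0 : 'I_1) by exact/val_inj.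
by rewrite /consv (@row_mxEl _ 1 1 n) mxE.
Qed.

Lemma consvS p i : consv p 0 (lift 0 i) = p.2 0 i.
Proof.
have -> : lift 0 i = rshift 1 i by exact/val_inj.
by rewrite /consv (@row_mxEr _ 1 1 n).
Qed.

Lemma consvK : cancel consv unconsv.
Proof.
move=> [t w]; rewrite /unconsv consv0; congr pair.
by apply/rowP => i; rewrite mxE consvS.
Qed.

Lemma unconsvK : cancel unconsv consv.
Proof.
move=> v; apply/rowP => i; case: (unliftP 0 i) => [j ->|->].
  by rewrite consvS mxE.
by rewrite consv0.
Qed.

Let rat_ball (q : 'rV[rat]_(n.+1) * nat) : set 'rV[R]_(n.+1) :=
  ball (\row_i (ratr (q.1 0 i) : R)) q.2.+1%:R^-1.

Let open_rat_balls (U : set 'rV[R]_(n.+1)) : open U ->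
  U = \bigcup_(q in [set q | rat_ball q `<=` U]) rat_ball q.
Proof.
move=> oU; apply/seteqP; split => [x Ux|x [q /= qU qx]]; last exact: qU.
have /nbhs_ballP[e /= e0 eU] : nbhs x U by exact: open_nbhs_nbhs.
have [k ke] : exists k : nat, (k.+1%:R^-1 : R) < e / 2.
  have /cvgrPdist_lt/(_ (e / 2)) := @cvg_harmonic R.
  rewrite divr_gt0// => /(_ isT)[k _ /(_ k (leqnn k))] /=.
  by rewrite sub0r normrN ger0_norm ?harmonic_ge0// => ?; exists k.
have k0 : (0 : R) < k.+1%:R^-1 by rewrite invr_gt0 ltr0n.
have /choice[q xq] : forall i, exists q : rat,
    `|x 0 i - ratr q| < (k.+1%:R^-1 : R).
  move=> i.
  have [y [/= yk [q _ qy]]] : ball (x 0 i) k.+1%:R^-1 `&` range (@ratr R) !=set0.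
    apply: dense_rat; first by exists (x 0 i); exact: ballxx.
    exact: ball_open.
  by exists q; rewrite qy.
exists (\row_i q i, k) => /=; last first.
  by rewrite /rat_ball /=; split=> // i j; rewrite !mxE ord1 /ball/= distrC xq.
apply: subset_trans eU => y [_ yq]; split => // i j.
have := yq i j; rewrite ord1 !mxE /ball /= => yqj.
rewrite -(subrKA (ratr (q j))) (le_lt_trans (ler_normD _ _))//.
by rewrite (splitr e) ltrD// (lt_trans _ ke).
Qed.

Lemma measurable_consv :
  measurable_fun [set: measurableTypeR R * 'rV[R]_n] consv.
Proof.
apply: (measurability _ (erefl : _ = <<s @open 'rV[R]_n.+1 >>)).
move=> _ [U oU <-]; rewrite setTI (open_rat_balls oU) preimage_bigcup bigcup_mkcond.
apply: countable_bigcupT_measurable => [|q]; first exact: countableP.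
case: ifPn => // _.
have -> : consv @^-1` rat_ball q =
    ball (ratr (q.1 0 0) : R) q.2.+1%:R^-1 `*`
    ball (\row_i ratr (q.1 0 (lift 0 i)) : 'rV[R]_n) q.2.+1%:R^-1.
  apply/seteqP; split => [p [_ qp]|p [/= q1 [q0 q2]]].
    split => /=.
      by have := qp 0 0; rewrite mxE consv0.
    split => // i j; have := qp 0 (lift 0 j).
    by rewrite ord1 consvS !mxE.
  split => // i j; rewrite ord1 mxE; case: (unliftP 0 j) => [k ->|->].
    by have := q2 0 k; rewrite consvS !mxE.
  by rewrite consv0.
apply: measurableX.
  by apply: open_measurable; exact: ball_open.
by apply: open_measurable_mx; exact: ball_open.
Qed.

Lemma measurable_unconsv : measurable_fun [set: 'rV[R]_(n.+1)] unconsv.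
Proof.
apply: measurable_fun_pair.
  by apply: continuous_measurable_mx; exact: coord_continuous.
apply: (measurability _ (erefl : _ = <<s @open 'rV[R]_n >>)).
move=> _ [U oU <-]; rewrite setTI; apply: open_measurable_mx; move: U oU; apply/continuousP.
move=> v A /nbhs_ballP[e /= e0 eA]; apply/nbhs_ballP.
exists e => //= w [_ vw]; apply: eA.
by split => // i j; rewrite !mxE; exact: vw.
Qed.

Variable mu : {sigma_finite_measure set 'rV[R]_n -> \bar R}.

Definition leb_cons : set 'rV[R]_(n.+1) -> \bar R :=
  pushforward (lebesgue_measure \x mu)%E consv.

Let mconsv A : measurable A -> measurable (consv @^-1` A).
Proof. by move=> mA; rewrite -[X in measurable X]setTI; exact: measurable_consv. Qed.

Let leb_cons0 : leb_cons set0 = 0%E.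
Proof. by rewrite /leb_cons /pushforward preimage_set0 measure0. Qed.

Let leb_cons_ge0 A : (0 <= leb_cons A)%E.
Proof. by rewrite /leb_cons /pushforward; exact: measure_ge0. Qed.

Let leb_cons_sigma_additive : semi_sigma_additive leb_cons.
Proof.
move=> F mF tF mUF; rewrite /leb_cons /pushforward preimage_bigcup.
apply: measure_semi_sigma_additive.
- by move=> k; exact: mconsv.
- apply/trivIsetP => /= i j _ _ ij; rewrite -preimage_setI.
  by move/trivIsetP : tF => /(_ _ _ _ _ ij) ->//; rewrite preimage_set0.
- by rewrite -preimage_bigcup; exact: mconsv.
Qed.

HB.instance Definition _ := isMeasure.Build _ _ _ leb_cons
  leb_cons0 leb_cons_ge0 leb_cons_sigma_additive.

Let sigma_finite_leb_cons : sigma_finite setT leb_cons.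
Proof.
have /sigma_finiteP[F [TF ndF Foo]] := sigma_finiteT (@lebesgue_measure R).
have /sigma_finiteP[G [TG ndG Goo]] := sigma_finiteT mu.
exists (fun k => unconsv @^-1` (F k `*` G k)).
  rewrite -preimage_bigcup -[LHS](preimage_setT unconsv); congr (_ @^-1` _).
  rewrite -setXTT TF TG predeqE => -[x y]; split => [[/= [i _ Fx] [j _ Gy]]|].
    exists (maxn i j) => //; split.
    - by move: x Fx; exact/subsetPset/ndF/leq_maxl.
    - by move: y Gy; exact/subsetPset/ndG/leq_maxr.
  by move=> [i _ []/= ? ?]; split; exists i.
move=> k; have [mF Fk] := Foo k; have [mG Gk] := Goo k; split.
  rewrite -[X in measurable X]setTI; apply: measurable_unconsv => //.
  exact: measurableX.
rewrite /leb_cons /pushforward -comp_preimage.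
rewrite (_ : unconsv \o consv = id); last exact/funext/consvK.
by rewrite /= product_measure1E// lte_mul_pinfty// ge0_fin_numE.
Qed.

HB.instance Definition _ := Measure_isSigmaFinite.Build _ _ _ leb_cons
  sigma_finite_leb_cons.

End cons_product.

(* Lebesgue measure on the Borel sets of R^n, as an iterated product; its value
   on boxes is given by [lebN_box]. *)
Fixpoint lebN (R : realType) (n : nat) :
    {sigma_finite_measure set 'rV[R]_n -> \bar R} :=
  match n with
  | 0 => \d_(0 : 'rV[R]_0)
  | m.+1 => leb_cons (lebN R m)
  end.
Arguments lebN : clear implicits.

Lemma lebN_box (R : realType) (n : nat) (l u : 'rV[R]_n) :
  (forall i, l 0 i <= u 0 i) ->
  lebN R n [set x | forall i, l 0 i <= x 0 i <= u 0 i] =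
  (\prod_(i < n) (u 0 i - l 0 i))%:E.
Proof.
elim: n l u => [l u _|n IHn l u lu].
  rewrite big_ord0 /= diracE mem_set//.
  by case.
rewrite big_ord_recl.
pose l' : 'rV[R]_n := \row_i l 0 (lift 0 i).
pose u' : 'rV[R]_n := \row_i u 0 (lift 0 i).
have lu' i : l' 0 i <= u' 0 i by rewrite !mxE.
have -> : \prod_(i < n) (u 0 (lift ord0 i) - l 0 (lift ord0 i)) =
    \prod_(i < n) (u' 0 i - l' 0 i) by apply: eq_bigr => i _; rewrite !mxE.
rewrite EFinM -(IHn _ _ lu') /= /leb_cons /pushforward.
pose B : set 'rV[R]_n := [set x | forall i, l' 0 i <= x 0 i <= u' 0 i].
rewrite -/B.
have -> : consv (n := n) @^-1` [set x | forall i, l 0 i <= x 0 i <= u 0 i] =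
    `[l 0 0, u 0 0]%classic `*` B.
  apply/seteqP; split => [p /= H|p [/= H0 H1] i].
    split; first by have := H 0; rewrite consv0 in_itv.
    by move=> i; have := H (lift 0 i); rewrite consvS !mxE.
  case: (unliftP 0 i) => [j ->|->]; last first.
    by move: H0; rewrite consv0 in_itv.
  by have := H1 j; rewrite consvS !mxE.
have mB : measurable B.
  have -> : B = \bigcap_(i in [set: 'I_n])
      ((fun x : 'rV[R]_n => x 0 i) @^-1` `[l' 0 i, u' 0 i]).
    apply/seteqP; split => [x Bx i _|x Bx i]; first by rewrite /= in_itv; exact: Bx.
    by have := Bx i Logic.I; rewrite /= in_itv.
  apply: fin_bigcap_measurable => // i _.
  rewrite -[X in measurable X]setTI.
  have mc : measurable_fun setT (fun x : 'rV[R]_n => x 0 i).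
    by apply: continuous_measurable_mx; exact: coord_continuous.
  by apply: mc => //; exact: measurable_itv.
rewrite product_measure1E//.
congr (_ * _)%E; rewrite [LHS]lebesgue_measure_itv/= lte_fin; case: ifPn => [//|].
rewrite -leNgt => ul.
rewrite (_ : u 0 ord0 = l 0 0) ?subrr//; by apply/eqP; rewrite eq_le ul lu.
Qed.

Section euclidean.
Context (R : realType).

Definition enorm n (x : 'rV[R]_n) : R := Num.sqrt (\sum_(i < n) x 0 i ^+ 2).

Definition eball n (x : 'rV[R]_n) (r : R) : set 'rV[R]_n :=
  [set y | enorm (y - x) < r].

(* Near each boundary point, after an orthogonal change of coordinates [Q] and a choice of the
   vertical coordinate [k], [Om] is the strict epigraph of a Lipschitz
   function of the remaining coordinates. *)
Definition lipschitz_boundary n (Om : set 'rV[R]_n) : Prop :=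
  forall x0, (closure Om `\` Om°) x0 ->
  exists (r L : R) (Q : 'M[R]_n) (k : 'I_n) (g : 'rV[R]_n.-1 -> R),
    [/\ 0 < r, Q *m Q^T = 1%:M,
        forall s t, `|g s - g t| <= L * enorm (s - t) &
        forall x, eball x0 r x ->
          (Om x <-> g (col' k (x *m Q)) < (x *m Q) 0 k)].

End euclidean.

Section calculus.
Context (R : realType) (N : nat).
Implicit Types (Om : set 'rV[R]_N) (f : 'rV[R]_N -> R).

Definition partial (i : 'I_N) f (x : 'rV[R]_N) : R := 'D_(delta_mx 0 i) f x.

Definition grad f (x : 'rV[R]_N) : 'rV[R]_N := \row_i partial i f x.

Definition divergence (phi : 'rV[R]_N -> 'rV[R]_N) (x : 'rV[R]_N) : R :=
  \sum_(i < N) partial i (fun y => phi y 0 i) x.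

Fixpoint Ck (k : nat) f : Prop :=
  match k with
  | 0 => continuous f
  | k'.+1 => continuous f /\ forall i,
      (forall x, derivable f x (delta_mx 0 i)) /\ Ck k' (partial i f)
  end.

Definition compact_supp (V : nmodType) Om (f : 'rV[R]_N -> V) : Prop :=
  let S := closure [set x | f x != 0] in compact S /\ S `<=` Om.

Definition Cc_infty Om f : Prop := (forall k, Ck k f) /\ compact_supp Om f.

Definition Cc1_vec Om (phi : 'rV[R]_N -> 'rV[R]_N) : Prop :=
  (forall i, Ck 1 (fun x => phi x 0 i)) /\ compact_supp Om phi.

End calculus.

Section function_spaces.
Context (R : realType) (N : nat) (Om : set 'rV[R]_N).
Implicit Types (a b f u v w : 'rV[R]_N -> R) (G : 'rV[R]_N -> 'rV[R]_N).
Local Open Scope ereal_scope.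

Definition ae_in (P : 'rV[R]_N -> Prop) : Prop :=
  {ae lebN R N, forall x, Om x -> P x}.

Definition Lp (p : R) f : Prop :=
  measurable_fun Om f /\ \int[lebN R N]_(x in Om) (`|f x| `^ p)%:E < +oo.

Definition cvg_Lp (q : R) (f_ : nat -> 'rV[R]_N -> R) f : Prop :=
  [/\ forall m, Lp q (f_ m), Lp q f &
      (\int[lebN R N]_(x in Om) (`|f_ m x - f x| `^ q)%:E) @[m --> \oo] --> 0].

Definition weak_partial (i : 'I_N) f g : Prop :=
  forall phi, Cc_infty Om phi ->
    \int[lebN R N]_(x in Om) (f x * partial i phi x)%:E =
    - \int[lebN R N]_(x in Om) (g x * phi x)%:E.

Definition W11 f : Prop :=
  Lp 1 f /\ forall i, exists2 g, Lp 1 g & weak_partial i f g.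

(* [precise_value a x l]: the precise representative of [a] is defined at [x]
   and equals [l] there. *)
Definition precise_value a (x : 'rV[R]_N) (l : R) : Prop :=
  (fine (\int[lebN R N]_(y in eball x r) (a y)%:E) /
   fine (lebN R N (eball x r)))%R @[r --> 0^'+] --> l.

(* The constraint |phi| <= a, where [a] stands for its precise representative,
   is imposed at every point of [Om] at which the latter is defined. *)
Definition admissible a (phi : 'rV[R]_N -> 'rV[R]_N) : Prop :=
  Cc1_vec Om phi /\
  forall x l, Om x -> precise_value a x l -> (enorm (phi x) <= l)%R.

Definition var a w : \bar R :=
  ereal_sup [set \int[lebN R N]_(x in Om) (w x * divergence phi x)%:E
            | phi in admissible a].

Definition BV a w : Prop := Lp 1 w /\ var a w < +oo.

Definition energy a (p : R) G : \bar R :=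
  \int[lebN R N]_(x in Om) (a x * enorm (G x) `^ p)%:E.

Definition sobolev_norm a (p : R) v G : \bar R :=
  (\int[lebN R N]_(x in Om) (`|v x| `^ p)%:E + energy a p G) `^ p^-1.

(* [W01p a p v G]: [v] belongs to $W_0^{1,p}(\Omega,a)$ and has gradient [G].
   The completion of $C_c^\infty(\Omega)$ is realized as the closure of the
   pairs (phi, grad phi) in $L^p(\Omega) \times L^p(\Omega,a)^N$; when [a] is
   bounded below by a positive constant, [G] is the weak gradient of [v], so
   it is determined by [v] up to a negligible set. *)
Definition W01p a (p : R) v G : Prop :=
  [/\ measurable_fun Om v, forall i, measurable_fun Om (fun x => G x 0%R i) &
      exists2 phi : nat -> 'rV[R]_N -> R, forall k, Cc_infty Om (phi k) &
        sobolev_norm a p (fun x => v x - phi k x)%R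
          (fun x => G x - grad (phi k) x)%R @[k --> \oo] --> 0].

Definition mass b (p : R) v : \bar R :=
  \int[lebN R N]_(x in Om) (b x * `|v x| `^ p)%:E.

Definition first_eigenvalue a b (p : R) : \bar R :=
  ereal_inf [set E | exists v G,
    [/\ W01p a p v G, mass b p v = 1 & E = energy a p G]].

(* The nonnegative first eigenfunction is the nonnegative minimizer in the
   definition of [first_eigenvalue], normalized by [mass b p u = 1]. *)
Definition nonneg_eigenfunction a b (p : R) u : Prop :=
  [/\ ae_in (fun x => 0 <= u x)%R, mass b p u = 1 &
      exists2 G, W01p a p u G & energy a p G = first_eigenvalue a b p].

End function_spaces.

(* Main.v *)
Require Import Defs.
From HB Require Import structures.
From mathcomp Require Import all_boot all_order all_algebra.
From mathcomp Require Import all_classical all_reals all_analysis.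
From mathcomp Require Import measurable_realfun ring lra.
Import Order.TTheory GRing.Theory Num.Theory.
Import numFieldNormedType.Exports.
Set Implicit Arguments.
Unset Strict Implicit.
Unset Printing Implicit Defensive.
Local Open Scope classical_set_scope.
Local Open Scope ring_scope.

(** Write $N=n+1$ and extend functions of $W_0^{1,p}(\Omega,a)$ by zero. Since
    $t\le 1+t^p$, the eigenfunctions $u_m$ satisfy
    $\int a|\nabla u_m|\le\|a\|_1+\lambda_m$, a bound independent of $m$. Hence
    every $u_m$ is an $L^1$-limit of test functions $\psi$ with
    $\int a|\nabla\psi|\le K$, for one and the same $K$ ([smooth_limit],
    [W01p_smooth_limit]). The theorem is a statement about this class, which is
    closed in $L^1$.

    Compactness and integrability come from approximation by step functions on
    the grid of mesh $h=2^{-k}$. Let $V$ bound $\int|\nabla\psi|$. On a cube $Q$ of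
    side $h$ some constant $c_Q$ satisfies
    $\int_Q|\psi-c_Q|\le h\sum_i\int_Q|\partial_i\psi|$ ([cube_oscillation]), so that
    the step function $g_k$ with values $c_Q$ is within $O(hV)$ of $\psi$ in $L^1$.
    Moreover $\int_Q|\psi|\le hV$, because $\psi$ vanishes at the ends of every line
    ([slab_estimate]); therefore $|g_k|\le O(h^{1-N}V)$ and not merely
    $O(h^{-N})$. Two consequences are drawn.
    - At height $|\psi|\sim 2^{k(N-1)}$ one has $|\psi|\le 2|\psi-g_k|$, and summing
      over $k$ the errors $2^{-k}$ weighted by $2^{k(N-1)(q-1)}$ bounds
      $\int|\psi|^q$: the series is geometric and converges exactly for
      $q<N/(N-1)$ ([Lq_bound]).
    - For fixed $k$ the functions $g_k$ have finitely many bounded coefficients,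
      so the class is totally bounded in $L^1$ ([smooth_limit_classes]); a
      subsequence converges in $L^1$ ([finite_classes_subsequence],
      [L1_complete]), and then in $L^q$ because it is bounded in some $L^{q'}$ with
      $q'>q$ ([cvg_Lq_interpolation]).

    The limit $u$ belongs to the class again, and $\mathrm{var}_a u\le K$
    ([smooth_limit_var_le]): for an admissible field $\varphi$, integration by parts
    gives $\int\psi\,\mathrm{div}\,\varphi\le\int|\varphi||\nabla\psi|$
    ([integral_divergence_le]), and one needs $|\varphi|\le a$ almost everywhere.
    As the constraint on $\varphi$ is imposed where the precise representative of
    $a$ is defined, this requires the Lebesgue differentiation theorem in
    $\mathbb R^N$ ([precise_value_ae]). It is deduced from a weak-type maximal
    inequality on the dyadic grid ([measure_exceptional_le],
    [not_exceptional_le]) and from the density of continuous functions in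
    $L^1$ ([continuous_dense_L1]). *)

(** * Iterated integrals and volumes of boxes *)

Section tonelli.
Context (R : realType) (n : nat).
Local Open Scope ereal_scope.
Local Notation leb := (@lebesgue_measure R).

Lemma integral_consv (D : set 'rV[R]_n.+1) (f : 'rV[R]_n.+1 -> \bar R) :
  measurable D -> measurable_fun D f -> (forall x, D x -> 0 <= f x) ->
  \int[lebN R n.+1]_(x in D) f x =
  \int[leb \x lebN R n]_(z in @consv R n @^-1` D) f (consv z).
Proof.
move=> mD mf f0.
rewrite -(@ge0_integral_pushforward _ _ _ _ _ _ (@measurable_consv R n)
    (leb \x lebN R n) D f)//; last first.
  by move=> x /[!inE]; exact: f0.
Qed.

Lemma measurable_fun_consv (f : 'rV[R]_n.+1 -> \bar R) :
  measurable_fun setT f ->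
  measurable_fun [set: measurableTypeR R * 'rV[R]_n] (f \o @consv R n).
Proof. by move=> mf; apply: measurableT_comp => //; exact: measurable_consv. Qed.

Lemma tonelli_consv (f : 'rV[R]_n.+1 -> \bar R) :
  measurable_fun setT f -> (forall x, 0 <= f x) ->
  \int[lebN R n.+1]_x f x = \int[leb]_t \int[lebN R n]_w f (consv (t, w)).
Proof.
move=> mf f0; rewrite integral_consv// preimage_setT.
by rewrite (fubini_tonelli1 _ (measurable_fun_consv mf) (fun z => f0 (consv z))).
Qed.

Lemma tonelli_consv_sym (f : 'rV[R]_n.+1 -> \bar R) :
  measurable_fun setT f -> (forall x, 0 <= f x) ->
  \int[lebN R n.+1]_x f x = \int[lebN R n]_w \int[leb]_t f (consv (t, w)).
Proof.
move=> mf f0; rewrite integral_consv// preimage_setT.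
by rewrite (fubini_tonelli2 _ (measurable_fun_consv mf) (fun z => f0 (consv z))).
Qed.

Lemma measurable_slice_integral (f : 'rV[R]_n.+1 -> \bar R) :
  measurable_fun setT f -> (forall x, 0 <= f x) ->
  measurable_fun [set: measurableTypeR R]
    (fun t => \int[lebN R n]_w f (consv (t, w))).
Proof.
move=> mf f0.
apply: (@measurable_fun_fubini_tonelli_F _ _ _ _ _ (lebN R n)
  (f \o @consv R n)); first exact: (measurable_fun_consv mf).
by move=> z; exact: f0.
Qed.

End tonelli.

Section tonelli_set.
Context (R : realType) (n : nat).
Local Open Scope ereal_scope.
Local Notation leb := (@lebesgue_measure R).

Definition cons_set (I : set R) (Q : set 'rV[R]_n) : set 'rV[R]_n.+1 :=
  @unconsv R n @^-1` (I `*` Q).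

Lemma consv_preimage_cons_set I Q : @consv R n @^-1` cons_set I Q = I `*` Q.
Proof. by rewrite /cons_set -comp_preimage (_ : _ \o _ = id)//; exact/funext/consvK. Qed.

Lemma measurable_cons_set (I : set (measurableTypeR R)) Q :
  measurable I -> measurable Q -> measurable (cons_set I Q).
Proof.
move=> mI mQ; rewrite /cons_set -[X in measurable X]setTI.
by apply: measurable_unconsv => //; exact: measurableX.
Qed.

Lemma cons_setE I Q t w : cons_set I Q (consv (t, w)) = (I t /\ Q w).
Proof. by rewrite -[LHS]/((I `*` Q) (unconsv (consv (t, w)))) consvK. Qed.

Lemma tonelli_cons_set (I : set (measurableTypeR R)) Q (f : 'rV[R]_n.+1 -> \bar R) :
  measurable I -> measurable Q ->
  measurable_fun setT f -> (forall x, 0 <= f x) ->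
  \int[lebN R n.+1]_(x in cons_set I Q) f x =
  \int[leb]_(t in I) \int[lebN R n]_(w in Q) f (consv (t, w)).
Proof.
move=> mI mQ mf f0; rewrite integral_mkcond tonelli_consv; last 2 first.
- by apply/(measurable_restrictT _ (measurable_cons_set mI mQ)); exact: measurable_funTS.
- by move=> x; rewrite erestrict_ge0.
rewrite [RHS]integral_mkcond; apply: eq_integral => t _.
rewrite /patch; case: ifPn => [tI|tI].
  rewrite [RHS]integral_mkcond; apply: eq_integral => w _; rewrite /patch.
  congr (if _ then _ else _); apply/idP/idP; rewrite !inE cons_setE; first by case.
  by move=> Qw; split => //; exact/set_mem.
rewrite integral0_eq// => w _; case: ifPn => //; rewrite inE cons_setE => -[It _].
by move/negP : tI; rewrite inE.
Qed.

Lemma tonelli_cons_set_sym (I : set (measurableTypeR R)) Q (f : 'rV[R]_n.+1 -> \bar R) :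
  measurable I -> measurable Q ->
  measurable_fun setT f -> (forall x, 0 <= f x) ->
  \int[lebN R n.+1]_(x in cons_set I Q) f x =
  \int[lebN R n]_(w in Q) \int[leb]_(t in I) f (consv (t, w)).
Proof.
move=> mI mQ mf f0; rewrite integral_mkcond tonelli_consv_sym; last 2 first.
- by apply/(measurable_restrictT _ (measurable_cons_set mI mQ)); exact: measurable_funTS.
- by move=> x; rewrite erestrict_ge0.
rewrite [RHS]integral_mkcond; apply: eq_integral => w _.
rewrite /patch; case: ifPn => [wQ|wQ].
  rewrite [RHS]integral_mkcond; apply: eq_integral => t _; rewrite /patch.
  congr (if _ then _ else _); apply/idP/idP; rewrite !inE cons_setE; first by case.
  by move=> It; split => //; exact/set_mem.
rewrite integral0_eq// => t _; case: ifPn => //; rewrite inE cons_setE => -[_ Qw].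
by move/negP : wQ; rewrite inE.
Qed.

End tonelli_set.

Section box.
Context (R : realType).

Definition box n (J : 'I_n -> set R) : set 'rV[R]_n :=
  [set x | forall i, J i (x 0 i)].

Lemma measurable_coord n i :
  measurable_fun setT (fun x : 'rV[R]_n => x 0 i).
Proof. by apply: continuous_measurable_mx; exact: coord_continuous. Qed.

Lemma measurable_box n (J : 'I_n -> set R) :
  (forall i, measurable (J i : set (measurableTypeR R))) -> measurable (box J).
Proof.
move=> mJ.
have -> : box J = \bigcap_(i in [set: 'I_n]) ((fun x : 'rV[R]_n => x 0 i) @^-1` J i).
  by apply/seteqP; split => x Bx i => [_|]; [exact: Bx|exact: (Bx i Logic.I)].
apply: fin_bigcap_measurable => // i _; rewrite -[X in measurable X]setTI.
by apply: (@measurable_coord n i) => //; exact: mJ.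
Qed.

Lemma box_cons n (J : 'I_n.+1 -> set R) :
  box J = cons_set (J ord0) (box (fun i => J (lift ord0 i))).
Proof.
apply/seteqP; split => [x Jx|x [/= J0 Jx] i].
  by split => //= i; rewrite mxE; exact: Jx.
case: (unliftP ord0 i) => [j ->|->//].
by have := Jx j; rewrite mxE.
Qed.

Lemma lebN_boxE n (J : 'I_n -> set R) :
  (forall i, measurable (J i : set (measurableTypeR R))) ->
  lebN R n (box J) = (\prod_(i < n) lebesgue_measure (J i))%E.
Proof.
elim: n J => [J _|n IHn J mJ].
  by rewrite big_ord0 /= diracE mem_set//; case.
rewrite big_ord_recl -IHn//= /leb_cons /pushforward box_cons.
by rewrite consv_preimage_cons_set product_measure1E//; exact: measurable_box.
Qed.

(** Half-open cubes: those of a grid partition the space. *)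
Definition cube n (l : 'rV[R]_n) (h : R) : set 'rV[R]_n :=
  box (fun i => `[l 0 i, l 0 i + h[%classic).

Lemma measurable_cube n (l : 'rV[R]_n) h : measurable (cube l h).
Proof. by apply: measurable_box => i; exact: measurable_itv. Qed.

Lemma lebN_cube n (l : 'rV[R]_n) h : 0 <= h -> lebN R n (cube l h) = (h ^+ n)%:E.
Proof.
move=> h0; rewrite lebN_boxE; last by move=> i; exact: measurable_itv.
rewrite (eq_bigr (fun=> h%:E)) => [|i _].
  by rewrite prodEFin prodr_const card_ord.
rewrite lebesgue_measure_itv/= lte_fin ltrDl.
by case: ltP => [_|h0']; [rewrite -EFinB addrC addKr|congr EFin; lra].
Qed.

End box.

Section measurable_slices.
Context (R : realType) (n : nat).
Local Open Scope ereal_scope.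
Local Notation leb := (@lebesgue_measure R).

Lemma measurable_integral_slice_l Q (f : 'rV[R]_n.+1 -> \bar R) :
  measurable Q -> measurable_fun setT f -> (forall x, 0 <= f x) ->
  measurable_fun [set: measurableTypeR R]
    (fun t => \int[lebN R n]_(w in Q) f (consv (t, w))).
Proof.
move=> mQ mf f0.
have mD : measurable (cons_set setT Q) by exact: measurable_cons_set.
rewrite (_ : (fun t => _) =
    fun t => \int[lebN R n]_w (f \_ (cons_set setT Q)) (consv (t, w))).
  apply: measurable_slice_integral; last by move=> x; rewrite erestrict_ge0.
  by apply/(measurable_restrictT _ mD); exact: measurable_funTS.
apply/funext => t; rewrite integral_mkcond; apply: eq_integral => w _.
rewrite /patch; congr (if _ then _ else _).
by apply/idP/idP; rewrite !inE cons_setE; first [by case|by move=> ?; split].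
Qed.

Lemma measurable_integral_slice_r (I : set (measurableTypeR R))
    (f : 'rV[R]_n.+1 -> \bar R) :
  measurable I -> measurable_fun setT f -> (forall x, 0 <= f x) ->
  measurable_fun [set: 'rV[R]_n] (fun w => \int[leb]_(t in I) f (consv (t, w))).
Proof.
move=> mI mf f0.
have mD : measurable (cons_set I [set: 'rV[R]_n]) by exact: measurable_cons_set.
rewrite (_ : (fun w => _) =
    fun w => \int[leb]_t (f \_ (cons_set I setT)) (consv (t, w))).
  apply: (@measurable_fun_fubini_tonelli_G _ _ _ _ _ leb
    ((f \_ (cons_set I setT)) \o @consv R n)).
  - apply: measurable_fun_consv; apply/(measurable_restrictT _ mD).
    exact: measurable_funTS.
  - by move=> x; rewrite /= erestrict_ge0.
apply/funext => t; rewrite integral_mkcond; apply: eq_integral => w _.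
rewrite /patch; congr (if _ then _ else _).
by apply/idP/idP; rewrite !inE cons_setE; first [by case|by move=> ?; split].
Qed.

End measurable_slices.

(** * Slices of continuously differentiable functions *)
Section slices.
Context (R : realType) (n : nat).
Implicit Type f : 'rV[R]_n.+1 -> R.

Lemma continuous_consv_l (w : 'rV[R]_n) : continuous (fun t : R => consv (t, w)).
Proof.
move=> t A /nbhs_ballP[e /= e0 eA]; apply/nbhs_ballP; exists e => //= s ts.
apply: eA; split => // i j; rewrite ord1; case: (unliftP ord0 j) => [k ->|->].
  by rewrite !consvS; exact: ballxx.
by rewrite !consv0.
Qed.

Lemma continuous_consv_r (t : R) : continuous (fun w : 'rV[R]_n => consv (t, w)).
Proof.
move=> w A /nbhs_ballP[e /= e0 eA]; apply/nbhs_ballP; exists e => //= v [_ vw].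
apply: eA; split => // i j; rewrite ord1; case: (unliftP ord0 j) => [k ->|->].
  by rewrite !consvS; exact: vw.
by rewrite !consv0; exact: ballxx.
Qed.

Lemma consv_shift0 (h t : R) (w : 'rV[R]_n) :
  consv (h + t, w) = h *: delta_mx 0 ord0 + consv (t, w).
Proof.
apply/rowP => j; rewrite [RHS]mxE [X in _ = X + _]mxE [X in _ = _ * X + _]mxE.
case: (unliftP ord0 j) => [k ->|->].
  by rewrite !consvS/= mulr0 add0r.
by rewrite !consv0/= ?eqxx mulr1.
Qed.

Lemma consv_shiftS (h t : R) (w : 'rV[R]_n) (i : 'I_n) :
  consv (t, h *: delta_mx 0 i + w) = h *: delta_mx 0 (lift ord0 i) + consv (t, w).
Proof.
apply/rowP => j; rewrite [RHS]mxE [X in _ = X + _]mxE [X in _ = _ * X + _]mxE.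
case: (unliftP ord0 j) => [k ->|->].
  by rewrite !consvS !mxE/= (inj_eq lift_inj).
by rewrite !consv0/= ?eqxx mulr0 add0r.
Qed.

Lemma partial_slice f (t : R) (w : 'rV[R]_n) (i : 'I_n) :
  partial i (fun w => f (consv (t, w))) w = partial (lift ord0 i) f (consv (t, w)).
Proof.
rewrite /partial /derive.
set F := (X in lim (X @ _) = _); set G := (X in _ = lim (X @ _)).
suff -> : F = G by [].
by apply/funext => h; rewrite /F /G /= consv_shiftS.
Qed.

Lemma Ck1_slice f (t : R) : Ck 1 f -> Ck 1 (fun w : 'rV[R]_n => f (consv (t, w))).
Proof.
move=> [cf df]; split => [w|i].
  apply: (@continuous_comp _ _ _ (fun w => consv (t, w)) f); last exact: cf.
  exact: continuous_consv_r.
split => [w|w].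
  have := (df (lift ord0 i)).1 (consv (t, w)); rewrite /derivable.
  set F := (X in cvg (X @ _) -> _); set G := (X in _ -> cvg (X @ _)).
  suff -> : G = F by [].
  by apply/funext => h; rewrite /F /G /= consv_shiftS.
rewrite (_ : partial i _ = fun w => partial (lift ord0 i) f (consv (t, w))).
  apply: (@continuous_comp _ _ _ (fun w => consv (t, w))).
    exact: continuous_consv_r.
  exact: (df _).2.
by apply/funext => v; exact: partial_slice.
Qed.

Lemma derivable_slice f (w : 'rV[R]_n) (t : R) : Ck 1 f ->
  derivable (fun s : R => f (consv (s, w))) t 1.
Proof.
move=> [_ df]; have := (df ord0).1 (consv (t, w)); rewrite /derivable.
set F := (X in cvg (X @ _) -> _); set G := (X in _ -> cvg (X @ _)).
suff -> : G = F by [].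
apply/funext => h; rewrite /F /G /=.
by rewrite -consv_shift0 -[h *: 1]/(h * 1) mulr1.
Qed.

Lemma derive_slice f (w : 'rV[R]_n) (t : R) :
  derive1 (fun s : R => f (consv (s, w))) t = partial ord0 f (consv (t, w)).
Proof.
rewrite derive1E /partial /derive.
set F := (X in lim (X @ _) = _); set G := (X in _ = lim (X @ _)).
suff -> : F = G by [].
apply/funext => h; rewrite /F /G /=.
by rewrite -consv_shift0 -[h *: 1]/(h * 1) mulr1.
Qed.

Lemma continuous_partial_slice f (w : 'rV[R]_n) : Ck 1 f ->
  continuous (fun s : R => partial ord0 f (consv (s, w))).
Proof.
move=> [_ df] t; apply: (@continuous_comp _ _ _ (fun s => consv (s, w))); last exact: (df _).2.
exact: continuous_consv_l.
Qed.

End slices.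

Section one_dimensional.
Context (R : realType).
Local Open Scope ereal_scope.
Local Notation leb := (@lebesgue_measure R).

Lemma FTC2_everywhere (f df : R -> R) (a b : R) : (a <= b)%R ->
  (forall t, derivable f t 1) -> derive1 f =1 df -> continuous df ->
  \int[leb]_(t in `[a, b]) (df t)%:E = (f b - f a)%:E.
Proof.
move=> + der dfE cdf; rewrite le_eqVlt => /predU1P[<-|ab].
  by rewrite set_itv1 integral_set1 subrr.
rewrite (continuous_FTC2 ab (F := f)) ?EFinB//.
- exact: continuous_subspaceT.
- split => [x _||]; first exact: der.
  + by apply: cvg_at_right_filter; apply: differentiable_continuous; apply/derivable1_diffP.
  + by apply: cvg_at_left_filter; apply: differentiable_continuous; apply/derivable1_diffP.
Qed.

Lemma osc_le_integral_deriv (f df : R -> R) (I : set (measurableTypeR R)) (s t : R) :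
  (forall t, derivable f t 1) -> derive1 f =1 df -> continuous df ->
  measurable I -> (forall x, (Num.min s t <= x <= Num.max s t)%R -> I x) ->
  `|f t - f s|%:E <= \int[leb]_(x in I) `|df x|%:E.
Proof.
wlog st : s t / (s <= t)%R => [wl|].
  have [st|] := boolP (s <= t)%R; first exact: wl.
  rewrite -ltNge => /ltW ts.
  move=> der dfE cdf mI sub; rewrite distrC.
  by apply: (wl t s) => // x; rewrite minC maxC; exact: sub.
move=> der dfE cdf mI; rewrite min_l// max_r// => sub.
have mdf : measurable_fun setT df by exact: continuous_measurable_fun.
rewrite -abse_EFin -(FTC2_everywhere st der dfE cdf).
apply: le_trans (le_abse_integral _ _ _) _ => //.
  by apply/measurable_EFinP; exact: measurable_funTS.
apply: ge0_subset_integral => //.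
  apply/measurable_EFinP; apply: measurableT_comp => //; exact: measurable_funTS.
Qed.

End one_dimensional.

(** * Oscillation on cubes and slabs *)
Section Ck1_facts.
Context (R : realType) (n : nat).
Implicit Type f : 'rV[R]_n -> R.

Lemma Ck1_continuous f : Ck 1 f -> continuous f. Proof. by case. Qed.

Lemma Ck1_partial f i : Ck 1 f -> continuous (partial i f).
Proof. by case=> _ /(_ i) []. Qed.

Lemma measurable_norm_EFin f c : continuous f ->
  measurable_fun setT (fun x => `|f x - c|%:E).
Proof.
move=> cf; apply/measurable_EFinP; apply: measurableT_comp => //.
by apply: measurable_funB => //; exact: continuous_measurable_mx.
Qed.

Lemma measurable_abs_EFin f : continuous f ->
  measurable_fun setT (fun x => `|f x|%:E).
Proof.
move=> cf; apply/measurable_EFinP; apply: measurableT_comp => //.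
exact: continuous_measurable_mx.
Qed.

End Ck1_facts.

(** The slack $e$ makes the inequality contradict the monotonicity of the
    integral, also when the integral is zero. *)
Lemma exists_le_mean (R : realType) (c h e : R) (F : R -> \bar R) :
  0 < h -> 0 < e -> measurable_fun [set: measurableTypeR R] F ->
  (forall t, (0 <= F t)%E) ->
  exists2 t, c <= t < c + h &
    (h%:E * F t <= \int[lebesgue_measure]_(s in `[c, (c + h)%R[) F s + e%:E)%E.
Proof.
move=> h0 e0 mF F0; apply: contrapT => H.
have {}H t : c <= t < c + h ->
    (\int[lebesgue_measure]_(s in `[c, (c + h)%R[) F s + e%:E < h%:E * F t)%E.
  by move=> tI; rewrite ltNge; apply/negP => ?; apply: H; exists t.
have : (0 <= \int[lebesgue_measure]_(s in `[c, (c + h)%R[) F s)%E by exact: integral_ge0.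
case E : (\int[lebesgue_measure]_(s in `[c, (c + h)%R[) F s)%E => [r| |]//.
- rewrite lee_fin => r0.
  have : (\int[lebesgue_measure]_(s in `[c, (c + h)%R[) (cst ((r + e) / h)%:E) s <=
          \int[lebesgue_measure]_(s in `[c, (c + h)%R[) F s)%E.
    apply: ge0_le_integral => //.
    + by move=> x _; rewrite /= lee_fin divr_ge0 ?addr_ge0 ?(ltW h0) ?(ltW e0).
    + exact: measurable_funTS.
    + move=> t /=; rewrite in_itv/= => tI; have := H _ tI; rewrite E => /ltW.
      rewrite -EFinD mulrC EFinM.
      by rewrite lee_pdivrMl.
  rewrite integral_cst//= lebesgue_measure_itv/= lte_fin ltrDl h0 -EFinB addrAC subrr add0r.
  by rewrite -EFinM E lee_fin divfK ?gt_eqF//; lra.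
- by move=> _; have := H c; rewrite lexx ltrDl h0 E /= => /(_ isT); rewrite ltNge leey.
Qed.

Section oscillation.
Context (R : realType).
Local Open Scope ereal_scope.
Local Notation leb := (@lebesgue_measure R).

Definition tailv n (l : 'rV[R]_n.+1) : 'rV[R]_n := (unconsv l).2.

Lemma cube_cons n (l : 'rV[R]_n.+1) h :
  cube l h = cons_set `[l 0 ord0, l 0 ord0 + h[%classic%R (cube (tailv l) h).
Proof.
rewrite /cube box_cons; congr (cons_set _ (box _)).
by apply/funext => i; rewrite /tailv /= !mxE.
Qed.

(** By induction on the dimension: the values of $f$ on a cube are compared with
    those on a slice $\{t_0\}\times Q'$ whose integral of the remaining partial
    derivatives does not exceed the mean; the induction hypothesis is applied to
    that slice. *)
Lemma cube_oscillation n (f : 'rV[R]_n -> R) (l : 'rV[R]_n) (h e : R) :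
  (0 < h)%R -> (0 < e)%R -> Ck 1 f ->
  exists c, \int[lebN R n]_(x in cube l h) `|f x - c|%:E <=
    h%:E * (\sum_(i < n) \int[lebN R n]_(x in cube l h) `|partial i f x|%:E) + e%:E.
Proof.
move=> h0; elim: n f l e => [f l e e0 Cf|n IHn f l e e0 Cf].
  exists (f 0%R); rewrite integral0_eq => [|x _].
    by rewrite big_ord0 mule0 add0e lee_fin ltW.
  by rewrite (_ : x = 0%R) ?subrr ?normr0//; apply/rowP; case.
set I := `[l 0 ord0, l 0 ord0 + h[%classic%R : set R.
have mI : measurable (I : set (measurableTypeR R)) by exact: measurable_itv.
have mQ' : measurable (cube (tailv l) h) by exact: measurable_cube.
pose F t := \sum_(j < n) \int[lebN R n]_(w in cube (tailv l) h)
  `|partial (lift ord0 j) f (consv (t, w))|%:E.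
have mP i : measurable_fun setT (fun x => `|partial i f x|%:E).
  by apply: measurable_abs_EFin; exact: Ck1_partial.
have mF : measurable_fun [set: measurableTypeR R] F.
  apply: emeasurable_sum => j.
  by apply: (measurable_integral_slice_l mQ' (mP (lift ord0 j))) => x.
have F0 t : 0 <= F t by apply: sume_ge0 => j _; apply: integral_ge0.
have e2 : (0 < e / 2 / h)%R by rewrite !divr_gt0.
(* The slice on which the partial derivatives along the other axes have an
   integral not exceeding the mean. *)
have [t0 t0I Ft0] := exists_le_mean (l 0%R ord0) h0 (divr_gt0 (divr_gt0 e0 (ltr0n _ 2)) h0) mF F0.
have [c Hc] := IHn _ (tailv l) _ e2 (Ck1_slice t0 Cf).
exists c.
(* A bound for $|f(t,w)-c|$ that does not depend on $t\in I$. *)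
pose G w := \int[leb]_(t in I) `|partial ord0 f (consv (t, w))|%:E +
  `|f (consv (t0, w)) - c|%:E.
have mG1 : measurable_fun setT (fun w => \int[leb]_(t in I) `|partial ord0 f (consv (t, w))|%:E).
  by apply: (measurable_integral_slice_r mI (mP ord0)) => x.
have mG2 : measurable_fun [set: 'rV[R]_n] (fun w => `|f (consv (t0, w)) - c|%:E).
  by apply: measurable_norm_EFin; apply/Ck1_continuous/Ck1_slice.
have mG : measurable_fun setT G by exact: emeasurable_funD.
have mf : measurable_fun setT (fun x => `|f x - c|%:E).
  by apply: measurable_norm_EFin; exact/Ck1_continuous.
have G0 w : 0 <= G w by rewrite adde_ge0// integral_ge0.
have IG : \int[lebN R n]_(w in cube (tailv l) h) G w <=
    \sum_(i < n.+1) \int[lebN R n.+1]_(x in cube l h) `|partial i f x|%:E + (e / h)%:E.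
  rewrite ge0_integralD//; last 3 first.
  - by move=> w _; exact: integral_ge0.
  - exact: measurable_funTS.
  - exact: measurable_funTS.
  rewrite big_ord_recl -addeA; apply: leeD.
    by rewrite cube_cons (tonelli_cons_set_sym mI mQ' (mP ord0)).
  apply: le_trans Hc _.
  under eq_bigr do under eq_integral do rewrite partial_slice.
  apply: le_trans (leeD2r _ Ft0) _.
  rewrite -addeA -EFinD ge0_integral_sum//; last 2 first.
  - move=> j; apply: measurable_funTS.
    by apply: (measurable_integral_slice_l mQ' (mP (lift ord0 j))) => x.
  - by move=> j t _; exact: integral_ge0.
  apply: leeD; last by rewrite lee_fin -mulrDl -splitr.
  apply: lee_sum => j _.
  by rewrite cube_cons (tonelli_cons_set mI mQ' (mP (lift ord0 j))).
rewrite [X in integral _ X _]cube_cons (tonelli_cons_set mI mQ' mf)//.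
have -> : h%:E * (\sum_(i < n.+1) \int[lebN R n.+1]_(x in cube l h) `|partial i f x|%:E) + e%:E =
   h%:E * (\sum_(i < n.+1) \int[lebN R n.+1]_(x in cube l h) `|partial i f x|%:E + (e / h)%:E).
  rewrite ge0_muleDr; last 2 first.
  - by apply: sume_ge0 => i _; exact: integral_ge0.
  - by rewrite lee_fin divr_ge0 ?ltW.
  by rewrite -EFinM mulrC divfK// gt_eqF.
apply: le_trans (lee_pmul _ _ (lexx _) IG); rewrite ?lee_fin ?(ltW h0)//; last first.
  exact: integral_ge0.
have <- : \int[leb]_(t in I) (cst (\int[lebN R n]_(w in cube (tailv l) h) G w)) t =
    h%:E * \int[lebN R n]_(w in cube (tailv l) h) G w.
  rewrite integral_cst//= lebesgue_measure_itv/= lte_fin ltrDl h0 -EFinB.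
  by rewrite muleC addrAC subrr add0r.
apply: ge0_le_integral => //.
- by move=> t _; exact: integral_ge0.
- apply: measurable_funTS.
  by apply: (measurable_integral_slice_l mQ' mf) => x.
- move=> t tI; apply: ge0_le_integral => //.
  + apply: measurable_funTS; apply: measurable_norm_EFin.
    exact/Ck1_continuous/Ck1_slice.
  + exact: measurable_funTS.
  move=> w _.
  rewrite (le_trans (y := `|f (consv (t, w)) - f (consv (t0, w))|%:E +
      `|f (consv (t0, w)) - c|%:E))//.
    by rewrite -EFinD lee_fin; apply: ler_distD.
  apply: leeD => //.
  apply: (osc_le_integral_deriv (f := fun s => f (consv (s, w)))
    (df := fun s => partial ord0 f (consv (s, w)))) => //.
  + by move=> s; exact: derivable_slice.
  + by move=> s; exact: derive_slice.
  + exact: continuous_partial_slice.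
  move=> x /andP[]; rewrite ge_min le_max /I/= in_itv/=.
  move: tI t0I; rewrite /I/= in_itv/=.
  move=> /andP[? ?] /andP[? ?] /orP[?|?] /orP[?|?]; apply/andP; split; lra.
Qed.

End oscillation.

Section slab.
Context (R : realType) (n : nat).
Local Open Scope ereal_scope.
Local Notation leb := (@lebesgue_measure R).

(** Every line parallel to the first axis contains a zero of $f$, hence $|f|$ is
    bounded on it by the integral of $|\partial_0 f|$ along the line, which is then
    integrated over an interval of length $h$. *)
Lemma slab_estimate (f : 'rV[R]_n.+1 -> R) l h : (0 < h)%R -> Ck 1 f ->
  (forall w, exists s, f (consv (s, w)) = 0%R) ->
  \int[lebN R n.+1]_(x in cube l h) `|f x|%:E <=
  h%:E * \int[lebN R n.+1]_x `|partial ord0 f x|%:E.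
Proof.
move=> h0 Cf f0.
set I := `[l 0%R ord0, (l 0 ord0 + h)%R[%classic : set R.
have mI : measurable (I : set (measurableTypeR R)) by exact: measurable_itv.
have mQ' : measurable (cube (tailv l) h) by exact: measurable_cube.
have mf : measurable_fun setT (fun x => `|f x|%:E).
  by apply: measurable_abs_EFin; exact: Ck1_continuous.
have mP : measurable_fun setT (fun x => `|partial ord0 f x|%:E).
  by apply: measurable_abs_EFin; exact: Ck1_partial.
have mG : measurable_fun [set: 'rV[R]_n]
    (fun w => \int[leb]_(s in setT) `|partial ord0 f (consv (s, w))|%:E).
  exact: (measurable_integral_slice_r measurableT mP).
rewrite cube_cons (tonelli_cons_set_sym mI mQ' mf)// tonelli_consv_sym//.
rewrite -ge0_integralZl_EFin//; last 2 first.
- by move=> w _; exact: integral_ge0.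
- exact: ltW.
apply: (@le_trans _ _ (\int[lebN R n]_(w in cube (tailv l) h) (h%:E *
   \int[leb]_s `|partial ord0 f (consv (s, w))|%:E))); last first.
  apply: ge0_subset_integral => //.
  - exact: measurable_funeM.
  - by move=> w _; rewrite mule_ge0 ?lee_fin ?(ltW h0)// integral_ge0.
apply: ge0_le_integral => //.
- by move=> w _; exact: integral_ge0.
- by apply: measurable_funTS; apply: (measurable_integral_slice_r mI mf).
- by apply: measurable_funTS; exact: measurable_funeM.
move=> w _; have [s fs] := f0 w.
have <- : \int[leb]_(t in I) (cst (\int[leb]_s `|partial ord0 f (consv (s, w))|%:E)) t =
    h%:E * \int[leb]_s `|partial ord0 f (consv (s, w))|%:E.
  rewrite integral_cst//= lebesgue_measure_itv/= lte_fin ltrDl h0 -EFinB.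
  by rewrite muleC addrAC subrr add0r.
apply: ge0_le_integral => //.
  apply: measurable_funTS; apply/measurable_EFinP; apply: measurableT_comp => //.
  apply: continuous_measurable_fun => t.
  apply: (@continuous_comp _ _ _ (fun s => consv (s, w)) f).
    exact: continuous_consv_l.
  exact: Ck1_continuous.
move=> t _; rewrite -[f _]subr0 -fs.
apply: (osc_le_integral_deriv (f := fun s => f (consv (s, w)))
    (df := fun s => partial ord0 f (consv (s, w)))) => //.
+ by move=> ?; exact: derivable_slice.
+ by move=> ?; exact: derive_slice.
+ exact: continuous_partial_slice.
Qed.

End slab.

(** * Step functions on dyadic grids *)
Section grid.
Context (R : realType) (n M : nat).
Local Notation V := ('rV[R]_n.+1).

Definition mesh (k : nat) : R := 2^-1 ^+ k.
(** Along each axis $[-M,M)$ is cut into $2M\cdot 2^k$ intervals. *)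
Definition grid_idx (k : nat) : finType := {ffun 'I_n.+1 -> 'I_(M.*2 * 2 ^ k)}.
Definition cell k (z : grid_idx k) : set V :=
  cube (\row_i (- M%:R + (z i)%:R * mesh k)) (mesh k).

Lemma mesh_gt0 k : 0 < mesh k. Proof. by rewrite /mesh exprn_gt0// invr_gt0. Qed.

Lemma mesh_exp2 k : mesh k * 2 ^+ k = 1.
Proof. by rewrite /mesh exprVn mulVf// expf_neq0. Qed.

Lemma measurable_cell k (z : grid_idx k) : measurable (cell z).
Proof. exact: measurable_cube. Qed.

Lemma cellE k (z : grid_idx k) x : cell z x ->
  forall i, - M%:R + (z i)%:R * mesh k <= x 0 i < - M%:R + (z i).+1%:R * mesh k.
Proof.
move=> zx i; have := zx i; rewrite /= in_itv/= mxE -addrA -natr1 mulrDl mul1r.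
by rewrite addrA.
Qed.

Lemma cell_inj k (z z' : grid_idx k) x : cell z x -> cell z' x -> z = z'.
Proof.
move=> /cellE zx /cellE z'x; apply/ffunP => i; apply/val_inj => /=.
have le (y y' : grid_idx k) : - M%:R + (y i)%:R * mesh k <= x 0 i ->
    x 0 i < - M%:R + (y' i).+1%:R * mesh k -> (y i <= y' i)%N.
  move=> yx xy'; have := le_lt_trans yx xy'.
  by rewrite ltrD2l ltr_pM2r ?mesh_gt0// ltr_nat ltnS.
have /andP[a b] := zx i; have /andP[c d] := z'x i.
by apply/eqP; rewrite eqn_leq (le z z')// (le z' z).
Qed.

Lemma cell_cover k (x : V) : (forall i, `|x 0 i| < M%:R) -> exists z : grid_idx k, cell z x.
Proof.
move=> xM.
have pos i : 0 <= (x 0 i + M%:R) * 2 ^+ k.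
  by have := xM i; rewrite ltr_norml => /andP[? ?]; rewrite mulr_ge0 ?exprn_ge0//; lra.
have lt i : (Num.truncn ((x 0 i + M%:R) * 2 ^+ k)%R < M.*2 * 2 ^ k)%N.
  rewrite truncn_lt_nat//.
  rewrite natrM natrX ltr_pM2r ?exprn_gt0// -addnn natrD.
  by have := xM i; rewrite ltr_norml => /andP[? ?]; lra.
exists [ffun i => Ordinal (lt i)] => i.
rewrite /= in_itv/= mxE ffunE /=.
have /andP[] := truncn_itv (pos i).
set t := Num.truncn _ => t1 t2.
have m0 := mesh_gt0 k.
have : t%:R * mesh k <= (x 0 i + M%:R) * 2 ^+ k * mesh k by rewrite ler_pM2r.
have : (x 0 i + M%:R) * 2 ^+ k * mesh k < t.+1%:R * mesh k by rewrite ltr_pM2r.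
rewrite -mulrA [2 ^+ k * _]mulrC mesh_exp2 mulr1 -natr1 mulrDl mul1r => ? ?.
by apply/andP; split; lra.
Qed.

Definition step k (c : grid_idx k -> R) (x : V) : R := \sum_z c z * \1_(cell z) x.

Lemma step_cell k (c : grid_idx k -> R) (z : grid_idx k) x : cell z x -> step c x = c z.
Proof.
move=> zx; rewrite /step (bigD1 z)//= indicE mem_set// mulr1 big1 ?addr0// => z' z'z.
rewrite indicE memNset ?mulr0// => z'x; move/eqP : z'z; apply.
exact: cell_inj z'x zx.
Qed.

Lemma measurable_step k (c : grid_idx k -> R) : measurable_fun setT (step c).
Proof.
apply: measurable_sum => z; apply: measurable_funM => //.
by apply: measurable_indic; exact: measurable_cell.
Qed.

Lemma step_bound k (c : grid_idx k -> R) B x : 0 <= B -> (forall z, `|c z| <= B) ->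
  `|step c x| <= B.
Proof.
move=> B0 cB; have [[z zx]|H] := pselect (exists z : grid_idx k, cell z x).
  by rewrite (step_cell _ zx).
rewrite /step big1 ?normr0// => z _; rewrite indicE memNset ?mulr0// => zx.
by apply: H; exists z.
Qed.

End grid.

Section step_approximation.
Context (R : realType) (n M : nat).
Local Notation V := ('rV[R]_n.+1).
Local Notation lebV := (lebN R n.+1).
Local Notation mesh := (mesh R).
Local Notation cell := (@cell R n M _).
Local Open Scope ereal_scope.
Implicit Types (Om : set V) (psi : V -> R).

Lemma lebN_cell k (z : grid_idx n M k) : lebV (cell z) = ((mesh k) ^+ n.+1)%:E.
Proof. by rewrite lebN_cube// ltW// mesh_gt0. Qed.

Lemma sum_cells_le k (F : V -> \bar R) : measurable_fun setT F -> (forall x, 0 <= F x) ->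
  \sum_(z : grid_idx n M k) \int[lebV]_(x in cell z) F x <= \int[lebV]_x F x.
Proof.
move=> mF F0.
have tri : trivIset [set` index_enum (grid_idx n M k)] (fun z => cell z).
  by move=> z z' _ _ [x [zx z'x]]; exact: cell_inj zx z'x.
rewrite -(ge0_integral_bigsetU lebV _ (index_enum_uniq _) tri) => [|z|//|//].
- apply: ge0_subset_integral => //.
  by apply: bigsetU_measurable => z _; exact: measurable_cell.
- exact: measurable_cell.
- exact: measurable_funTS.
Qed.

Lemma integral_le_sum_cells k Om (F : V -> \bar R) : measurable Om ->
  (forall x, Om x -> forall i, (`|x 0%R i| < M%:R)%R) ->
  measurable_fun setT F -> (forall x, 0 <= F x) ->
  \int[lebV]_(x in Om) F x <= \sum_(z : grid_idx n M k) \int[lebV]_(x in cell z) F x.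
Proof.
move=> mOm OmM mF F0.
have tri : trivIset [set` index_enum (grid_idx n M k)] (fun z => cell z).
  by move=> z z' _ _ [x [zx z'x]]; exact: cell_inj zx z'x.
rewrite -(ge0_integral_bigsetU lebV _ (index_enum_uniq _) tri) => [|z|//|//].
- apply: ge0_subset_integral => //.
  + by apply: bigsetU_measurable => z _; exact: measurable_cell.
  + exact: measurable_funTS.
  move=> x Omx; have [z zx] := cell_cover k (OmM _ Omx).
  by rewrite -bigcup_seq; exists z => //=; rewrite mem_index_enum.
- exact: measurable_cell.
- exact: measurable_funTS.
Qed.

(** The slab estimate yields coefficients of order $h^{-n}$, where the size of the
    $L^1$ norm alone would give $h^{-n-1}$; the range of exponents $q<(n+1)/n$
    depends on this gain. *)
Lemma step_approx k Om psi (W : R) : measurable Om ->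
  (forall x, Om x -> forall i, (`|x 0%R i| < M%:R)%R) ->
  Ck 1 psi -> (forall x, ~ Om x -> psi x = 0%R) -> (0 < W)%R ->
  (forall i, \int[lebV]_x `|partial i psi x|%:E <= W%:E) ->
  exists c : grid_idx n M k -> R,
    (forall z, `|c z| <= n.+3%:R * W * (2 ^+ n) ^+ k)%R /\
    \int[lebV]_(x in Om) `|psi x - step c x|%:E <= (n.+3%:R * W * mesh k)%:E.
Proof.
move=> mOm OmM Cpsi psi0 W0 pW.
have h0 := @mesh_gt0 R k; set h := mesh k in h0 *.
have n2 : (n.+2%:R = n.+1%:R + 1 :> R)%R by rewrite natr1.
have n3 : (n.+3%:R = n.+1%:R + 2 :> R)%R by rewrite -[(n.+3%:R)%R]natr1 n2; lra.
pose K := #|{: grid_idx n M k}|.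
have e0 : (0 < h * W / K.+1%:R)%R by rewrite !divr_gt0// mulr_gt0.
(* The error allowed on each cell: its sum over the $K$ cells is at most $hW$. *)
set e := (h * W / K.+1%:R)%R in e0.
have eK : (e * K.+1%:R = h * W)%R by rewrite /e divfK// pnatr_eq0.
have ehW : (e <= h * W)%R by rewrite -eK ler_peMr// ?(ltW e0)// ler1n.
have eKhW : (e *+ K <= h * W)%R by rewrite -eK -mulr_natr ler_pM2l// ler_nat.
have mP i : measurable_fun setT (fun x => `|partial i psi x|%:E).
  by apply: measurable_abs_EFin; exact: Ck1_partial.
have mpsi c : measurable_fun setT (fun x => `|psi x - c|%:E).
  by apply: measurable_norm_EFin; exact/Ck1_continuous.
have mpsi0 : measurable_fun setT (fun x => `|psi x|%:E).
  by apply: measurable_abs_EFin; exact/Ck1_continuous.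
have H z := cube_oscillation (\row_i (- M%:R + (z i)%:R * h)%R) h0 e0 Cpsi.
have {H} /choice[c Hc] : forall z : grid_idx n M k, exists c : R,
  \int[lebV]_(x in cell z) `|psi x - c|%:E <= h%:E *
   (\sum_(i < n.+1) \int[lebV]_(x in cell z) `|partial i psi x|%:E) + e%:E.
  by move=> z; exact: H.
exists c; split.
  move=> z.
  have slab : \int[lebV]_(x in cell z) `|psi x|%:E <= (h * W)%:E.
    apply: le_trans (slab_estimate _ h0 Cpsi _) _.
      move=> w; exists M%:R; apply: psi0 => /OmM/(_ ord0).
      by rewrite consv0/= ger0_norm// ltxx.
    by rewrite EFinM lee_pmul// ?lee_fin ?(ltW h0)// integral_ge0.
  have osc : \int[lebV]_(x in cell z) `|psi x - c z|%:E <= (h * (n.+1%:R * W) + h * W)%:E.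
    apply: le_trans (Hc z) _; rewrite EFinD leeD ?lee_fin//.
    rewrite EFinM; apply: lee_pmul; rewrite ?lee_fin ?(ltW h0)//.
      by apply: sume_ge0 => i _; exact: integral_ge0.
    rewrite mulr_natl -[X in (_ *+ X)%R](card_ord n.+1) -sumr_const -sumEFin.
    apply: lee_sum => i _; apply: le_trans (pW i).
    by apply: ge0_subset_integral => //; exact: measurable_cell.
  have : \int[lebV]_(x in cell z) (cst `|c z|%:E) x <= (h * (n.+3%:R * W))%:E.
    rewrite (le_trans (y := \int[lebV]_(x in cell z) (`|psi x|%:E + `|psi x - c z|%:E)))//.
      apply: ge0_le_integral => //.
      - exact: measurable_cell.
      - by move=> x _; rewrite /= lee_fin.
      - by apply: emeasurable_funD; exact: measurable_funTS.
      move=> x _; rewrite -EFinD lee_fin /=.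
      by rewrite -{1}[c z](subKr (psi x)) ler_normB.
    rewrite ge0_integralD//; first last.
    - exact: measurable_funTS.
    - exact: measurable_funTS.
    - exact: measurable_cell.
    apply: le_trans (leeD slab osc) _.
    by rewrite -EFinD lee_fin n3; lra.
  rewrite integral_cst//; last exact: measurable_cell.
  rewrite [X in (_ * X)%E](lebN_cell z) -/h -EFinM lee_fin exprS mulrCA (ler_pM2l h0).
  rewrite -exprM mulnC exprM.
  have hk : (h ^+ n * (2 ^+ k) ^+ n = 1)%R by rewrite -exprMn /h mesh_exp2 expr1n.
  move=> ineq.
  have -> : (`|c z| = (`|c z| * h ^+ n) * (2 ^+ k) ^+ n)%R.
    by rewrite -mulrA hk mulr1.
  by rewrite ler_pM2r// exprn_gt0// exprn_gt0.
have mF : measurable_fun setT (fun x => `|psi x - step c x|%:E).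
  apply/measurable_EFinP; apply: measurableT_comp => //.
  apply: measurable_funB; last exact: measurable_step.
  by apply: continuous_measurable_mx; exact: Ck1_continuous.
apply: le_trans; first exact: (@integral_le_sum_cells k _ _ mOm OmM mF).
rewrite (eq_bigr (fun z => \int[lebV]_(x in cell z) `|psi x - c z|%:E)); last first.
  by move=> z _; apply: eq_integral => x /[!inE] zx; rewrite (step_cell _ zx).
apply: le_trans; first by apply: lee_sum => z _; exact: Hc.
rewrite big_split/= -ge0_sume_distrr; last first.
  by move=> z _; apply: sume_ge0 => i _; exact: integral_ge0.
rewrite sumEFin sumr_const -/K.
have -> : (n.+3%:R * W * h = h * (n.+2%:R * W) + h * W)%R.
  by rewrite n3 n2; lra.
rewrite EFinD; apply: leeD; last by rewrite lee_fin.
rewrite EFinM; apply: lee_pmul; rewrite ?lee_fin ?(ltW h0)//.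
  by apply: sume_ge0 => z _; apply: sume_ge0 => i _; exact: integral_ge0.
rewrite exchange_big/= (@le_trans _ _ (\sum_(i < n.+1) W%:E))//.
  by apply: lee_sum => i _; apply: le_trans (pW i); exact: sum_cells_le.
rewrite sumEFin sumr_const card_ord lee_fin -[(W *+ _)%R]mulr_natl ler_pM2r// ler_nat.
by [].
Qed.

End step_approximation.

(** * Completeness and total boundedness in the space of integrable functions *)
Section series_facts.
Context (R : realType).
Local Open Scope ereal_scope.

Lemma nneseries_geometric_le (c z : R) : (0 <= c)%R -> (0 < z < 1)%R ->
  \sum_(0 <= k <oo) (c * z ^+ k)%:E <= (c / (1 - z))%:E.
Proof.
move=> c0 /andP[z0 z1].
have nn k : 0 <= (c * z ^+ k)%:E by rewrite lee_fin mulr_ge0// exprn_ge0// ltW.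
apply: lime_le; first by apply: is_cvg_nneseries => k _ _; exact: nn.
apply: nearW => m; rewrite sumEFin lee_fin.
have := @geometric_le_lim R m c z c0 z0; rewrite seriesEnat; apply.
by rewrite ger0_norm// ltW.
Qed.

Lemma nneseries_ge_term (u : nat -> \bar R) k : (forall i, 0 <= u i) ->
  u k <= \sum_(0 <= i <oo) u i.
Proof.
move=> u0; apply: le_trans (nneseries_lim_ge k.+1 (fun i _ _ => u0 i)).
by rewrite big_nat_recr//= leeDr// sume_ge0.
Qed.

Lemma limn_esup_bounds (u : nat -> \bar R) j a b :
  (forall i, (j <= i)%N -> a <= u i <= b) -> a <= limn_esup u <= b.
Proof.
move=> H; rewrite limn_esup_lim; apply/andP; split.
  apply: lime_ge; first exact: is_cvg_esups.
  apply: nearW => m; have /andP[+ _] := H _ (leq_maxr m j).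
  move=> /le_trans; apply; apply: ereal_sup_ubound.
  by exists (maxn m j) => //=; exact: leq_maxl.
apply: lime_le; first exact: is_cvg_esups.
exists j => // m /= jm; apply: ub_ereal_sup => _ [i /= mi <-].
by have /andP[] := H i (leq_trans jm mi).
Qed.

End series_facts.

Section L1_completeness.
Context d (T : measurableType d) (R : realType) (mu : {measure set T -> \bar R}).
Variables (D : set T) (mD : measurable D).
Local Open Scope ereal_scope.

Definition pointwise_limsup (v : nat -> T -> R) (x : T) : R :=
  fine (limn_esup (fun j => (v j x)%:E)).

Lemma measurable_pointwise_limsup (v : nat -> T -> R) :
  (forall j, measurable_fun D (v j)) -> measurable_fun D (pointwise_limsup v).
Proof.
move=> mv; apply: (measurableT_comp (f := fine)) => //.
by apply: measurable_fun_limn_esup => j; exact/measurable_EFinP.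
Qed.

(** The tail $\sum_{i\ge j}|v_{i+1}-v_i|$ bounds $|v_i-v_j|$ for all $i\ge j$,
    hence also $|\limsup_i v_i-v_j|$; where the tail is infinite there is nothing
    to prove, so no almost everywhere convergence has to be discussed. *)
Lemma dist_limsup_le_tail (v : nat -> T -> R) j x :
  `|v j x - pointwise_limsup v x|%:E <=
  \sum_(0 <= i <oo) `|v (j + i.+1)%N x - v (j + i)%N x|%:E.
Proof.
set S := \sum_(0 <= i <oo) _.
have S0 : 0 <= S by exact: nneseries_ge0.
have : forall i, (j <= i)%N -> (`|v i x - v j x|)%:E <= S.
  move=> i /subnKC <-; move: (i - j)%N => {}i.
  apply: le_trans (nneseries_lim_ge i (fun _ _ _ => _)); last by [].
  elim: i => [|i IH]; first by rewrite addn0 subrr normr0 sume_ge0.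
  rewrite big_nat_recr//= addeC.
  apply: le_trans (leeD (lexx _) IH); rewrite -EFinD lee_fin.
  exact: ler_distD.
move: S0; case: S => [s s0 H|_ _|//]; last by rewrite leey.
have : (v j x - s)%:E <= limn_esup (fun j => (v j x)%:E) <= (v j x + s)%:E.
  apply: (@limn_esup_bounds _ _ j) => i /H.
  rewrite !lee_fin ler_norml => /andP[? ?]; apply/andP; split; lra.
rewrite /pointwise_limsup; case: (limn_esup _) => [l| |] /=; last 2 first.
- by rewrite leye_eq andbF.
- by [].

by rewrite !lee_fin ler_norml => /andP[? ?]; apply/andP; split; lra.
Qed.

Lemma pointwise_limsup_ge0 (v : nat -> T -> R) x : (forall j, 0 <= v j x)%R ->
  (0 <= pointwise_limsup v x)%R.
Proof.
move=> v0; apply: fine_ge0.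
suff /andP[] : 0 <= limn_esup (fun j => (v j x)%:E) <= +oo by [].
by apply: (@limn_esup_bounds _ _ 0%N) => i _; rewrite lee_fin v0 leey.
Qed.

Lemma L1_complete (v : nat -> T -> R) :
  (forall j, measurable_fun D (v j)) ->
  (forall j, \int[mu]_(x in D) `|v j.+1 x - v j x|%:E <= (2^-1 ^+ j)%:E) ->
  forall j, \int[mu]_(x in D) `|v j x - pointwise_limsup v x|%:E <= (2 * 2^-1 ^+ j)%:E.
Proof.
move=> mv Hv j.
have md i k : measurable_fun D (fun x => `|v i x - v k x|%:E).
  apply/measurable_EFinP; apply: measurableT_comp => //.
  exact: measurable_funB.
apply: (@le_trans _ _ (\int[mu]_(x in D)
   \sum_(0 <= i <oo) `|v (j + i.+1)%N x - v (j + i)%N x|%:E)).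
  apply: ge0_le_integral => //.
  - apply/measurable_EFinP; apply: measurableT_comp => //.
    by apply: measurable_funB => //; exact: measurable_pointwise_limsup.
  - by apply: ge0_emeasurable_sum => //.
  - by move=> x _; exact: dist_limsup_le_tail.
rewrite integral_nneseries//.
have -> : (2 * 2^-1 ^+ j = 2^-1 ^+ j / (1 - 2^-1) :> R)%R by field.
apply: le_trans (nneseries_geometric_le _ _).
- apply: lee_nneseries => i _; first by move=> _; exact: integral_ge0.
  by rewrite addnS -exprD; exact: Hv.
- by rewrite exprn_ge0.
- by apply/andP; split; lra.
Qed.

End L1_completeness.

Section total_boundedness.
Context d (T : measurableType d) (R : realType) (mu : {measure set T -> \bar R}).
Variables (D : set T) (mD : measurable D).
Local Open Scope ereal_scope.

Lemma ultra_finite_fiber (U : set_system nat) (J : finType) (t : nat -> J) :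
  UltraFilter U -> exists j, U (t @^-1` [set j]).
Proof.
move=> UU; apply: contrapT => H.
have : \forall m \near U, forall j, t m <> j.
  apply: filter_forall => j; have [Uj|//] := in_ultra_setVsetC (t @^-1` [set j]) UU.
  by exfalso; apply: H; exists j.
by move=> /filter_ex[m /(_ (t m))].
Qed.

(** If finitely many classes suffice at every precision, then along a free
    ultrafilter one class survives at each precision; indices are picked from
    finite intersections of surviving classes. *)
Lemma finite_classes_subsequence (u : nat -> T -> R) :
  (forall e : R, (0 < e)%R -> exists (J : finType) (t : nat -> J), forall m m',
    t m = t m' -> \int[mu]_(x in D) `|u m x - u m' x|%:E <= e%:E) ->
  exists2 s : nat -> nat, {homo s : i j / (i < j)%N} &
    forall j, \int[mu]_(x in D) `|u (s j.+1) x - u (s j) x|%:E <= (2^-1 ^+ j)%:E.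
Proof.
move=> H.
(* A free ultrafilter: each of its members meets every tail of $\mathbb N$. *)
have [U [UU oU]] := @ultraFilterLemma nat \oo _.
have {H} /choice[A HA] : forall k : nat, exists A : set nat, U A /\ forall m m', A m -> A m' ->
    \int[mu]_(x in D) `|u m x - u m' x|%:E <= (2^-1 ^+ k)%:E.
  move=> k; have [|J [t tP]] := H (2^-1 ^+ k)%R; first by rewrite exprn_gt0.
  have [j Uj] := ultra_finite_fiber t UU.
  by exists (t @^-1` [set j]); split => // m m' /= tm tm'; apply: tP; rewrite tm tm'.
have /choice[next nextP] : forall q : nat * nat, exists m,
    (q.1 < m)%N /\ forall k, (k <= q.2)%N -> A k m.
  move=> [m0 K] /=.
  have UA : \forall m \near U, forall k : 'I_K.+1, A k m.
    by apply: filter_forall => k; exact: (HA k).1.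
  have Um : U [set m | (m0 < m)%N] by apply: oU; exists m0.+1.
  have [m [/= m0m Am]] := filter_ex (filterI Um UA).
  exists m; split => // k; rewrite -ltnS => kK; exact: (Am (Ordinal kK)).
pose s := fix s j := if j is j'.+1 then next (s j', j'.+1) else next (0%N, 0%N).
have sA j k : (k <= j)%N -> A k (s j).
  by case: j => [|j] kj /=; exact: (nextP (_, _)).2.
exists s.
  apply: homo_ltn; first by move=> ? ? ?; exact: ltn_trans.
  by move=> j /=; exact: (nextP (s j, j.+1)).1.
by move=> j; apply: (HA j).2; exact: sA.
Qed.

End total_boundedness.

(** * Higher integrability from step approximations *)
Lemma cvge0P (R : realType) (u : nat -> \bar R) : (forall j, 0 <= u j)%E ->
  (u @ \oo --> 0)%E <-> forall e : R, 0 < e -> \forall j \near \oo, (u j <= e%:E)%E.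
Proof.
move=> u0; split.
  move=> /fine_cvgP[ufin /cvgrPdist_le ucv] e e0.
  near=> j; rewrite -[u j]fineK; last by near: j.
  rewrite lee_fin; have : `|0 - (fine \o u) j| <= e by near: j; exact: ucv.
  by rewrite sub0r normrN => /(le_trans (ler_norm _)).
move=> H; apply/fine_cvgP; split.
  near=> j; rewrite ge0_fin_numE//; apply: le_lt_trans (ltry 1).
  by near: j; exact: H.
apply/cvgrPdist_le => e e0; near=> j.
rewrite sub0r normrN /= ger0_norm ?fine_ge0//.
have ue : (u j <= e%:E)%E by near: j; exact: H.
rewrite -lee_fin fineK// ge0_fin_numE//; exact: le_lt_trans (ltry e).
Unshelve. all: by end_near. Qed.

Section Lq_from_steps.
Context d (T : measurableType d) (R : realType) (mu : {measure set T -> \bar R}).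
Variables (D : set T) (mD : measurable D) (muD : (mu D < +oo)%E).

(** The bounds obtained on the grids of mesh $2^{-k}$, stated without the grids. *)
Definition step_rate (n : nat) (C : R) (f : T -> R) (g : nat -> T -> R) :=
  forall k, [/\ measurable_fun D (g k),
    forall x, `|g k x| <= C * (2 ^+ n) ^+ k &
    (\int[mu]_(x in D) `|f x - g k x|%:E <= (C * 2^-1 ^+ k)%:E)%E].

Let height (n : nat) (C : R) k : R := 2 * C * (2 ^+ n) ^+ k.

(** If $2C2^{nk}<|f|\le 2C2^{n(k+1)}$ then $|g_k|\le|f|/2$, so
    $|f|\le 2|f-g_k|$: only the $k$-th approximation error pays for $|f|^q$ at
    this height. *)
Lemma powR_le_steps n C q (f : T -> R) (g : nat -> T -> R) x : (0 < n)%N ->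
  0 < C -> 1 <= q -> (forall k, `|g k x| <= C * (2 ^+ n) ^+ k) ->
  ((`|f x| `^ q)%:E <= (height n C 0 `^ q)%:E +
    \sum_(0 <= k <oo) (2 * height n C k.+1 `^ (q - 1))%:E * `|f x - g k x|%:E)%E.
Proof.
move=> n0 C0 q1 gx.
have term0 k : (0 <= (2 * height n C k.+1 `^ (q - 1))%:E * `|f x - g k x|%:E)%E.
  by rewrite -EFinM lee_fin !mulr_ge0// powR_ge0.
have S0 : (0 <= \sum_(0 <= k <oo) (2 * height n C k.+1 `^ (q - 1))%:E * `|f x - g k x|%:E)%E.
  by apply: nneseries_ge0 => k _ _; exact: term0.
have q0 : 0 <= q by lra.
have height_gt0 k : 0 < height n C k by rewrite /height !mulr_gt0// exprn_gt0// exprn_gt0.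
have [small|big] := leP `|f x| (height n C 0).
  apply: (@le_trans _ _ (height n C 0 `^ q)%:E); last by rewrite leeDl.
  by rewrite lee_fin ge0_ler_powR// nnegrE// ltW.
have ex : exists m, `|f x| <= height n C m.
  have [m fm] : exists m : nat, `|f x| / (2 * C) < m%:R.
    by exists (Num.truncn (`|f x| / (2 * C))).+1; exact: truncnS_gt.
  exists m; rewrite /height mulrC -ler_pdivrMr ?mulr_gt0//; apply: ltW.
  apply: lt_le_trans fm _.
  rewrite -exprM -natrX ler_nat (leq_trans (ltnW (ltn_expl m (ltnSn 1))))//.
  by rewrite leq_exp2l// leq_pmull.
have := ex_minnP ex; case; case => [|k] fk mink.
  by move: big; rewrite ltNge fk.
have kf : height n C k < `|f x|.
  by rewrite ltNge; apply/negP => /mink; rewrite ltnn.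
have f0 : 0 < `|f x| by exact: lt_trans kf.
have f2 : `|f x| <= 2 * `|f x - g k x|.
  have := gx k; have : `|f x| <= `|f x - g k x| + `|g k x|.
    by rewrite -{1}(subrK (g k x) (f x)) ler_normD.
  by move: kf; rewrite /height; lra.
rewrite -[X in (X <= _)%E]add0e; apply: leeD; first by rewrite lee_fin powR_ge0.
apply: le_trans (nneseries_ge_term k term0).
rewrite -EFinM lee_fin.
have -> : `|f x| `^ q = `|f x| * `|f x| `^ (q - 1).
  by rewrite -{2}(powRr1 (ltW f0)) -powRD ?(gt_eqF f0) ?implybT// addrC subrK.
rewrite mulrAC; apply: ler_pM => //; rewrite ?powR_ge0//.
by apply: ge0_ler_powR; rewrite ?subr_ge0 ?nnegrE// ltW.
Qed.

(** Integrating [powR_le_steps] leaves a geometric series of ratio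
    $2^{n(q-1)}/2$, which is less than $1$ because $q<(n+1)/n$. *)
Lemma Lq_bound n C q : (0 < n)%N -> 0 < C -> 1 <= q < n.+1%:R / n%:R ->
  exists B : R, forall f g, measurable_fun D f -> step_rate n C f g ->
    (\int[mu]_(x in D) (`|f x| `^ q)%:E <= B%:E)%E.
Proof.
move=> n0 C0 /andP[q1 qn].
have n0R : (0 : R) < n%:R by rewrite ltr0n.
pose sg : R := (2 ^+ n) `^ (q - 1).
have sg0 : 0 < sg by rewrite powR_gt0// exprn_gt0.
have sg2 : sg < 2.
  rewrite /sg -powR_mulrn// -powRrM -[ltRHS]powRr1// /powR pnatr_eq0/= ltr_expR.
  rewrite ltr_pM2r ?ln_gt0 ?ltr1n//.
  by move: qn; rewrite ltr_pdivlMr// -natr1; lra.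
have nD : (0 <= mu D)%E by exact: measure_ge0.
have muDE : mu D = (fine (mu D))%:E by rewrite fineK// ge0_fin_numE.
pose K := 2 * (2 * C) `^ (q - 1) * sg * C.
exists (height n C 0 `^ q * fine (mu D) + K / (1 - sg / 2)) => f g mf Hg.
have mdist k : measurable_fun D (fun x => `|f x - g k x|%:E).
  have [mg _ _] := Hg k.
  by apply/measurable_EFinP; apply: measurableT_comp => //; exact: measurable_funB.
have c0 k : 0 <= 2 * height n C k.+1 `^ (q - 1) by rewrite mulr_ge0// powR_ge0.
have mterm k : measurable_fun D (fun x =>
    ((2 * height n C k.+1 `^ (q - 1))%:E * `|f x - g k x|%:E)%E).
  exact: measurable_funeM.
have term0 k x : (0 <= (2 * height n C k.+1 `^ (q - 1))%:E * `|f x - g k x|%:E)%E.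
  by rewrite -EFinM lee_fin mulr_ge0.
apply: (@le_trans _ _ (\int[mu]_(x in D) ((height n C 0 `^ q)%:E +
    \sum_(0 <= k <oo) (2 * height n C k.+1 `^ (q - 1))%:E * `|f x - g k x|%:E)))%E.
  apply: ge0_le_integral => //.
  - apply/measurable_EFinP; apply: (measurableT_comp (measurable_powR _)).
    exact: measurableT_comp.
  - by apply: emeasurable_funD => //; exact: ge0_emeasurable_sum.
  - by move=> x _; apply: powR_le_steps => // k; case: (Hg k).
rewrite ge0_integralD//; last 3 first.
- by move=> x _; rewrite lee_fin powR_ge0.
- by move=> x _; apply: nneseries_ge0 => k _ _; exact: term0.
- by apply: ge0_emeasurable_sum => //.
rewrite integral_cst// muDE -EFinM EFinD leeD2l//.
rewrite integral_nneseries//.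
apply: le_trans (nneseries_geometric_le _ _).
- apply: lee_nneseries => k _; first by move=> _; exact: integral_ge0.
  rewrite ge0_integralZl_EFin//.
  have [_ _ Hk] := Hg k.
  apply: le_trans (lee_pmul _ _ (lexx _) Hk) _.
  - by rewrite lee_fin.
  - exact: integral_ge0.
  rewrite -EFinM lee_fin le_eqVlt; apply/orP; left; apply/eqP.
  rewrite /K /height powRM ?exprn_ge0 ?mulr_ge0 ?(ltW C0)//.
  have -> : ((2 ^+ n) ^+ k.+1) `^ (q - 1) = sg ^+ k.+1 :> R.
    by rewrite /sg -[RHS]powR_mulrn ?powR_ge0// -powRrM mulrC powRrM powR_mulrn ?exprn_ge0.
  by rewrite exprMn exprS; ring.
- by rewrite /K !mulr_ge0 ?powR_ge0 ?(ltW C0) ?(ltW sg0).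
- by apply/andP; split; lra.
Qed.

(** Boundedness of $\int|v_j|^{q'}$ for some $q'>q$ turns convergence to $0$ in
    $L^1$ into convergence in $L^q$, by
    $t^q\le K^{q-1}t+K^{q-q'}t^{q'}$. *)
Lemma cvg_Lq_interpolation q q' B (v : nat -> T -> R) : 1 <= q < q' ->
  (forall j, measurable_fun D (v j)) ->
  (\int[mu]_(x in D) `|v j x|%:E @[j --> \oo] --> 0)%E ->
  (forall j, \int[mu]_(x in D) (`|v j x| `^ q')%:E <= B%:E)%E ->
  (\int[mu]_(x in D) (`|v j x| `^ q)%:E @[j --> \oo] --> 0)%E.
Proof.
move=> /andP[q1 qq'] mv v0 vB.
have mabs j : measurable_fun D (fun x => `|v j x|) by exact: measurableT_comp.
have mpow j s : measurable_fun D (fun x => (`|v j x| `^ s)%:E).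
  by apply/measurable_EFinP; apply: (measurableT_comp (measurable_powR _)).
have B0 : 0 <= B.
  by rewrite -lee_fin; apply: le_trans (vB 0%N); apply: integral_ge0 => x _; rewrite lee_fin powR_ge0.
have split j K : 0 < K -> (\int[mu]_(x in D) (`|v j x| `^ q)%:E <=
    (K `^ (q - 1))%:E * \int[mu]_(x in D) `|v j x|%:E + (K `^ (q - q') * B)%:E)%E.
  move=> K0.
  rewrite EFinM; apply: (@le_trans _ _ ((K `^ (q - 1))%:E * \int[mu]_(x in D) `|v j x|%:E +
      (K `^ (q - q'))%:E * \int[mu]_(x in D) (`|v j x| `^ q')%:E)%E); last first.
    by rewrite leeD2l// lee_pmul ?lee_fin ?powR_ge0//; apply: integral_ge0 => x _; rewrite lee_fin powR_ge0.
  have p0 x s : (0 <= (`|v j x| `^ s)%:E)%E by rewrite lee_fin powR_ge0.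
  have mv1 : measurable_fun D (fun x => `|v j x|%:E) by exact/measurable_EFinP.
  rewrite -(ge0_integralZl_EFin _ mD _ mv1) ?powR_ge0//.
  rewrite -(ge0_integralZl_EFin _ mD _ (mpow j q')) ?powR_ge0//.
  rewrite -(ge0_integralD _ mD); last 4 first.
  - by move=> x _; rewrite -EFinM lee_fin mulr_ge0 ?powR_ge0.
  - exact: measurable_funeM.
  - by move=> x _; rewrite -EFinM lee_fin mulr_ge0 ?powR_ge0.
  - exact: measurable_funeM.
  apply: ge0_le_integral => //.
  - by apply: emeasurable_funD; exact: measurable_funeM.
  move=> x _; rewrite -!EFinM -EFinD lee_fin.
  have [->|vx0] := eqVneq `|v j x| 0.
    rewrite powR0; last by lra. by rewrite mulr0 add0r mulr_ge0 ?powR_ge0.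
  have {}vx0 : 0 < `|v j x| by rewrite lt_neqAle eq_sym vx0 normr_ge0.
  have [vK|Kv] := leP `|v j x| K.
    rewrite -[leLHS]addr0 lerD ?mulr_ge0 ?powR_ge0//.
    have -> : `|v j x| `^ q = `|v j x| `^ (q - 1) * `|v j x|.
      by rewrite -{3}(powRr1 (ltW vx0)) -powRD ?(gt_eqF vx0) ?implybT// subrK.
    by rewrite ler_pM2r//; apply: ge0_ler_powR; rewrite ?nnegrE ?subr_ge0// ltW.
  rewrite -[leLHS]add0r lerD ?mulr_ge0 ?powR_ge0//.
  have -> : `|v j x| `^ q = `|v j x| `^ (q - q') * `|v j x| `^ q'.
    by rewrite -powRD ?(gt_eqF vx0) ?implybT// subrK.
  rewrite ler_pM2r ?powR_gt0// -opprB !powRN lef_pV2 ?posrE ?powR_gt0//.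
  by apply: ge0_ler_powR; rewrite ?nnegrE ?subr_ge0// ltW.
have p0 j s : (0 <= \int[mu]_(x in D) (`|v j x| `^ s)%:E)%E.
  by apply: integral_ge0 => x _; rewrite lee_fin powR_ge0.
apply/cvge0P => // e e0.
have [K K0 KB] : exists2 K : R, 0 < K & K `^ (q - q') * B <= e / 2.
  have [e1 e1' ] : exists2 e1, 0 < e1 & e1 * B <= e / 2.
    exists (e / 2 / (B + 1)); first by rewrite !divr_gt0//; lra.
    by rewrite mulrAC ler_pdivrMr ?ler_pM2l; lra.
  (* The exponent $q-q'$ is negative: this is a large height when $e_1$ is small. *)
  exists (e1 `^ (q - q')^-1); first by rewrite powR_gt0.
  by rewrite -powRrM mulVf ?powRr1 ?(ltW e1')//; lra.
have c0 : 0 < K `^ (q - 1) by rewrite powR_gt0.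
have n0 j : (0 <= \int[mu]_(x in D) `|v j x|%:E)%E by exact: integral_ge0.
have H : \forall j \near \oo, (\int[mu]_(x in D) `|v j x|%:E <= (e / 2 / K `^ (q - 1))%:E)%E.
  by apply: (cvge0P n0).1 => //; rewrite !divr_gt0.
near=> j.
apply: le_trans (split j K K0) _.
rewrite [e in leRHS]splitr EFinD leeD ?lee_fin//.
have Hj : (\int[mu]_(x in D) `|v j x|%:E <= (e / 2 / K `^ (q - 1))%:E)%E by near: j.
by rewrite -lee_pdivlMl// muleC -EFinM.
Unshelve. all: by end_near. Qed.
End Lq_from_steps.

(** * Density of continuous functions *)
Section continuous_density.
Context (R : realType) (n : nat).
Local Notation V := ('rV[R]_n).
Local Notation leb := (lebN R n).
Variables (D : set V) (mD : measurable D) (finD : (leb D < +oo)%E).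
Local Open Scope ereal_scope.

Lemma L1_triangle (f g h : V -> R) : measurable_fun D f -> measurable_fun D g ->
  measurable_fun D h ->
  \int[leb]_(x in D) `|f x - h x|%:E <=
  \int[leb]_(x in D) `|f x - g x|%:E + \int[leb]_(x in D) `|g x - h x|%:E.
Proof.
move=> mf mg mh.
have md (u v : V -> R) : measurable_fun D u -> measurable_fun D v ->
    measurable_fun D (fun x => `|u x - v x|%:E).
  by move=> mu mv; apply/measurable_EFinP; apply: measurableT_comp => //; exact: measurable_funB.
rewrite -ge0_integralD//; [|exact: md|exact: md].
apply: ge0_le_integral => //; [exact: md|by apply: emeasurable_funD; exact: md|].
by move=> x _; rewrite -EFinD lee_fin; exact: ler_distD.
Qed.

Lemma bounded_cvg_L1 (h : nat -> V -> R) : (forall k, measurable_fun D (h k)) ->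
  (forall k x, D x -> `|h k x| <= 1)%R ->
  (forall x, D x -> exists m, forall k, (m <= k)%N -> h k x = 0%R) ->
  forall e : R, (0 < e)%R -> exists k, \int[leb]_(x in D) `|h k x|%:E <= e%:E.
Proof.
move=> mh h1 h0 e e0.
have mabs k : measurable_fun D (fun x => `|h k x|%:E).
  by apply/measurable_EFinP; exact: measurableT_comp.
have H : \int[leb]_(x in D) `|h k x|%:E @[k --> \oo] --> \int[leb]_(x in D) (cst 0 x : \bar R).
  apply: (@dominated_cvg _ _ _ leb D mD _ (cst 0) (cst 1)) => //.
  - move=> x Dx; have [m hm] := h0 _ Dx; apply: cvg_near_cst.
    by exists m => // k /= mk; rewrite hm// normr0.
  - apply/integrableP; split=> //.
    rewrite (eq_integral (cst 1)) => [|x _]; last by rewrite /= normr1.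
    by rewrite integral_cst// mul1e.
  - by move=> k x Dx; rewrite abse_EFin normr_id lee_fin h1.
rewrite integral0 in H.
have n0 k : 0 <= \int[leb]_(x in D) `|h k x|%:E by exact: integral_ge0.
have [m _ Hm] := (cvge0P n0).1 H _ e0.
by exists m; apply: Hm => /=.
Qed.

Definition L1_approx_cont (f : V -> R) := measurable_fun D f /\
  forall e : R, (0 < e)%R ->
    exists2 g, continuous g & \int[leb]_(x in D) `|f x - g x|%:E <= e%:E.

Lemma L1_approx_cont_continuous (f : V -> R) : continuous f -> L1_approx_cont f.
Proof.
move=> cf; split; first by apply: measurable_funTS; exact: continuous_measurable_mx.
move=> e e0; exists f => //.
by rewrite integral0_eq ?lee_fin ?ltW// => x _; rewrite subrr normr0.
Qed.

Lemma L1_approx_cont_lim (f : V -> R) : measurable_fun D f ->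
  (forall e : R, (0 < e)%R -> exists2 g, L1_approx_cont g &
    \int[leb]_(x in D) `|f x - g x|%:E <= e%:E) -> L1_approx_cont f.
Proof.
move=> mf H; split => // e e0.
have [g [mg Hg] fg] := H _ (divr_gt0 e0 (ltr0n _ 2)).
have [h ch gh] := Hg _ (divr_gt0 e0 (ltr0n _ 2)).
exists h => //; apply: le_trans (L1_triangle mf mg _) _.
  by apply: measurable_funTS; exact: continuous_measurable_mx.
by rewrite [e in leRHS]splitr EFinD leeD.
Qed.

Lemma L1_approx_contD (f g : V -> R) : L1_approx_cont f -> L1_approx_cont g ->
  L1_approx_cont (fun x => f x + g x)%R.
Proof.
move=> [mf Hf] [mg Hg]; split; first exact: measurable_funD.
move=> e e0.
have [f' cf' ff'] := Hf _ (divr_gt0 e0 (ltr0n _ 2)).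
have [g' cg' gg'] := Hg _ (divr_gt0 e0 (ltr0n _ 2)).
have mf' : measurable_fun D f' by apply: measurable_funTS; exact: continuous_measurable_mx.
have mg' : measurable_fun D g' by apply: measurable_funTS; exact: continuous_measurable_mx.
exists (fun x => f' x + g' x)%R; first by move=> x; exact: (cvgD (cf' x) (cg' x)).
have md (u v : V -> R) : measurable_fun D u -> measurable_fun D v ->
    measurable_fun D (fun x => `|u x - v x|%:E).
  by move=> mu mv; apply/measurable_EFinP; apply: measurableT_comp => //; exact: measurable_funB.
rewrite [e in leRHS]splitr EFinD; apply: le_trans (leeD ff' gg').
rewrite -ge0_integralD//; [|exact: md|exact: md].
apply: ge0_le_integral => //.
- by apply: md; exact: measurable_funD.
- by apply: emeasurable_funD; exact: md.
- by move=> x _; rewrite -EFinD lee_fin opprD addrACA ler_normD.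
Qed.

Lemma L1_approx_contZ (c : R) (f : V -> R) : L1_approx_cont f -> L1_approx_cont (fun x => c * f x)%R.
Proof.
move=> [mf Hf]; split; first exact: measurable_funM.
move=> e e0.
have c0 : (0 < `|c| + 1)%R by rewrite ltr_pwDr.
have [f' cf' ff'] := Hf _ (divr_gt0 e0 c0).
have mf' : measurable_fun D f' by apply: measurable_funTS; exact: continuous_measurable_mx.
exists (fun x => c * f' x)%R; first by move=> x; exact: (cvgM (cvg_cst _) (cf' x)).
rewrite (eq_integral (fun x => `|c|%:E * `|f x - f' x|%:E)); last first.
  by move=> x _; rewrite -mulrBr normrM EFinM.
rewrite ge0_integralZl_EFin//; last first.
  by apply/measurable_EFinP; apply: measurableT_comp => //; exact: measurable_funB.
apply: le_trans (lee_pmul _ _ (lexx _) ff') _; first by rewrite lee_fin.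
  exact: integral_ge0.
by rewrite -EFinM lee_fin mulrCA ler_piMr ?(ltW e0)// ler_pdivrMr// mul1r lerDl.
Qed.

Lemma L1_approx_cont_sum (I : Type) (s : seq I) (F : I -> V -> R) :
  (forall i, L1_approx_cont (F i)) -> L1_approx_cont (fun x => \sum_(i <- s) F i x)%R.
Proof.
move=> HF; elim: s => [|i s IH].
  rewrite (_ : (fun x => _) = cst 0%R); last by apply/funext => x; rewrite big_nil.
  by apply: L1_approx_cont_continuous; exact: cst_continuous.
rewrite (_ : (fun x => _) = fun x => F i x + \sum_(i <- s) F i x)%R.
  exact: L1_approx_contD.
by apply/funext => x; rewrite big_cons.
Qed.

(** The distance to the complement, cut off at height $1/k$, approximates the
    indicator of an open set. *)
Lemma L1_approx_cont_open (U : set V) : open U -> L1_approx_cont \1_U.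
Proof.
move=> oU; have mU : measurable U by exact: open_measurable_mx.
apply: L1_approx_cont_lim; first exact: measurable_indic.
move=> e e0.
have [U0|/set0P[a Ua]] := eqVneq (~` U) set0.
  exists (cst 1%R); first by apply: L1_approx_cont_continuous; exact: cst_continuous.
  rewrite integral0_eq ?lee_fin ?ltW// => x _.
  by rewrite indicE mem_set ?subrr ?normr0// -[U]setCK U0.
pose dist (x : V) : R := fine (edist_inf (~` U) x).
have dfin x : edist_inf (~` U) x \is a fin_num.
  rewrite ge0_fin_numE ?edist_inf_ge0//; apply: le_lt_trans.
    by apply: ereal_inf_lbound; exists a.
  rewrite -ge0_fin_numE ?edist_ge0//; apply/edist_finP => /=.
  exists (`|x - a| + 1)%R; first by rewrite ltr_wpDl.
  by rewrite -ball_normE /= ltrDl.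
have cdist : continuous dist.
  move=> x; apply: fine_cvg; first exact: nbhs_filter.
  by rewrite /dist fineK//; exact: edist_inf_continuous.
have dist0 x : ~ U x -> dist x = 0%R by move=> Ux; rewrite /dist edist_inf0.
have dist_gt0 x : U x -> (0 < dist x)%R.
  move=> Ux; rewrite fine_gt0//; apply/andP; split; last by rewrite -ge0_fin_numE ?edist_inf_ge0.
  have /nbhs_ballP[r /= r0 rU] : nbhs x U by exact: open_nbhs_nbhs.
  apply: (@lt_le_trans _ _ r%:E); first by rewrite lte_fin.
  apply: le_ereal_inf_tmp => _ [y /= Uy <-]; rewrite leNgt; apply/negP => /edist_lt_ball /rU.
  exact: Uy.
have dist_ge0 x : (0 <= dist x)%R by rewrite fine_ge0// edist_inf_ge0.
pose g (k : nat) (x : V) : R := (Num.min (k%:R * dist x) 1)%R.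
have cg k : continuous (g k).
  move=> x; apply: (@continuous_min _ _ (fun x => k%:R * dist x)%R (cst 1%R) x).
    2: exact: cst_continuous.
  exact: (cvgM (cvg_cst _) (cdist x)).
have [k Hk] : exists k, \int[leb]_(x in D) `|\1_U x - g k x|%:E <= e%:E.
  apply: (@bounded_cvg_L1 (fun k x => \1_U x - g k x)%R) => //.
  - move=> k; apply: measurable_funB; first exact: measurable_indic.
    by apply: measurable_funTS; exact: continuous_measurable_mx.
  - move=> k x _; rewrite indicE /g.
    have ? : (0 <= k%:R * dist x)%R by rewrite mulr_ge0.
    by case: (x \in U) => /=; case: (leP (k%:R * dist x)%R 1%R) => ?; rewrite ler_norml; apply/andP; split; lra.
  - move=> x _; have [Ux|Ux] := pselect (U x); last first.
      by exists 0%N => k _; rewrite indicE memNset// /g dist0// mulr0 min_l ?subrr.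
    exists (Num.truncn (dist x)^-1).+1 => k tk.
    rewrite indicE mem_set// /g min_r ?subrr//.
    have dx := dist_gt0 _ Ux.
    rewrite -ler_pdivrMr// div1r; apply: ltW; apply: lt_le_trans (truncnS_gt _) _.
    by rewrite ler_nat.
by exists (g k) => //; exact: L1_approx_cont_continuous.
Qed.

Lemma L1_approx_cont_indic (A : set V) : measurable A -> L1_approx_cont \1_A.
Proof.
(* The sets whose indicator is a limit of continuous functions form a Dynkin
   system, and the open sets are stable under intersection. *)
apply: (@dynkin_induction _ V (@open V) (fun A => L1_approx_cont \1_A)) => //.
- exact: openI.
- by apply: L1_approx_cont_open; exact: openT.
- exact: L1_approx_cont_open.
- move=> S mS HS.
  rewrite (_ : \1_(~` S) = fun x => 1 + (-1) * \1_S x)%R.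
    apply: L1_approx_contD; last exact: L1_approx_contZ.
    by apply: L1_approx_cont_continuous; exact: cst_continuous.
  by apply/funext => x; rewrite !indicE in_setC; case: (x \in S) => /=; lra.
move=> F mF tF HF; apply: L1_approx_cont_lim.
  by apply: measurable_indic; exact: bigcupT_measurable.
move=> e e0.
have sumE x m k : F m x -> (\sum_(i < k) \1_(F i) x = (m < k)%:R :> R)%R.
  move=> Fmx; have Fi i : \1_(F i) x = (i == m)%:R :> R.
    rewrite indicE; case: eqVneq => [->|im]; first by rewrite mem_set.
    rewrite memNset// => Fix; move/eqP : im; apply.
    by apply: tF => //; exists x.
  have [mk|km] := ltnP m k.
    rewrite (bigD1 (Ordinal mk))//= big1 ?addr0; first by rewrite Fi eqxx.
    by move=> i im; rewrite Fi; case: eqP => // im'; case/eqP: im; exact: val_inj.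
  by rewrite big1// => i _; rewrite Fi ltn_eqF// (leq_trans (ltn_ord i)).
have sum0 x k : (forall m, ~ F m x) -> (\sum_(i < k) \1_(F i) x = 0 :> R)%R.
  by move=> nF; rewrite big1// => i _; rewrite indicE memNset.
have [k Hk] : exists k, \int[leb]_(x in D) `|\1_(\bigcup_i F i) x - \sum_(i < k) \1_(F i) x|%:E <= e%:E.
  apply: (@bounded_cvg_L1 (fun k x => \1_(\bigcup_i F i) x - \sum_(i < k) \1_(F i) x)%R) => //.
  - move=> k; apply: measurable_funB.
      by apply: measurable_indic; exact: bigcupT_measurable.
    by apply: measurable_sum => i; exact: measurable_indic.
  - move=> k x _; have [[m _ Fmx]|nF] := pselect ((\bigcup_i F i) x).
      rewrite indicE mem_set//; last by exists m.
      by rewrite (sumE _ _ _ Fmx); case: (_ < _)%N => /=; rewrite ?subrr ?subr0 ?normr0 ?normr1.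
    rewrite indicE memNset// sum0 ?subrr ?normr0// => m Fm.
    by apply: nF; exists m.
  - move=> x _; have [[m _ Fmx]|nF] := pselect ((\bigcup_i F i) x).
      exists m.+1 => k mk; rewrite indicE mem_set//; last by exists m.
      by rewrite (sumE _ _ _ Fmx) mk subrr.
    exists 0%N => k _; rewrite indicE memNset// sum0 ?subrr// => m Fm.
    by apply: nF; exists m.
exists (fun x => \sum_(i < k) \1_(F i) x)%R => //.
exact: L1_approx_cont_sum.
Qed.

Import HBSimple.

Lemma continuous_dense_L1 (f : V -> R) : leb.-integrable D (EFin \o f) ->
  L1_approx_cont f.
Proof.
move=> intf; have mf : measurable_fun D f.
  by apply/measurable_EFinP; exact: measurable_int intf.
apply: L1_approx_cont_lim => // e e0.
have [g [_ _ gf]] := approximation_sfun_integrable mD intf.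
have n0 k : 0 <= \int[leb]_(z in D) `|(EFin \o f) z - (g k z)%:E| by exact: integral_ge0.
have [m _ Hm] := (cvge0P n0).1 gf _ e0.
exists (g m); last exact: (Hm m (leqnn m)).
rewrite (_ : HBSimple.SimpleFun.sort (g m) =
    fun x => \sum_(y \in range (g m)) y * \1_(g m @^-1` [set y]) x)%R; last first.
  by apply/funext => x; rewrite -fimfunE.
rewrite (_ : (fun x => _) = fun x => \sum_(y <- finmap.enum_fset (fset_set (range (g m)))) y * \1_(g m @^-1` [set y]) x)%R.
  apply: L1_approx_cont_sum => y; apply: L1_approx_contZ.
  apply: L1_approx_cont_indic.
  by rewrite -[X in measurable X]setTI; exact: (measurable_funP (g m)).
by apply/funext => x; rewrite fsbig_finite.
Qed.

End continuous_density.

(** * A maximal inequality on dyadic grids *)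
Lemma measure_bigsetU_cond_le d (T : measurableType d) (R : realType)
    (mu : {measure set T -> \bar R}) (I : Type) (s : seq I) (P : pred I) (F : I -> set T) :
  (forall i, measurable (F i)) ->
  (mu (\big[setU/set0]_(i <- s | P i) F i) <= \sum_(i <- s | P i) mu (F i))%E.
Proof.
move=> mF; elim: s => [|i s IH]; first by rewrite !big_nil measure0.
rewrite !big_cons; case: ifP => // _.
apply: le_trans (measureU2 _ _ _) _ => //; last by rewrite leeD2l.
exact: bigsetU_measurable.
Qed.

Section maximal_inequality.
Context (R : realType) (n M : nat).
Local Notation V := ('rV[R]_n.+1).
Local Notation lebV := (lebN R n.+1).
Local Notation mesh := (mesh R).
Local Notation cell := (@cell R n M _).
Local Notation idx := (grid_idx n M).

(** Inclusion of dyadic cells, read on their indices. *)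
Definition ancestor j k (y : idx j) (z : idx k) : bool :=
  (j <= k)%N && [forall i, z i %/ 2 ^ (k - j) == y i]%N.

Lemma ancestor_refl k (z : idx k) : ancestor z z.
Proof. by rewrite /ancestor leqnn; apply/forallP => i; rewrite subnn divn1. Qed.

Lemma ancestor_trans i j k (x : idx i) (y : idx j) (z : idx k) :
  ancestor x y -> ancestor y z -> ancestor x z.
Proof.
move=> /andP[ij /forallP xy] /andP[jk /forallP yz].
rewrite /ancestor (leq_trans ij jk); apply/forallP => l.
rewrite -(eqP (xy l)) -(eqP (yz l)) -divnMA -expnD.
by rewrite addnBA// subnK.
Qed.

Lemma meshB j k : (j <= k)%N -> mesh j = (2 ^ (k - j))%:R * mesh k.
Proof.
move=> jk; have E : 2^-1 ^+ k = 2^-1 ^+ j * 2^-1 ^+ (k - j) :> R.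
  by rewrite -exprD subnKC.
rewrite /mesh E mulrCA natrX -exprMn.
by rewrite mulfV ?expr1n ?mulr1// pnatr_eq0.
Qed.

Lemma ancestor_bounds j k (y : idx j) (z : idx k) i : ancestor y z ->
  (y i)%:R * mesh j <= (z i)%:R * mesh k /\
  (z i).+1%:R * mesh k <= (y i).+1%:R * mesh j.
Proof.
move=> /andP[jk /forallP/(_ i)/eqP <-].
rewrite (meshB jk) !mulrA -!natrM !ler_pM2r ?mesh_gt0// !ler_nat.
by split; [exact: leq_divM|rewrite ltn_ceil// expn_gt0].
Qed.

Lemma meet_ancestor j k (y : idx j) (z : idx k) x : (j <= k)%N ->
  cell y x -> cell z x -> ancestor y z.
Proof.
move=> jk /cellE yx /cellE zx; rewrite /ancestor jk; apply/forallP => i.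
have /andP[y1 y2] := yx i; have /andP[z1 z2] := zx i.
have p0 : (0 < 2 ^ (k - j))%N by rewrite expn_gt0.
have le1 : (y i * 2 ^ (k - j) < (z i).+1)%N.
  rewrite -(ltr_nat R) natrM -(ltr_pM2r (@mesh_gt0 R k)) -mulrA -(meshB jk).
  by have := le_lt_trans y1 z2; rewrite ltrD2l.
have le2 : (z i < (y i).+1 * 2 ^ (k - j))%N.
  rewrite -(ltr_nat R) natrM -(ltr_pM2r (@mesh_gt0 R k)) -mulrA -(meshB jk).
  by have := le_lt_trans z1 y2; rewrite ltrD2l.
by rewrite eqn_leq -ltnS ltn_divLR// le2 leq_divRL.
Qed.

(** A cell dilated threefold about its center. *)
Definition cell3 k (z : idx k) : set V :=
  cube (\row_i (- M%:R + (z i)%:R * mesh k - mesh k)) (3 * mesh k).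

Lemma cell3E k (z : idx k) x : cell3 z x <->
  forall i, - M%:R + (z i)%:R * mesh k - mesh k <= x 0 i <
            - M%:R + (z i).+1%:R * mesh k + mesh k.
Proof.
have E i : - M%:R + (z i)%:R * mesh k - mesh k + 3 * mesh k =
    - M%:R + (z i).+1%:R * mesh k + mesh k by rewrite -natr1; ring.
split => H i; have := H i; rewrite /= in_itv/= mxE E//.
Qed.

Lemma ancestor_cell3 j k (y : idx j) (z : idx k) : ancestor y z -> cell3 z `<=` cell3 y.
Proof.
move=> yz x /cell3E zx; apply/cell3E => i.
have [b1 b2] := ancestor_bounds i yz.
have jk : (j <= k)%N by case/andP: yz.
have hk : mesh k <= mesh j.
  by rewrite (meshB jk) ler_peMl ?(ltW (@mesh_gt0 R k))// ler1n expn_gt0.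
by have /andP[] := zx i; move=> ? ?; apply/andP; split; lra.
Qed.

Lemma measurable_cell3 k (z : idx k) : measurable (cell3 z).
Proof. exact: measurable_cube. Qed.

Section stopping.
Variables (F : V -> \bar R) (lam : R).
Hypotheses (mF : measurable_fun setT F) (F0 : forall x, (0 <= F x)%E) (lam0 : 0 < lam).

Definition heavy k (z : idx k) : bool :=
  ((lam * mesh k ^+ n.+1)%:E < \int[lebV]_(x in cell z) F x)%E.

Definition maximal_heavy k (z : idx k) : Prop :=
  heavy z /\ forall j (y : idx j), (j < k)%N -> ancestor y z -> ~~ heavy y.

Lemma heavy_below_maximal k (z : idx k) : heavy z -> exists j (y : idx j), maximal_heavy y /\ ancestor y z.
Proof.
move=> gz.
pose P j := [exists y : idx j, heavy y && ancestor y z].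
have exP : exists j, P j.
  by exists k; apply/existsP; exists z; rewrite gz ancestor_refl.
case: (ex_minnP exP) => j /existsP[y /andP[gy yz]] minj.
exists j, y; split => //; split => // i w ij wy; apply/negP => gw.
have /minj : P i.
  by apply/existsP; exists w; rewrite gw (ancestor_trans wy yz).
by rewrite leqNgt ij.
Qed.

Definition maximal_heavyb k (z : idx k) : bool := `[< maximal_heavy z >].
Definition maximal_heavy_cells k : set V := \big[setU/set0]_(z : idx k | maximal_heavyb z) cell z.
(** The threefold dilations of the maximal heavy cells. They contain those of all
    heavy cells, since dilation preserves inclusion of dyadic cells. *)
Definition exceptional : set V := \bigcup_k \big[setU/set0]_(z : idx k | maximal_heavyb z) cell3 z.

Lemma measurable_exceptional : measurable exceptional.
Proof.
apply: bigcupT_measurable => k; apply: bigsetU_measurable => z _.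
exact: measurable_cell3.
Qed.

Lemma not_exceptional_light k (z : idx k) x : ~ exceptional x -> cell3 z x -> ~~ heavy z.
Proof.
move=> xE zx; apply/negP => /heavy_below_maximal[j [y [ty yz]]]; apply: xE.
exists j => //; rewrite -bigcup_seq_cond; exists y.
  by rewrite /= mem_index_enum/=; exact/asboolP.
exact: ancestor_cell3 yz _ zx.
Qed.

(** Two dyadic cells that meet are nested, and a maximal heavy cell is contained
    in no coarser heavy cell. *)
Lemma trivIset_maximal_heavy_cells : trivIset setT maximal_heavy_cells.
Proof.
apply/trivIsetP => j k _ _.
wlog jk : j k / (j < k)%N => [wl|_].
  by rewrite neq_ltn => /orP[jk|kj]; [|rewrite setIC]; apply: wl => //; rewrite ltn_eqF.
apply/seteqP; split => // x [].
rewrite /maximal_heavy_cells -!bigcup_seq_cond => -[y /= /andP[_ /asboolP[gy _]] yx] [z /= /andP[_ /asboolP[_ tz]] zx].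
by have := tz _ _ jk (meet_ancestor (ltnW jk) yx zx); rewrite gy.
Qed.

Lemma measurable_maximal_heavy_cells k : measurable (maximal_heavy_cells k).
Proof. by apply: bigsetU_measurable => z _; exact: measurable_cell. Qed.

(** The maximal heavy cells are pairwise disjoint and each carries a mass of at
    least $\lambda$ times its volume; dilation costs the factor $3^{n+1}$. *)
Lemma measure_exceptional_le :
  (lebV exceptional <= (3 ^+ n.+1 / lam)%:E * \int[lebV]_x F x)%E.
Proof.
pose G k := \big[setU/set0]_(z : idx k | maximal_heavyb z) cell3 z.
have mG k : measurable (G k).
  by apply: bigsetU_measurable => z _; exact: measurable_cell3.
have c0 : 0 <= 3 ^+ n.+1 / lam by rewrite divr_ge0 ?exprn_ge0// ltW.
apply: (@le_trans _ _ (\sum_(0 <= k <oo) lebV (G k))%E).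
  apply: measure_sigma_subadditive => //; exact: measurable_exceptional.
apply: (@le_trans _ _ (\sum_(0 <= k <oo) (3 ^+ n.+1 / lam)%:E *
    \int[lebV]_(x in maximal_heavy_cells k) F x)%E).
  apply: lee_nneseries => // k _.
  have trik : trivIset [set` [seq z <- index_enum (idx k) | maximal_heavyb z]] (fun z => cell z).
    by move=> z z' _ _ [x [zx z'x]]; exact: cell_inj zx z'x.
  rewrite /maximal_heavy_cells -big_filter ge0_integral_bigsetU//; last 3 first.
  - by move=> z; exact: measurable_cell.
  - by rewrite filter_uniq// index_enum_uniq.
  - exact: measurable_funTS.
  rewrite ge0_sume_distrr => [|z _]; last exact: integral_ge0.
  apply: (@le_trans _ _ (\sum_(z : idx k | maximal_heavyb z) lebV (cell3 z))%E).
    by apply: measure_bigsetU_cond_le => z; exact: measurable_cell3.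
  rewrite big_filter; apply: lee_sum => z /asboolP[gz _].
  rewrite lebN_cube ?mulr_ge0 ?(ltW (@mesh_gt0 R k))//.
  have -> : (3 * mesh k) ^+ n.+1 = 3 ^+ n.+1 / lam * (lam * mesh k ^+ n.+1).
    by rewrite exprMn mulrA divfK ?gt_eqF.
  rewrite EFinM; apply: lee_pmul; rewrite ?lee_fin//; last exact: ltW.
  by rewrite mulr_ge0 ?(ltW lam0)// exprn_ge0// ltW// mesh_gt0.
rewrite nneseriesZl//; last by move=> k _; exact: integral_ge0.
apply: lee_pmul; rewrite ?lee_fin//.
  by apply: nneseries_ge0 => k _ _; exact: integral_ge0.
rewrite -ge0_integral_bigcup//; last 3 first.
- exact: measurable_maximal_heavy_cells.
- exact: measurable_funTS.
- exact: trivIset_maximal_heavy_cells.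
apply: ge0_subset_integral => //.
by apply: bigcupT_measurable => k; exact: measurable_maximal_heavy_cells.
Qed.

(** A cell that meets the cube of side $2h$ centered at $x$ has $x$ in its dilation,
    so it is not heavy; all such cells lie in the cube of side $4h$. *)
Lemma not_exceptional_le k x (A : set V) : ~ exceptional x -> measurable A ->
  (forall w, A w -> forall i, `|w 0 i| < M%:R) ->
  A `<=` cube (\row_i (x 0 i - mesh k)) (2 * mesh k) ->
  (\int[lebV]_(w in A) F w <= (lam * 4 ^+ n.+1 * mesh k ^+ n.+1)%:E)%E.
Proof.
move=> xE mA AM Ax; have h0 := @mesh_gt0 R k; set h := mesh k in h0 Ax *.
pose Q : set V := cube (\row_i (x 0 i - 2 * h)) (4 * h).
have mQ : measurable Q by exact: measurable_cube.
pose IQ (w : V) : \bar R := (\1_Q w)%:E.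
have mIQ : measurable_fun setT IQ by apply/measurable_EFinP; exact: measurable_indic.
have mFA : measurable_fun setT (F \_ A).
  by apply/(measurable_restrictT _ mA); exact: measurable_funTS.
rewrite (eq_integral (F \_ A)); last by move=> w wA; rewrite /patch wA.
apply: le_trans; first by apply: (@integral_le_sum_cells _ _ _ k _ _ mA AM mFA) => w; rewrite erestrict_ge0.
apply: (@le_trans _ _ (\sum_(z : idx k) lam%:E * \int[lebV]_(w in cell z) IQ w)%E); last first.
  rewrite -ge0_sume_distrr; last by move=> z _; apply: integral_ge0 => w _; rewrite lee_fin.
  apply: (@le_trans _ _ (lam%:E * \int[lebV]_w IQ w)%E).
    apply: lee_pmul; rewrite ?lee_fin ?(ltW lam0)//.
      by apply: sume_ge0 => z _; apply: integral_ge0 => w _; rewrite lee_fin.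
    by apply: sum_cells_le => // w; rewrite lee_fin.
  have -> : (\int[lebV]_w IQ w = ((4 * h) ^+ n.+1)%:E)%E.
    by rewrite integral_indic// setIT; apply: lebN_cube; rewrite mulr_ge0// ltW.
  by rewrite -EFinM exprMn mulrA.
apply: lee_sum => z _.
have [[w0 [zw0 Aw0]]|zA] := pselect (exists w, cell z w /\ A w); last first.
  rewrite integral0_eq; last first.
    by move=> w zw; rewrite /patch memNset// => Aw; apply: zA; exists w.
  by rewrite mule_ge0 ?lee_fin ?(ltW lam0)//; apply: integral_ge0 => w _; rewrite lee_fin.
have xw0 i : x 0 i - h <= w0 0 i < x 0 i + h.
  by have := Ax _ Aw0 i; rewrite /= in_itv/= mxE; move=> /andP[? ?]; apply/andP; split; lra.
have zQ : cell z `<=` Q.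
  move=> w /cellE zw i; have := zw i; have := cellE zw0 i; have := xw0 i.
  rewrite /= in_itv/= mxE -/h -natr1 => /andP[? ?] /andP[? ?] /andP[? ?].
  by apply/andP; split; lra.
have zx : cell3 z x.
  apply/cell3E => i; have := cellE zw0 i; have := xw0 i; rewrite -/h.
  by move=> /andP[? ?] /andP[? ?]; apply/andP; split; lra.
have -> : (\int[lebV]_(w in cell z) IQ w = (h ^+ n.+1)%:E)%E.
  rewrite (eq_integral (cst 1%E)); last by move=> w /[!inE] /zQ Qw; rewrite /IQ indicE mem_set.
  by rewrite integral_cst ?mul1e; [exact: lebN_cell|exact: measurable_cell].
have := not_exceptional_light xE zx; rewrite /heavy -leNgt -EFinM.
apply: le_trans; apply: ge0_le_integral => //.
- exact: measurable_cell.
- by move=> w _; rewrite erestrict_ge0.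
- exact: measurable_funTS.
- exact: measurable_funTS.
by move=> w _; rewrite /patch; case: ifPn.
Qed.

End stopping.

End maximal_inequality.
(** * The Euclidean norm *)
Lemma continuous_sumr (R : realType) (T : topologicalType) (I : Type) (s : seq I)
    (F : I -> T -> R) :
  (forall i, continuous (F i)) -> continuous (fun x => \sum_(i <- s) F i x).
Proof.
move=> cF; elim: s => [|i s IH].
  rewrite (_ : (fun x => _) = cst 0); first exact: cst_continuous.
  by apply/funext => x; rewrite big_nil.
rewrite (_ : (fun x => _) = fun x => F i x + \sum_(i <- s) F i x).
  by move=> x; exact: (cvgD (cF i x) (IH x)).
by apply/funext => x; rewrite big_cons.
Qed.

Section euclidean_norm.
Context (R : realType) (n : nat).
Implicit Types x y : 'rV[R]_n.

Lemma enorm_ge0 x : 0 <= enorm x. Proof. exact: sqrtr_ge0. Qed.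

Lemma coord_le_enorm x i : `|x 0 i| <= enorm x.
Proof.
rewrite -sqrtr_sqr /enorm ler_wsqrtr// (bigD1 i)//= lerDl.
by apply: sumr_ge0 => j _; exact: sqr_ge0.
Qed.

Lemma enorm_le_coord x c : (forall i, `|x 0 i| <= c) -> enorm x <= n%:R * c.
Proof.
move=> xc; have [n0|n0] := posnP n.
  by move: x xc; rewrite n0 /enorm => x _; rewrite big_ord0 sqrtr0 mul0r.
have c0 : 0 <= c by apply: le_trans (xc (Ordinal n0)).
rewrite -[leRHS]ger0_norm ?mulr_ge0// -sqrtr_sqr /enorm ler_wsqrtr//.
apply: (@le_trans _ _ (\sum_(i < n) c ^+ 2)).
  by apply: ler_sum => i _; rewrite -[leLHS]real_normK ?num_real// ler_sqr ?nnegrE.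
rewrite sumr_const card_ord exprMn -[leLHS]mulr_natl ler_wpM2r ?sqr_ge0//.
by rewrite -natrX ler_nat -{1}(expn1 n) leq_pexp2l.
Qed.

Lemma enormN x : enorm (- x) = enorm x.
Proof. by congr Num.sqrt; apply: eq_bigr => i _; rewrite mxE sqrrN. Qed.

Lemma continuous_enorm : continuous (@enorm R n).
Proof.
move=> x; apply: (@continuous_comp _ _ _ (fun x => \sum_(i < n) x 0 i ^+ 2)).
  apply: continuous_sumr => i {}x.
  by apply: (@continuous_comp _ _ _ (fun y : 'rV[R]_n => y 0 i) (fun t : R => t ^+ 2) x); [exact: coord_continuous|exact: exprn_continuous].
exact: sqrt_continuous.
Qed.

Lemma measurable_eball x r : measurable (eball x r).
Proof.
rewrite (_ : eball x r = (fun y => enorm (y - x)) @^-1` `]-oo, r[%classic); last first.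
  by apply/seteqP; split => y; rewrite /eball /= in_itv.
rewrite -[X in measurable X]setTI.
have m : measurable_fun setT (fun y : 'rV[R]_n => enorm (y - x)).
  apply: continuous_measurable_mx => y.
  apply: (@continuous_comp _ _ _ (fun y => y - x)); last exact: continuous_enorm.
  exact: (cvgB (@cvg_id _ (nbhs y)) (cvg_cst x)).
by apply: m => //; exact: measurable_itv.
Qed.

Lemma cauchy_schwarz x y :
  `|\sum_(i < n) x 0 i * y 0 i| <= enorm x * enorm y.
Proof.
set s := \sum_(i < n) _.
have x0 : 0 <= \sum_(i < n) x 0 i ^+ 2 by apply: sumr_ge0 => i _; exact: sqr_ge0.
have y0 : 0 <= \sum_(i < n) y 0 i ^+ 2 by apply: sumr_ge0 => i _; exact: sqr_ge0.
rewrite /enorm -sqrtrM// -sqrtr_sqr; apply: ler_wsqrtr.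
set X := \sum_(i < n) x 0 i ^+ 2 in x0 *; set Y := \sum_(i < n) y 0 i ^+ 2 in y0 *.
(* The discriminant of $t\mapsto|x-ty|^2$. *)
have quad (t : R) : 0 <= X - 2 * t * s + t ^+ 2 * Y.
  rewrite (_ : _ + _ = \sum_(i < n) (x 0 i - t * y 0 i) ^+ 2).
    by apply: sumr_ge0 => i _; exact: sqr_ge0.
  rewrite /X /Y /s !mulr_sumr -sumrN -!big_split/=; apply: eq_bigr => i _; ring.
have [Y0|Yn0] := eqVneq Y 0.
  have [->|sn0] := eqVneq s 0; first by rewrite expr0n mulr_ge0// Y0.
  have := quad ((X + 1) / (2 * s)); rewrite Y0 !mulr0 addr0.
  have -> : 2 * ((X + 1) / (2 * s)) * s = X + 1 by field.
  by move=> ?; lra.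
have Yp : 0 < Y by rewrite lt_neqAle eq_sym Yn0.
have := quad (s / Y).
have -> : X - 2 * (s / Y) * s + (s / Y) ^+ 2 * Y = X - s ^+ 2 / Y by field.
by rewrite subr_ge0 ler_pdivrMr.
Qed.

Lemma enorm_sqr x : enorm x ^+ 2 = \sum_(i < n) x 0 i ^+ 2.
Proof. by rewrite /enorm sqr_sqrtr// sumr_ge0// => i _; exact: sqr_ge0. Qed.

Lemma enormD x y : enorm (x + y) <= enorm x + enorm y.
Proof.
rewrite -ler_sqr ?nnegrE ?addr_ge0 ?enorm_ge0// sqrrD !enorm_sqr.
rewrite (_ : \sum_(i < n) (x + y) 0 i ^+ 2 =
    \sum_(i < n) x 0 i ^+ 2 + (\sum_(i < n) x 0 i * y 0 i) *+ 2 + \sum_(i < n) y 0 i ^+ 2).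
  rewrite lerD2r lerD2l lerMn2r/=; apply: le_trans (ler_norm _) _; exact: cauchy_schwarz.
rewrite -sumrMnl -!big_split/=; apply: eq_bigr => i _; rewrite mxE sqrrD; ring.
Qed.

Lemma measurable_enorm_fun d (T : measurableType d) (D : set T) (H : T -> 'rV[R]_n) :
  (forall i, measurable_fun D (fun t => H t 0 i)) -> measurable_fun D (fun t => enorm (H t)).
Proof.
move=> mH; apply: (measurableT_comp (f := @Num.sqrt R)).
  by apply: continuous_measurable_fun; exact: sqrt_continuous.
apply: measurable_sum => i; exact: measurable_funX.
Qed.

End euclidean_norm.

(** * Lebesgue differentiation with respect to Euclidean balls *)
Section lebesgue_differentiation.
Context (R : realType) (n M : nat).
Local Notation V := ('rV[R]_n.+1).
Local Notation lebV := (lebN R n.+1).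
Local Notation mesh := (mesh R).

Lemma mesh_le k : mesh k <= k.+1%:R^-1.
Proof.
rewrite -[mesh k]invrK lef_pV2 ?posrE ?invr_gt0 ?mesh_gt0// /mesh exprVn invrK.
by rewrite -natrX ler_nat ltn_expl.
Qed.

Lemma meshS k : mesh k.+1 = mesh k / 2. Proof. by rewrite /mesh exprSr. Qed.

Lemma exists_mesh_le (e : R) : 0 < e -> exists k, mesh k <= e.
Proof.
move=> e0; exists (Num.truncn e^-1); apply: le_trans (mesh_le _) _.
rewrite -[leRHS]invrK lef_pV2 ?posrE ?invr_gt0//.
by apply: ltW; apply: truncnS_gt.
Qed.

Lemma exists_mesh_bracket (r : R) : 0 < r < 1 -> exists k, mesh k <= 2 * r /\ r < mesh k.
Proof.
move=> /andP[r0 r1]; have ex := exists_mesh_le r0.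
case: (ex_minnP ex) => -[|k] kr mink.
  by move: r1; rewrite ltNge (le_trans _ kr)// /mesh expr0.
exists k; split; first by move: kr; rewrite meshS ler_pdivrMr// mulrC.
by rewrite ltNge; apply/negP => /mink; rewrite ltnn.
Qed.

Lemma eball_subset_ball (x : V) r : eball x r `<=` ball x r.
Proof.
move=> y yx; have r0 : 0 < r by apply: le_lt_trans yx; exact: enorm_ge0.
split => // i j; rewrite ord1 -ball_normE /= distrC.
by apply: le_lt_trans yx; have := coord_le_enorm (y - x) j; rewrite !mxE.
Qed.

Lemma eball_subset_cube (x : V) r k : r < mesh k ->
  eball x r `<=` cube (\row_i (x 0 i - mesh k)) (2 * mesh k).
Proof.
move=> rk y yx i; rewrite /= in_itv/= mxE.
have : `|(y - x) 0 i| < r by apply: le_lt_trans yx; exact: coord_le_enorm.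
rewrite !mxE ltr_norml => /andP[? ?]; apply/andP; split; lra.
Qed.

Lemma lebN_eball_ge (x : V) r : 0 < r -> (((r / n.+2%:R) ^+ n.+1)%:E <= lebV (eball x r))%E.
Proof.
move=> r0; have c0 : 0 < r / n.+2%:R by rewrite divr_gt0.
rewrite -(lebN_cube x (ltW c0)); apply: le_measure; rewrite ?inE.
- exact: measurable_cube.
- exact: measurable_eball.
move=> y yx; rewrite /eball /=.
apply: (@le_lt_trans _ _ (n.+1%:R * (r / n.+2%:R))).
  apply: enorm_le_coord => i; have := yx i.
  move: c0 {yx}; set c := r / n.+2%:R => c0; rewrite /= in_itv/= !mxE => /andP[? ?].
  by rewrite ger0_norm; lra.
by rewrite mulrCA gtr_pMr// ltr_pdivrMr// mul1r ltr_nat.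
Qed.

Lemma eball_lt_pinfty (x : V) r : 0 < r < 1 -> (lebV (eball x r) < +oo)%E.
Proof.
move=> /exists_mesh_bracket[k [_ rk]].
apply: (@le_lt_trans _ _ (lebV (cube (\row_i (x 0 i - mesh k)) (2 * mesh k)))).
  apply: le_measure; rewrite ?inE; [exact: measurable_eball|exact: measurable_cube|].
  exact: eball_subset_cube.
by rewrite lebN_cube ?ltry// mulr_ge0// ltW// mesh_gt0.
Qed.

Variables (Om : set V) (oOm : open Om).
Hypothesis OmM : forall x, Om x -> forall i, `|x 0 i| < M%:R.

Let mOm : measurable Om. Proof. exact: open_measurable_mx. Qed.

(** The factor $4$ stems from the maximal inequality, the factor $2$ from the
    choice of a mesh $h\le 2r$ for a ball of radius $r$, and $n+2$ from the cube of
    side $r/(n+2)$ that the ball contains. *)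
Let K : R := (4 * 2 * n.+2%:R) ^+ n.+1.

(** Outside the exceptional set of $|f-g|$ the averages of $|f-f(x)|$ are small at
    small scales, as $g$ is continuous. *)
Lemma average_dist_le (f g : V -> R) (lam : R) (x : V) :
  0 < lam -> measurable_fun Om f -> continuous g -> Om x ->
  ~ exceptional M ((fun y => `|f y - g y|%:E) \_ Om)%E lam x ->
  `|f x - g x| <= lam ->
  \forall r \near 0^'+, (\int[lebV]_(y in eball x r) `|f y - f x|%:E <=
     (lam * (K + 2))%:E * lebV (eball x r))%E.
Proof.
move=> lam0 mf cg Omx xE fgx.
have /nbhs_ballP[d1 /= d10 d1Om] : nbhs x Om by exact: open_nbhs_nbhs.
have /cvgrPdist_le/(_ _ lam0)/nbhs_ballP[d2 /= d20 d2g] := cg x.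
near=> r.
have r0 : 0 < r by near: r; exact: nbhs_right_gt.
have r1 : r < 1 by near: r; exact: nbhs_right_lt.
have rd1 : r < d1 by near: r; exact: nbhs_right_lt.
have rd2 : r < d2 by near: r; exact: nbhs_right_lt.
have [|k [kr rk]] := @exists_mesh_bracket r; first by rewrite r0.
have BOm : eball x r `<=` Om.
  by move=> y /eball_subset_ball /(le_ball (ltW rd1)); exact: d1Om.
have mB := measurable_eball x r.
have mg : measurable_fun Om g by apply: measurable_funTS; exact: continuous_measurable_mx.
have md (u v : V -> R) : measurable_fun Om u -> measurable_fun Om v ->
    measurable_fun (eball x r) (fun x => `|u x - v x|%:E).
  move=> mu mv; apply: (measurable_funS mOm BOm).
  by apply/measurable_EFinP; apply: measurableT_comp => //; exact: measurable_funB.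
have mFT : measurable_fun setT ((fun y => `|f y - g y|%:E) \_ Om)%E.
  apply/(measurable_restrictT _ mOm); apply/measurable_EFinP; apply: measurableT_comp => //.
  exact: measurable_funB.
have FB : (\int[lebV]_(y in eball x r) `|f y - g y|%:E <= (lam * K)%:E * lebV (eball x r))%E.
  rewrite (eq_integral ((fun y => `|f y - g y|%:E) \_ Om)%E); last first.
    by move=> y /[!inE] By; rewrite /patch mem_set//; exact: BOm.
  apply: (@le_trans _ _ (lam * 4 ^+ n.+1 * mesh k ^+ n.+1)%:E).
    apply: (not_exceptional_le mFT _ lam0 xE mB).
    - by move=> y; rewrite erestrict_ge0.
    - by move=> y By; apply: OmM; exact: BOm.
    - exact: eball_subset_cube.
  apply: (@le_trans _ _ ((lam * K)%:E * ((r / n.+2%:R) ^+ n.+1)%:E)%E); last first.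
    rewrite lee_pmul ?lee_fin//; last exact: lebN_eball_ge.
      by rewrite mulr_ge0 ?(ltW lam0)// exprn_ge0.
    by rewrite exprn_ge0// divr_ge0// ltW.
  rewrite -EFinM lee_fin -!mulrA ler_pM2l// /K -!exprMn lerXn2r ?nnegrE//.
  - by rewrite mulr_ge0// ltW// mesh_gt0.
  - by rewrite !mulr_ge0 ?invr_ge0// ltW.
  by rewrite -!mulrA [n.+2%:R * _]mulrCA mulfV ?mulr1 ?pnatr_eq0// ler_pM2l.
apply: (@le_trans _ _ (\int[lebV]_(y in eball x r) (`|f y - g y|%:E + (cst (2 * lam)%:E) y))%E).
  apply: ge0_le_integral => //.
  - by apply: md => //; exact: measurable_cst.
  - by apply: emeasurable_funD; [exact: md|exact: measurable_cst].
  move=> y By; rewrite /= -EFinD lee_fin.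
  have gxy : `|g x - g y| <= lam.
    by apply: d2g; apply: (le_ball (ltW rd2)); exact: eball_subset_ball.
  have -> : f y - f x = (f y - g y) + ((g y - g x) + (g x - f x)) by ring.
  apply: le_trans (ler_normD _ _) _; rewrite lerD2l.
  apply: le_trans (ler_normD _ _) _; rewrite distrC [`|g x - f x|]distrC.
  by rewrite mulr_natl mulr2n lerD.
rewrite ge0_integralD//; last 2 first.
- exact: md.
- by move=> y _; rewrite lee_fin mulr_ge0// ltW.
rewrite integral_cst//.
apply: (@le_trans _ _ ((lam * K)%:E * lebV (eball x r) + (2 * lam)%:E * lebV (eball x r))%E).
  by rewrite leeD2r.
rewrite -ge0_muleDl ?lee_fin ?mulr_ge0 ?exprn_ge0 ?(ltW lam0)//.
by rewrite -EFinD mulrDr [2 * lam]mulrC.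
Unshelve. all: by end_near. Qed.

End lebesgue_differentiation.

Section lebesgue_points.
Context (R : realType) (n M : nat).
Local Notation V := ('rV[R]_n.+1).
Local Notation lebV := (lebN R n.+1).

Lemma lebesgue_point_precise_value (Om : set V) (f : V -> R) (x : V) : open Om -> Om x ->
  lebV.-integrable Om (EFin \o f) ->
  (forall e : R, 0 < e -> \forall r \near 0^'+,
     (\int[lebV]_(y in eball x r) `|f y - f x|%:E <= e%:E * lebV (eball x r))%E) ->
  precise_value f x (f x).
Proof.
move=> oOm Omx intf H; rewrite /precise_value; apply/cvgrPdist_le => e e0.
have /nbhs_ballP[d1 /= d10 d1Om] : nbhs x Om by exact: open_nbhs_nbhs.
near=> r.
have r0 : 0 < r by near: r; exact: nbhs_right_gt.
have r1 : r < 1 by near: r; exact: nbhs_right_lt.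
have rd1 : r < d1 by near: r; exact: nbhs_right_lt.
have Hr : (\int[lebV]_(y in eball x r) `|f y - f x|%:E <= e%:E * lebV (eball x r))%E.
  by near: r; exact: H.
have BOm : eball x r `<=` Om.
  by move=> y /eball_subset_ball /(le_ball (ltW rd1)); exact: d1Om.
have mB := measurable_eball x r.
have Bfin : (lebV (eball x r) < +oo)%E by apply: eball_lt_pinfty; rewrite r0.
have Bpos : (0 < lebV (eball x r))%E.
  by apply: lt_le_trans (lebN_eball_ge x r0); rewrite lte_fin exprn_gt0// divr_gt0.
have [m [m0 Em]] : exists m : R, 0 < m /\ lebV (eball x r) = m%:E.
  exists (fine (lebV (eball x r))); rewrite fineK ?ge0_fin_numE ?measure_ge0//.
  by rewrite fine_gt0// Bpos.
have intB : lebV.-integrable (eball x r) (EFin \o f).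
  exact: integrableS (open_measurable_mx oOm) mB BOm intf.
have intc : lebV.-integrable (eball x r) (cst (f x)%:E).
  apply/integrableP; split => //.
  rewrite (eq_integral (cst `|f x|%:E)); last by [].
  by rewrite integral_cst// lte_mul_pinfty// ?lee_fin.
have Ifin := integrable_fin_num mB intB.
have E : (\int[lebV]_(y in eball x r) (f y - f x)%:E =
    \int[lebV]_(y in eball x r) (f y)%:E - (f x * m)%:E)%E.
  rewrite (eq_integral (fun y => (EFin \o f) y - cst (f x)%:E y)%E); last by [].
  by rewrite integralB// integral_cst// [X in (_ * X)%E]Em -EFinM.
have mfB : measurable_fun (eball x r) f by apply/measurable_EFinP; exact: measurable_int intB.
have Habs : (`|\int[lebV]_(y in eball x r) (f y - f x)%:E| <= (e * m)%:E)%E.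
  apply: le_trans; first apply: le_abse_integral => //.
    by apply/measurable_EFinP; apply: measurable_funB.
  by rewrite EFinM -Em.
move: Habs; rewrite E [lebV (eball x r)]Em /=.
have -> : (\int[lebV]_(y in eball x r) (f y)%:E = (fine (\int[lebV]_(y in eball x r) (f y)%:E))%:E)%E.
  by rewrite fineK.
rewrite -EFinB lee_fin /=; set I := fine _.
move=> Hab; rewrite distrC.
have -> : I / m - f x = (I - f x * m) / m by rewrite mulrBl mulfK ?gt_eqF.
by rewrite normrM normfV (gtr0_norm m0) ler_pdivrMr.
Unshelve. all: by end_near. Qed.

Variables (Om : set V) (oOm : open Om).
Hypothesis OmM : forall x, Om x -> forall i, `|x 0 i| < M%:R.

Let mOm : measurable Om. Proof. exact: open_measurable_mx. Qed.

Lemma lebN_bounded_lt_pinfty : (lebV Om < +oo)%E.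
Proof.
apply: (@le_lt_trans _ _ (lebV (cube (const_mx (- M%:R)) (M%:R + M%:R)))).
  apply: le_measure; rewrite ?inE//; first exact: measurable_cube.
  move=> x Omx i; rewrite /= in_itv/= mxE.
  by have := OmM Omx i; rewrite ltr_norml => /andP[? ?]; apply/andP; split; lra.
by rewrite lebN_cube ?ltry// addr_ge0.
Qed.

Let deviation (F : V -> R) (lam : R) : set V := Om `&` [set x | lam < `|F x|].

Let measurable_deviation F lam : measurable_fun Om F -> measurable (deviation F lam).
Proof.
move=> mF; rewrite /deviation (_ : [set _ | _] = (fun x => `|F x|) @^-1` `]lam, +oo[%classic).
  have mFn : measurable_fun Om (fun x => `|F x|) by exact: measurableT_comp.
  by apply: mFn => //; exact: measurable_itv.
by apply/seteqP; split => x; rewrite /= in_itv/= andbT.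
Qed.

Let deviation_le (F : V -> R) (lam c : R) : 0 < lam -> measurable_fun Om F ->
  (\int[lebV]_(x in Om) `|F x|%:E <= c%:E)%E ->
  (lebV (deviation F lam) <= (c / lam)%:E)%E.
Proof.
move=> lam0 mF Fc.
have mS := measurable_deviation lam mF.
have mFE : measurable_fun Om (fun x => `|F x|%:E).
  by apply/measurable_EFinP; exact: measurableT_comp.
rewrite mulrC EFinM lee_pdivlMl//.
apply: le_trans Fc.
apply: (@le_trans _ _ (\int[lebV]_(x in deviation F lam) (cst lam%:E x))%E).
  by rewrite integral_cst.
apply: (@le_trans _ _ (\int[lebV]_(x in deviation F lam) `|F x|%:E)%E).
  apply: ge0_le_integral => //.
  - by move=> x _; rewrite lee_fin ltW.
  - by apply: (measurable_funS mOm) => //; exact: subIsetl.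
  - by move=> x [_ /= /ltW]; rewrite lee_fin.
by apply: ge0_subset_integral => //; exact: subIsetl.
Qed.

(** For continuous $g_j$ within $4^{-j}$ of $f$ in $L^1$, the points where the
    comparison with $g_j$ fails at level $2^{-j}$ form sets of summable measures, so
    almost every point lies in finitely many of them (Borel-Cantelli). *)
Theorem precise_value_ae (f : V -> R) : lebV.-integrable Om (EFin \o f) ->
  ae_in Om (fun x => precise_value f x (f x)).
Proof.
move=> intf.
have mf : measurable_fun Om f by apply/measurable_EFinP; exact: measurable_int intf.
have [_ dense] := continuous_dense_L1 mOm lebN_bounded_lt_pinfty intf.
have /choice[g Hg] : forall j : nat, exists g : V -> R, continuous g /\
    (\int[lebV]_(x in Om) `|f x - g x|%:E <= (2^-1 ^+ j * 2^-1 ^+ j)%:E)%E.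
  move=> j; have [|g cg fg] := dense (2^-1 ^+ j * 2^-1 ^+ j); last by exists g.
  by rewrite mulr_gt0// exprn_gt0.
have mg j : measurable_fun Om (g j).
  by apply: measurable_funTS; apply: continuous_measurable_mx; case: (Hg j).
have mfg j : measurable_fun Om (fun x => f x - g j x) by exact: measurable_funB.
have lam0 j : 0 < 2^-1 ^+ j :> R by rewrite exprn_gt0.
pose F j := ((fun y => `|f y - g j y|%:E) \_ Om)%E.
have mF j : measurable_fun setT (F j).
  apply/(measurable_restrictT _ mOm); apply/measurable_EFinP; exact: measurableT_comp.
have F0 j x : (0 <= F j x)%E by rewrite erestrict_ge0.
pose Bad j := exceptional M (F j) (2^-1 ^+ j) `|`
  deviation (fun x => f x - g j x) (2^-1 ^+ j).
have mBad j : measurable (Bad j).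
  by apply: measurableU; [exact: measurable_exceptional|exact: measurable_deviation].
pose c : R := 3 ^+ n.+1 + 1.
have leBad j : (lebV (Bad j) <= (c * 2^-1 ^+ j)%:E)%E.
  apply: le_trans; first apply: measureU2.
    exact: measurable_exceptional.
    exact: measurable_deviation.
  rewrite /c mulrDl mul1r EFinD; apply: leeD; last first.
    apply: le_trans (deviation_le (lam0 j) (mfg j) (Hg j).2) _.
    by rewrite mulfK// gt_eqF.
  apply: le_trans (measure_exceptional_le M (mF j) (F0 j) (lam0 j)) _.
  have -> : 3 ^+ n.+1 * 2^-1 ^+ j = 3 ^+ n.+1 / 2^-1 ^+ j * (2^-1 ^+ j * 2^-1 ^+ j) :> R.
    by rewrite mulrA divfK// gt_eqF.
  rewrite [in leRHS]EFinM; apply: lee_pmul => //.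
  - by apply: integral_ge0 => x _; exact: F0.
  - by rewrite -integral_mkcond; exact: (Hg j).2.
pose Nul := \bigcap_m \bigcup_(j in [set j | (m <= j)%N]) Bad j.
have mU m : measurable (\bigcup_(j in [set j | (m <= j)%N]) Bad j).
  by apply: bigcup_measurable.
have mNul : measurable Nul by apply: bigcapT_measurable.
exists Nul; split => //.
  apply/eqP; rewrite eq_le measure_ge0 andbT; apply/lee_addgt0Pr => e e0; rewrite add0e.
  have c20 : 0 < 2 * c by rewrite mulr_gt0// ltr_wpDl// exprn_ge0.
  have [m me] := @exists_mesh_le R (e / (2 * c)) (divr_gt0 e0 c20).
  apply: (@le_trans _ _ (lebV (\bigcup_(j in [set j | (m <= j)%N]) Bad j))).
    by apply: le_measure; rewrite ?inE//; exact: bigcap_inf.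
  apply: (@le_trans _ _ (\sum_(0 <= j <oo) lebV (Bad (m + j)%N))%E).
    apply: measure_sigma_subadditive => //.
    by move=> x [j /= mj xj]; exists (j - m)%N => //; rewrite subnKC.
  apply: (@le_trans _ _ (\sum_(0 <= j <oo) (c * 2^-1 ^+ m * 2^-1 ^+ j)%:E)%E).
    apply: lee_nneseries => // j _; rewrite -mulrA -exprD; exact: leBad.
  apply: le_trans (nneseries_geometric_le _ _) _.
  - by rewrite mulr_ge0 ?exprn_ge0// addr_ge0// exprn_ge0.
  - by apply/andP; split; lra.
  rewrite lee_fin; move: me; rewrite /mesh ler_pdivlMr// => me.
  suff -> : c * 2^-1 ^+ m / (1 - 2^-1) = 2^-1 ^+ m * (2 * c) by [].
  by field.
move=> x /= xP; apply: contrapT => xNul; apply: xP => Omx.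
have [m Hm] : exists m, forall j, (m <= j)%N -> ~ Bad j x.
  apply: contrapT => nH; apply: xNul => m _; apply: contrapT => nm; apply: nH.
  by exists m => j mj Bj; apply: nm; exists j.
apply: (lebesgue_point_precise_value oOm Omx intf) => e e0.
pose K : R := (4 * 2 * n.+2%:R) ^+ n.+1.
have K2 : 0 < K + 2 by rewrite ltr_wpDl// exprn_ge0.
have [k ke] := @exists_mesh_le R (e / (K + 2)) (divr_gt0 e0 K2).
pose j := maxn m k.
have nB := Hm j (leq_maxl _ _).
have := @average_dist_le R n M Om oOm OmM f (g j) (2^-1 ^+ j) x (lam0 j) mf (Hg j).1 Omx.
have {}nB1 : ~ exceptional M (F j) (2^-1 ^+ j) x by move=> ?; apply: nB; left.
have {}nB2 : `|f x - g j x| <= 2^-1 ^+ j.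
  by rewrite leNgt; apply/negP => ?; apply: nB; right.
move=> /(_ nB1 nB2); apply: filterS => r /le_trans; apply.
apply: lee_wpmul2r; first exact: measure_ge0.
rewrite lee_fin -ler_pdivlMr//; apply: le_trans ke.
by rewrite /mesh ler_wiXn2l ?invr_ge0 ?leq_maxr// invf_le1// ler1n.
Qed.

End lebesgue_points.

(** * Integration by parts *)
Section locality.
Context (R : realType) (n : nat).

Lemma derive_near0 (V : normedModType R) (f : V -> R) (x v : V) :
  (\forall y \near x, f y = 0) -> 'D_v f x = 0.
Proof. by move=> f0; rewrite (@near_eq_derive _ _ _ f (cst 0))//; exact: derive_cst. Qed.

Lemma partial_notin_support (f : 'rV[R]_n -> R) i x :
  ~ closure [set y | f y != 0] x -> partial i f x = 0.
Proof.
move=> xS; apply: derive_near0.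
have : nbhs x (~` closure [set y | f y != 0]).
  by apply: open_nbhs_nbhs; split => //; exact: closed_openC (@closed_closure _ _).
apply: filterS => y /= yS; apply/eqP; apply: contrapT => /negP fy; apply: yS.
exact: subset_closure.
Qed.

End locality.

(** Extended real values, as it only serves in integrals; the negative part of $x$
    is the positive part of $-x$. *)
Definition pos_part (R : realType) (x : R) : \bar R := (Num.max x 0)%:E.

Section pos_part.
Context (R : realType).

Lemma pos_part_ge0 (x : R) : (0 <= pos_part x)%E.
Proof. by rewrite lee_fin le_max lexx orbT. Qed.

Lemma measurable_pos_part d (T : measurableType d) (D : set T) (f : T -> R) :
  measurable_fun D f -> measurable_fun D (fun x => pos_part (f x)).
Proof. by move=> mf; apply/measurable_EFinP; exact: measurable_maxr. Qed.

Lemma integral_pos_part d (T : measurableType d) (mu : {measure set T -> \bar R})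
    (D : set T) (f : T -> R) :
  (\int[mu]_(x in D) (f x)%:E =
  \int[mu]_(x in D) pos_part (f x) - \int[mu]_(x in D) pos_part (- f x))%E.
Proof.
rewrite integralE; congr (_ - _)%E; apply: eq_integral => x _.
  by rewrite funeposE /pos_part EFin_max.
by rewrite funenegE /pos_part EFin_max.
Qed.

Lemma integral_deriv_parts (g h : R -> R) (M : R) : 0 <= M ->
  (forall t, derivable g t 1) -> derive1 g =1 h -> continuous h ->
  (forall t, M <= `|t| -> g t = 0) ->
  (\int[@lebesgue_measure R]_t pos_part (h t) =
   \int[@lebesgue_measure R]_t pos_part (- h t))%E.
Proof.
move=> M0 dg gh ch g0.
have h0 t : M < `|t| -> h t = 0.
  move=> tM; rewrite -gh derive1E; apply: derive_near0.
  have : \forall s \near t, M < `|s|.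
    have := @norm_continuous _ _ t; move=> /cvgrPdist_lt/(_ (`|t| - M)).
    rewrite subr_gt0 => /(_ tM); apply: filterS => s.
    by rewrite ltr_norml => /andP[? ?]; lra.
  by apply: filterS => s /ltW /g0.
pose I := `[- (M + 1), M + 1]%classic : set (measurableTypeR R).
have mI : measurable I by exact: measurable_itv.
have restr (k : R -> R) : (forall t, h t = 0 -> k t = 0) ->
   (\int[@lebesgue_measure R]_t pos_part (k t) =
    \int[@lebesgue_measure R]_(t in I) pos_part (k t))%E.
  move=> k0; rewrite [RHS]integral_mkcond; apply: eq_integral => t _.
  rewrite /patch; case: ifPn => //; rewrite notin_setE /I /= in_itv/= => tI.
  rewrite k0 ?h0 /pos_part ?maxxx// ltNge; apply/negP; rewrite ler_norml => /andP[? ?].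
  by apply: tI; apply/andP; split; lra.
rewrite restr// (restr (fun t => - h t)); last by move=> t ->; rewrite oppr0.
have intI : (@lebesgue_measure R).-integrable I (EFin \o h).
  by apply: continuous_compact_integrable; [exact: segment_compact|exact: continuous_subspaceT].
have := FTC2_everywhere (a := - (M + 1)) (b := M + 1) _ dg gh ch.
have g1 : g (M + 1) = 0 by apply: g0; rewrite ger0_norm; lra.
have g2 : g (- (M + 1)) = 0 by apply: g0; rewrite normrN ger0_norm; lra.
have M1 : - (M + 1) <= M + 1 by lra.
move=> /(_ M1); rewrite g1 g2 subr0 integral_pos_part.
have mh : measurable_fun I h by apply: measurable_funTS; exact: continuous_measurable_fun.
have fin (k : R -> R) : measurable_fun I k -> (forall t, `|k t| = `|h t|) ->
    (\int[@lebesgue_measure R]_(t in I) pos_part (k t))%E \is a fin_num.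
  move=> mk kh; rewrite ge0_fin_numE; last by apply: integral_ge0 => t _; exact: pos_part_ge0.
  have /integrableP[_] := intI; apply: le_lt_trans; apply: ge0_le_integral => //.
  - by move=> t _; exact: pos_part_ge0.
  - exact: measurable_pos_part.
  - by apply/measurable_EFinP; exact: measurableT_comp.
  - by move=> t _; rewrite /= lee_fin ge_max normr_ge0 -kh ler_norm.
have fp := fin _ mh (fun t => erefl).
have mhN : measurable_fun I (fun t => - h t) by exact: measurableT_comp.
have fn := fin _ mhN (fun t => normrN (h t)).
rewrite -(fineK fp) -(fineK fn) -EFinB => -[] /eqP.
by rewrite subr_eq0 => /eqP ->.
Qed.

End pos_part.

Section divergence_theorem.
Context (R : realType).

(** Comparing positive and negative parts keeps all iterated integrals
    nonnegative, so that Tonelli's theorem suffices. *)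
Lemma integral_partial_parts n (f : 'rV[R]_n -> R) (M : R) i : 0 <= M -> Ck 1 f ->
  (forall (x : 'rV[R]_n) j, M <= `|x 0 j| -> f x = 0) ->
  (\int[lebN R n]_x pos_part (partial i f x) =
   \int[lebN R n]_x pos_part (- partial i f x))%E.
Proof.
move=> M0; elim: n f i => [f []//|n IH f i Cf f0].
have mP k : measurable_fun setT (partial k f).
  by apply: continuous_measurable_mx; exact: Ck1_partial.
have mPN k : measurable_fun setT (fun x => - partial k f x) by exact: measurableT_comp.
case: (unliftP ord0 i) => [j ->|->].
  rewrite !tonelli_consv; [|exact: measurable_pos_part|by move=> x; exact: pos_part_ge0..
    |exact: measurable_pos_part|by move=> x; exact: pos_part_ge0].
  apply: eq_integral => t _.
  under eq_integral do rewrite -partial_slice.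
  under [RHS]eq_integral do rewrite -partial_slice.
  apply: IH; first exact: Ck1_slice.
  by move=> w k wk; apply: (f0 _ (lift ord0 k)); rewrite consvS.
rewrite !tonelli_consv_sym; [|exact: measurable_pos_part|by move=> x; exact: pos_part_ge0..
    |exact: measurable_pos_part|by move=> x; exact: pos_part_ge0].
apply: eq_integral => w _.
apply: (@integral_deriv_parts R (fun s => f (consv (s, w)))
    (fun s => partial ord0 f (consv (s, w))) M) => //.
- by move=> t; exact: derivable_slice.
- by move=> t; exact: derive_slice.
- exact: continuous_partial_slice.
- by move=> t tM; apply: (f0 _ ord0); rewrite consv0.
Qed.

Lemma continuous_zero_outside_bounded n (S : set 'rV[R]_n) (f : 'rV[R]_n -> R) :
  compact S -> continuous f -> (forall x, ~ S x -> f x = 0) ->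
  exists2 B, 0 < B & forall x, `|f x| <= B.
Proof.
move=> cS cf f0.
have [B [_ HB]] := compact_bounded (continuous_compact (continuous_subspaceT cf) cS).
exists (`|B| + 1); first by rewrite ltr_wpDl.
move=> x; have [Sx|/f0 ->] := pselect (S x); last by rewrite normr0 addr_ge0.
by apply: HB; [rewrite (le_lt_trans (ler_norm _))// ltrDl|exists x].
Qed.

Lemma Ck1M n (f g : 'rV[R]_n -> R) : Ck 1 f -> Ck 1 g -> Ck 1 (fun x => f x * g x).
Proof.
move=> [cf df] [cg dg]; split; first by move=> x; exact: (cvgM (cf x) (cg x)).
move=> i; split.
  by move=> x; exact: (derivableM ((df i).1 x) ((dg i).1 x)).
rewrite (_ : partial i _ = fun x => f x * partial i g x + g x * partial i f x).
  by move=> x; exact: (cvgD (cvgM (cf x) ((dg i).2 x)) (cvgM (cg x) ((df i).2 x))).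
by apply/funext => x; exact: (deriveM ((df i).1 x) ((dg i).1 x)).
Qed.

Lemma partialM n (f g : 'rV[R]_n -> R) i x : Ck 1 f -> Ck 1 g ->
  partial i (fun x => f x * g x) x = f x * partial i g x + g x * partial i f x.
Proof. by move=> [_ df] [_ dg]; exact: (deriveM ((df i).1 x) ((dg i).1 x)). Qed.

End divergence_theorem.

Section by_parts.
Context (R : realType) (n M : nat).
Local Notation V := ('rV[R]_n.+1).
Local Notation lebV := (lebN R n.+1).
Variables (Om : set V) (oOm : open Om).
Hypothesis OmM : forall x, Om x -> forall i, `|x 0 i| < M%:R.

Let mOm : measurable Om. Proof. exact: open_measurable_mx. Qed.
Let finOm : (lebV Om < +oo)%E. Proof. exact: lebN_bounded_lt_pinfty oOm OmM. Qed.

Lemma compact_supp_out (W : nmodType) (f : V -> W) x : compact_supp Om f -> ~ Om x -> f x = 0.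
Proof.
move=> [_ SOm] Omx; apply: contrapT => fx; apply: Omx; apply: SOm.
by apply: subset_closure; apply/eqP.
Qed.

Lemma Cc_infty_Ck1 (psi : V -> R) : Cc_infty Om psi -> Ck 1 psi.
Proof. by case=> /(_ 1%N). Qed.

Lemma integrable_compact_supp (S : set V) (f : V -> R) : compact S ->
  continuous f -> (forall x, ~ S x -> f x = 0) -> lebV.-integrable Om (EFin \o f).
Proof.
move=> cS cf f0; apply: measurable_bounded_integrable => //.
  by apply: measurable_funTS; exact: continuous_measurable_mx.
have [B B0 fB] := continuous_zero_outside_bounded cS cf f0.
exists B; split; first exact: num_real.
by move=> x Bx y _; exact: le_trans (fB y) (ltW Bx).
Qed.

Lemma integral_partial_eq0 (S : set V) (f : V -> R) i : compact S -> S `<=` Om ->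
  Ck 1 f -> (forall x, ~ S x -> f x = 0) -> (forall x, ~ S x -> partial i f x = 0) ->
  (\int[lebV]_(x in Om) (partial i f x)%:E = 0)%E.
Proof.
move=> cS SOm Cf f0 pf0.
have int := integrable_compact_supp cS (@Ck1_partial _ _ _ i Cf) pf0.
have full (k : V -> R) : (forall x, partial i f x = 0 -> k x = 0) ->
    (\int[lebV]_(x in Om) pos_part (k x) = \int[lebV]_x pos_part (k x))%E.
  move=> k0; rewrite integral_mkcond; apply: eq_integral => x _.
  rewrite /patch; case: ifPn => //; rewrite notin_setE => Omx.
  by rewrite k0 /pos_part ?maxxx// pf0// => /SOm.
rewrite integral_pos_part full// (full (fun x => - partial i f x)); last first.
  by move=> x ->; rewrite oppr0.
rewrite -(@integral_partial_parts R n.+1 f M%:R i)//; last first.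
  by move=> x j Mx; apply: f0 => /SOm/OmM/(_ j); rewrite ltNge Mx.
rewrite subee// -full// ge0_fin_numE; last by apply: integral_ge0 => x _; exact: pos_part_ge0.
have /integrableP[_] := int; apply: le_lt_trans; apply: ge0_le_integral => //.
- by move=> x _; exact: pos_part_ge0.
- by apply: measurable_pos_part; apply/measurable_EFinP; exact: measurable_int int.
- by apply: measurableT_comp => //; exact: measurable_int int.
- by move=> x _; rewrite /= lee_fin ge_max normr_ge0 ler_norm.
Qed.

Lemma Cc1_vec_coord (phi : V -> V) i x : Cc1_vec Om phi ->
  ~ closure [set y | phi y != 0] x -> phi x 0 i = 0 /\ partial i (fun y => phi y 0 i) x = 0.
Proof.
move=> [_ _] xS; split.
  have [|pn0] := eqVneq (phi x) 0; first by move=> ->; rewrite mxE.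
  by exfalso; apply: xS; exact: subset_closure.
apply: partial_notin_support => xT; apply: xS; apply: closure_subset xT => y /=.
by apply: contra_neq => ->; rewrite mxE.
Qed.

Lemma continuous_divergence (phi : V -> V) : Cc1_vec Om phi -> continuous (divergence phi).
Proof.
by move=> [Cphi _]; apply: continuous_sumr => i; exact: (@Ck1_partial _ _ _ i (Cphi i)).
Qed.

Lemma divergence_out (phi : V -> V) x : Cc1_vec Om phi ->
  ~ closure [set y | phi y != 0] x -> divergence phi x = 0.
Proof.
by move=> Cphi xS; rewrite /divergence big1// => i _; case: (Cc1_vec_coord i Cphi xS).
Qed.

Lemma measurable_enorm_grad (psi : V -> R) (D : set V) : Ck 1 psi ->
  measurable_fun D (fun x => enorm (grad psi x)).
Proof.
move=> C1; apply: measurable_enorm_fun => i; apply: measurable_funTS.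
rewrite (_ : (fun x => _) = partial i psi); last by apply/funext => x; rewrite mxE.
by apply: continuous_measurable_mx; exact: Ck1_partial.
Qed.

Lemma measurable_enorm_vec (phi : V -> V) (D : set V) : Cc1_vec Om phi ->
  measurable_fun D (fun x => enorm (phi x)).
Proof.
move=> [Cphi _]; apply: measurable_enorm_fun => i; apply: measurable_funTS.
by apply: continuous_measurable_mx; exact: Ck1_continuous.
Qed.

(** The integral of $\mathrm{div}(\psi\varphi)$ vanishes, and the Cauchy-Schwarz
    inequality bounds the remaining term. *)
Lemma integral_divergence_le (psi : V -> R) (phi : V -> V) :
  Cc_infty Om psi -> Cc1_vec Om phi ->
  (\int[lebV]_(x in Om) (psi x * divergence phi x)%:E <=
   \int[lebV]_(x in Om) (enorm (phi x) * enorm (grad psi x))%:E)%E.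
Proof.
move=> Cpsi Cphi.
have C1 := Cc_infty_Ck1 Cpsi.
have [_ [cS SOm]] := Cpsi; set S := closure _ in cS SOm.
have psi0 x : ~ S x -> psi x = 0.
  by move=> xS; apply: contrapT => px; apply: xS; apply: subset_closure; exact/eqP.
have ppsi0 i x : ~ S x -> partial i psi x = 0 by exact: partial_notin_support.
have C1phi i : Ck 1 (fun x => phi x 0 i) by case: Cphi.
pose A x := psi x * divergence phi x.
pose B x := \sum_(i < n.+1) phi x 0 i * partial i psi x.
pose F i x := psi x * phi x 0 i.
have C1F i : Ck 1 (F i) by exact: Ck1M.
have FE i x : partial i (F i) x =
    psi x * partial i (fun y => phi y 0 i) x + phi x 0 i * partial i psi x.
  exact: partialM.
have ABE x : A x + B x = \sum_(i < n.+1) partial i (F i) x.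
  by rewrite /A /B /divergence mulr_sumr -big_split/=; apply: eq_bigr => i _; rewrite FE.
have cA : continuous A.
  by move=> x; exact: (cvgM (@Ck1_continuous _ _ _ C1 x) (@continuous_divergence _ Cphi x)).
have cB : continuous B.
  apply: continuous_sumr => i x.
  exact: (cvgM (@Ck1_continuous _ _ _ (C1phi i) x) (@Ck1_partial _ _ _ i C1 x)).
have A0 x : ~ S x -> A x = 0 by move=> xS; rewrite /A psi0// mul0r.
have B0 x : ~ S x -> B x = 0.
  by move=> xS; rewrite /B big1// => i _; rewrite ppsi0// mulr0.
have F0 i x : ~ S x -> F i x = 0 by move=> xS; rewrite /F psi0// mul0r.
have pF0 i x : ~ S x -> partial i (F i) x = 0.
  by move=> xS; rewrite FE psi0// ppsi0// mul0r mulr0 addr0.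
have iA := integrable_compact_supp cS cA A0.
have iB := integrable_compact_supp cS cB B0.
have AB : (\int[lebV]_(x in Om) (A x)%:E + \int[lebV]_(x in Om) (B x)%:E = 0)%E.
  rewrite -integralD//.
  rewrite (eq_integral (fun x => \sum_(i < n.+1) (partial i (F i) x)%:E)%E); last first.
    by move=> x _; rewrite -EFinD ABE sumEFin.
  rewrite integral_sum//; last first.
    move=> i; exact: (integrable_compact_supp cS (@Ck1_partial _ _ _ i (C1F i)) (pF0 i)).
  by rewrite big1// => i _; exact: (integral_partial_eq0 cS SOm (C1F i) (F0 i) (pF0 i)).
have finB := integrable_fin_num mOm iB.
have -> : (\int[lebV]_(x in Om) (A x)%:E = - \int[lebV]_(x in Om) (B x)%:E)%E.
  have finA := integrable_fin_num mOm iA.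
  move: AB; rewrite -(fineK finA) -(fineK finB) -EFinD => -[] /eqP.
  by rewrite addr_eq0 => /eqP ->; rewrite EFinN.
apply: le_trans (lee_abs _) _; rewrite abseN.
have mB : measurable_fun Om B by apply/measurable_EFinP; exact: measurable_int iB.
apply: le_trans; first by apply: le_abse_integral => //; exact/measurable_EFinP.
have mphi := measurable_enorm_vec Cphi (D := Om).
apply: ge0_le_integral => //.
- by apply/measurable_EFinP; exact: measurableT_comp.
- apply/measurable_EFinP; apply: measurable_funM => //; exact: measurable_enorm_grad.
move=> x _; rewrite /= lee_fin.
apply: le_trans (cauchy_schwarz _ _); rewrite le_eqVlt; apply/orP; left; apply/eqP.
by congr `|_|; apply: eq_bigr => i _; rewrite mxE.
Qed.

End by_parts.

(** * Limits of test functions of bounded weighted variation *)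
Section smooth_limits.
Context (R : realType) (n M : nat).
Local Notation V := ('rV[R]_n.+1).
Local Notation lebV := (lebN R n.+1).
Local Notation mesh := (mesh R).
Variables (Om : set V) (oOm : open Om).
Hypothesis OmM : forall x, Om x -> forall i, `|x 0 i| < M%:R.
Variables (a : V -> R) (mu : R).
Hypotheses (ma : measurable_fun Om a) (mu0 : 0 < mu) (a_ge : ae_in Om (fun x => mu <= a x)).

Let mOm : measurable Om. Proof. exact: open_measurable_mx. Qed.
Let finOm : (lebV Om < +oo)%E. Proof. exact: lebN_bounded_lt_pinfty oOm OmM. Qed.

(** With $|a|$ in place of $a$ the integrand is nonnegative everywhere, and not
    only outside the negligible set where $a\ge\mu$ fails. *)
Definition smooth_limit (K : R) (u : V -> R) : Prop :=
  measurable_fun Om u /\ forall e : R, 0 < e -> exists psi,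
    [/\ Cc_infty Om psi,
        (\int[lebV]_(x in Om) (`|a x| * enorm (grad psi x))%:E <= K%:E)%E &
        (\int[lebV]_(x in Om) `|u x - psi x|%:E <= e%:E)%E].

Let md (u v : V -> R) : measurable_fun Om u -> measurable_fun Om v ->
  measurable_fun Om (fun x => `|u x - v x|%:E).
Proof.
by move=> mu' mv; apply/measurable_EFinP; apply: measurableT_comp => //; exact: measurable_funB.
Qed.

Lemma measurable_Cc_infty (psi : V -> R) : Cc_infty Om psi -> measurable_fun Om psi.
Proof.
move=> /Cc_infty_Ck1[cpsi _]; apply: measurable_funTS; exact: continuous_measurable_mx.
Qed.

Lemma smooth_limit_closed K (u : V -> R) : measurable_fun Om u ->
  (forall e : R, 0 < e -> exists2 v, smooth_limit K v &
    (\int[lebV]_(x in Om) `|u x - v x|%:E <= e%:E)%E) -> smooth_limit K u.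
Proof.
move=> mu' H; split => // e e0.
have e20 : 0 < e / 2 by rewrite divr_gt0.
have [v [mv Hv] uv] := H _ e20.
have [psi [Cpsi Kpsi vpsi]] := Hv _ e20.
exists psi; split => //; apply: le_trans (L1_triangle mOm mu' mv (measurable_Cc_infty Cpsi)) _.
by rewrite [e in leRHS]splitr EFinD leeD.
Qed.

Lemma smooth_limit_partial_le K psi i : Cc_infty Om psi ->
  (\int[lebV]_(x in Om) (`|a x| * enorm (grad psi x))%:E <= K%:E)%E ->
  (\int[lebV]_x `|partial i psi x|%:E <= (K / mu)%:E)%E.
Proof.
move=> Cpsi Kpsi; have C1 := Cc_infty_Ck1 Cpsi.
have [_ [_ SOm]] := Cpsi.
have -> : (\int[lebV]_x `|partial i psi x|%:E = \int[lebV]_(x in Om) `|partial i psi x|%:E)%E.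
  rewrite [RHS]integral_mkcond; apply: eq_integral => x _.
  rewrite /patch; case: ifPn => //; rewrite notin_setE => Omx.
  by rewrite partial_notin_support ?normr0// => /SOm.
have mg : measurable_fun Om (fun x => enorm (grad psi x)) by exact: measurable_enorm_grad.
have mag : measurable_fun Om (fun x => (`|a x| * enorm (grad psi x))%:E).
  by apply/measurable_EFinP; apply: measurable_funM => //; exact: measurableT_comp.
rewrite mulrC EFinM lee_pdivlMl//; apply: le_trans Kpsi.
rewrite -ge0_integralZl_EFin//; last 2 first.
- by apply: measurable_funTS; apply: measurable_abs_EFin; exact: Ck1_partial.
- exact: ltW.
apply: ae_ge0_le_integral => //.
- by move=> x _; rewrite -EFinM lee_fin mulr_ge0// ltW.
- apply: measurable_funeM; apply: measurable_funTS; apply: measurable_abs_EFin.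
  exact: Ck1_partial.
- by move=> x _; rewrite lee_fin mulr_ge0// enorm_ge0.
move: a_ge; rewrite /ae_in; apply: filterS => x ax Omx; rewrite -EFinM lee_fin; apply: ler_pM => //.
- exact: ltW.
- by apply: le_trans (ler_norm _); exact: ax.
- by have := coord_le_enorm (grad psi x) i; rewrite mxE.
Qed.

Lemma smooth_limit_steps K : 0 <= K -> exists2 C, 0 < C & forall u, smooth_limit K u ->
  forall k, exists c : grid_idx n M k -> R,
    (forall z, `|c z| <= C * (2 ^+ n) ^+ k) /\
    (\int[lebV]_(x in Om) `|u x - step c x|%:E <= (C * 2^-1 ^+ k)%:E)%E.
Proof.
move=> K0; pose W : R := K / mu + 1.
have W0 : 0 < W by rewrite ltr_wpDl// divr_ge0// ltW.
exists (n.+4%:R * W); first by rewrite mulr_gt0.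
move=> u [mu' Hu] k.
have [psi [Cpsi Kpsi upsi]] := Hu _ (mulr_gt0 W0 (@mesh_gt0 R k)).
have psi0 x : ~ Om x -> psi x = 0 by exact: compact_supp_out Cpsi.2.
have pW i : (\int[lebV]_x `|partial i psi x|%:E <= W%:E)%E.
  by apply: le_trans (smooth_limit_partial_le i Cpsi Kpsi) _; rewrite lee_fin lerDl.
have [c [cB cI]] := step_approx k mOm OmM (Cc_infty_Ck1 Cpsi) psi0 W0 pW.
exists c; split.
  move=> z; apply: le_trans (cB z) _; rewrite ler_pM2r ?exprn_gt0// ?exprn_gt0//.
  by rewrite ler_pM2r// ler_nat.
apply: le_trans.
  apply: (L1_triangle mOm mu' (measurable_Cc_infty Cpsi)).
  by apply: measurable_funTS; exact: measurable_step.
rewrite -[n.+4%:R]natr1 addrC mulrDl mul1r mulrDl EFinD; exact: leeD.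
Qed.

Lemma smooth_limit_Lq K q : (0 < n)%N -> 0 <= K -> 1 <= q < n.+1%:R / n%:R ->
  exists B : R, forall u, smooth_limit K u ->
    (\int[lebV]_(x in Om) (`|u x| `^ q)%:E <= B%:E)%E.
Proof.
move=> n0 K0 qn; have [C C0 HC] := smooth_limit_steps K0.
have [B HB] := Lq_bound mOm finOm n0 C0 qn.
exists B => u Hu; have [mu' _] := Hu.
have /choice[g Hg] : forall k, exists g : V -> R, [/\ measurable_fun Om g,
    forall x, `|g x| <= C * (2 ^+ n) ^+ k &
    (\int[lebV]_(x in Om) `|u x - g x|%:E <= (C * 2^-1 ^+ k)%:E)%E].
  move=> k; have [c [cB cI]] := HC u Hu k; exists (step c); split => //.
  - by apply: measurable_funTS; exact: measurable_step.
  - by move=> x; apply: step_bound => //; rewrite mulr_ge0 ?exprn_ge0// ltW.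
exact: (HB u g mu').
Qed.

(** Two functions are put into the same class when the coefficients of their step
    approximations agree after rounding. *)
Lemma smooth_limit_classes K (u_ : nat -> V -> R) : 0 <= K ->
  (forall m, smooth_limit K (u_ m)) ->
  forall e : R, 0 < e -> exists (J : finType) (t : nat -> J), forall m m',
    t m = t m' -> (\int[lebV]_(x in Om) `|u_ m x - u_ m' x|%:E <= e%:E)%E.
Proof.
move=> K0 Hu e e0; have [C C0 HC] := smooth_limit_steps K0.
have C40 : 0 < 4 * C by rewrite mulr_gt0.
have [k ke] := exists_mesh_le (divr_gt0 e0 C40).
have {HC} /choice[c Hc] : forall m, exists c : grid_idx n M k -> R,
    (forall z, `|c z| <= C * (2 ^+ n) ^+ k) /\
    (\int[lebV]_(x in Om) `|u_ m x - step c x|%:E <= (C * 2^-1 ^+ k)%:E)%E.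
  by move=> m; exact: HC.
set B : R := C * (2 ^+ n) ^+ k in Hc.
have B0 : 0 < B by rewrite mulr_gt0// exprn_gt0// exprn_gt0.
have d0 : 0 <= fine (lebV Om) by apply: fine_ge0; exact: measure_ge0.
have dE : lebV Om = (fine (lebV Om))%:E by rewrite fineK// ge0_fin_numE.
set d := fine (lebV Om) in d0 dE.
pose dl : R := e / 2 / (d + 1).
have dl0 : 0 < dl by rewrite !divr_gt0// ltr_wpDl.
have dld : dl * d <= e / 2.
  by rewrite /dl mulrAC ler_pdivrMr ?ltr_wpDl// ler_pM2l ?divr_gt0// lerDl.
(* The coefficients lie in $[-B,B]$, which is cut into intervals of length $dl$. *)
pose L := Num.truncn (2 * B / dl).
pose qn m z := Num.truncn ((c m z + B) / dl).
have arg0 m z : 0 <= (c m z + B) / dl.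
  have [cB _] := Hc m; rewrite divr_ge0 ?(ltW dl0)//.
  by have := cB z; rewrite ler_norml => /andP[? ?]; lra.
have qL m z : (qn m z < L.+1)%N.
  rewrite ltnS; apply: le_truncn; rewrite ler_pM2r ?invr_gt0//.
  by have [cB _] := Hc m; have := cB z; rewrite ler_norml => /andP[? ?]; lra.
exists {ffun grid_idx n M k -> 'I_L.+1}, (fun m => [ffun z => inord (qn m z)]) => m m' tE.
have qE z : qn m z = qn m' z.
  by have /ffunP/(_ z) := tE; rewrite !ffunE => /(congr1 val) /=; rewrite !inordK.
have cc z : `|c m z - c m' z| <= dl.
  have bnd m1 : (qn m1 z)%:R * dl <= c m1 z + B < (qn m1 z)%:R * dl + dl.
    have /andP[l1 u1] := truncn_itv (arg0 m1 z).
    rewrite -(ler_pdivlMr _ _ dl0) l1 /=.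
    rewrite -[X in _ < _ + X]mul1r -mulrDl natr1 -(ltr_pdivrMr _ _ dl0).
    exact: u1.
  have := bnd m; have := bnd m'; rewrite qE => /andP[? ?] /andP[? ?].
  by rewrite ler_norml; apply/andP; split; lra.
have ms m1 : measurable_fun Om (step (c m1)) by apply: measurable_funTS; exact: measurable_step.
have mu_ m1 : measurable_fun Om (u_ m1) by case: (Hu m1).
apply: le_trans (L1_triangle mOm (mu_ m) (ms m) (mu_ m')) _.
apply: le_trans (leeD2l _ (L1_triangle mOm (ms m) (ms m') (mu_ m'))) _.
have I1 := (Hc m).2; have I2 := (Hc m').2.
have I3 : (\int[lebV]_(x in Om) `|step (c m) x - step (c m') x|%:E <= (dl * d)%:E)%E.
  rewrite EFinM -dE -integral_cst//; apply: ge0_le_integral => //.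
  - exact: md.
  move=> x _; rewrite lee_fin.
  rewrite (_ : _ - _ = step (fun z => c m z - c m' z) x).
    by apply: step_bound => //; exact: ltW.
  by rewrite /step -sumrB; apply: eq_bigr => z _; rewrite mulrBl.
have I2' : (\int[lebV]_(x in Om) `|step (c m') x - u_ m' x|%:E <= (C * 2^-1 ^+ k)%:E)%E.
  by under eq_integral do rewrite distrC.
apply: le_trans (leeD I1 (leeD I3 I2')) _; rewrite -!EFinD lee_fin.
have : C * 2^-1 ^+ k <= e / 4.
  have := ke; rewrite /mesh ler_pdivlMr// => H; lra.
by move=> ?; lra.
Qed.

Lemma smooth_limit_compact K (u_ : nat -> V -> R) : 0 <= K ->
  (forall m, smooth_limit K (u_ m)) ->
  exists s : nat -> nat, [/\ {homo s : i j / (i < j)%N},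
    smooth_limit K (pointwise_limsup (fun j => u_ (s j))) &
    forall j, (\int[lebV]_(x in Om)
      `|u_ (s j) x - pointwise_limsup (fun j => u_ (s j)) x|%:E <= (2 * 2^-1 ^+ j)%:E)%E].
Proof.
move=> K0 Hu.
have [s sinc Hs] := finite_classes_subsequence (smooth_limit_classes K0 Hu).
have mu_ j : measurable_fun Om (u_ (s j)) by case: (Hu (s j)).
have cvg := L1_complete mOm mu_ Hs.
exists s; split => //.
apply: smooth_limit_closed; first exact: measurable_pointwise_limsup.
move=> e e0; have e20 : 0 < e / 2 by rewrite divr_gt0.
have [j je] := exists_mesh_le e20.
exists (u_ (s j)) => //; under eq_integral do rewrite distrC.
by apply: le_trans (cvg j) _; rewrite lee_fin mulrC -ler_pdivlMr.
Qed.

Hypothesis ia : lebV.-integrable Om (EFin \o a).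

(** At almost every point the precise value exists and equals $a$. *)
Lemma admissible_ae phi : admissible Om a phi -> ae_in Om (fun x => enorm (phi x) <= `|a x|).
Proof.
move=> [_ adm]; have := precise_value_ae oOm OmM ia.
rewrite /ae_in; apply: filterS => x xa Omx.
by apply: le_trans (ler_norm _); apply: adm => //; exact: xa.
Qed.

(** For a fixed field $\varphi$ the map $u\mapsto\int u\,\mathrm{div}\,\varphi$ is
    continuous for the $L^1$ norm, so the bound for test functions passes to their
    limits. *)
Lemma smooth_limit_var_le K (u : V -> R) : smooth_limit K u -> (var Om a u <= K%:E)%E.
Proof.
move=> [mu' Hu]; apply: ub_ereal_sup => _ [phi adm <-].
have Cphi := adm.1.
have cd := @continuous_divergence _ _ _ _ Cphi.
have [_ [cS _]] := Cphi.
have [B B0 dB] := continuous_zero_outside_bounded cS cd (fun x => divergence_out Cphi).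
have mdiv : measurable_fun Om (divergence phi).
  by apply: measurable_funTS; exact: continuous_measurable_mx.
apply/lee_addgt0Pr => e e0.
have [psi [Cpsi Kpsi upsi]] := Hu _ (divr_gt0 e0 B0).
have mpsi := measurable_Cc_infty Cpsi.
have C1 := Cc_infty_Ck1 Cpsi.
pose D x := (u x - psi x) * divergence phi x.
have mD : measurable_fun Om D by apply: measurable_funM => //; exact: measurable_funB.
have Dle : (\int[lebV]_(x in Om) `|D x|%:E <= e%:E)%E.
  apply: (@le_trans _ _ (B%:E * \int[lebV]_(x in Om) `|u x - psi x|%:E)%E).
    rewrite -ge0_integralZl_EFin ?(ltW B0)//; last exact: md.
    apply: ge0_le_integral => //.
    - by apply/measurable_EFinP; exact: measurableT_comp.
    - by apply: measurable_funeM; exact: md.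
    by move=> x _; rewrite -EFinM lee_fin /D normrM mulrC ler_wpM2r.
  apply: (@le_trans _ _ (B%:E * (e / B)%:E)%E).
    by rewrite lee_pmul ?lee_fin ?(ltW B0)//; exact: integral_ge0.
  by rewrite -EFinM mulrC divfK// gt_eqF.
have iD : lebV.-integrable Om (EFin \o D).
  apply/integrableP; split; first exact/measurable_EFinP.
  by apply: le_lt_trans Dle _; rewrite ltry.
pose A x := psi x * divergence phi x.
have iA : lebV.-integrable Om (EFin \o A).
  have [_ [cS' _]] := Cpsi.
  apply: (integrable_compact_supp oOm OmM cS').
    by move=> x; exact: (cvgM (@Ck1_continuous _ _ _ C1 x) (cd x)).
  move=> x xS; rewrite /A (_ : psi x = 0) ?mul0r//.
  by apply: contrapT => px; apply: xS; apply: subset_closure; exact/eqP.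
rewrite (eq_integral (fun x => (A x)%:E + (D x)%:E)%E); last first.
  by move=> x _; rewrite -EFinD /A /D -mulrDl addrC subrK.
rewrite integralD//; apply: leeD; last first.
  by apply: le_trans (lee_abs _) _; apply: le_trans Dle; apply: le_abse_integral => //; exact/measurable_EFinP.
apply: le_trans (integral_divergence_le oOm OmM Cpsi Cphi) _; apply: le_trans Kpsi.
apply: ae_ge0_le_integral => //.
- by move=> x _; rewrite lee_fin mulr_ge0// enorm_ge0.
- apply/measurable_EFinP; apply: measurable_funM; last exact: measurable_enorm_grad.
  exact: (measurable_enorm_vec Cphi).
- by move=> x _; rewrite lee_fin mulr_ge0// enorm_ge0.
- apply/measurable_EFinP; apply: measurable_funM; last exact: measurable_enorm_grad.
  exact: measurableT_comp.
have := admissible_ae adm; rewrite /ae_in; apply: filterS => x ax Omx.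
by rewrite lee_fin ler_wpM2r ?enorm_ge0//; exact: ax.
Qed.

End smooth_limits.

(** * Weighted Sobolev functions as limits of test functions *)
Section sobolev_class.
Context (R : realType) (n M : nat).
Local Notation V := ('rV[R]_n.+1).
Local Notation lebV := (lebN R n.+1).
Variables (Om : set V) (oOm : open Om).
Hypothesis OmM : forall x, Om x -> forall i, `|x 0 i| < M%:R.
Variables (a : V -> R) (mu : R).
Hypotheses (ma : measurable_fun Om a) (mu0 : 0 < mu) (a_ge : ae_in Om (fun x => mu <= a x)).

Let mOm : measurable Om. Proof. exact: open_measurable_mx. Qed.
Let finOm : (lebV Om < +oo)%E. Proof. exact: lebN_bounded_lt_pinfty oOm OmM. Qed.

(** With $t$ small this turns convergence in $L^p$ on a set of finite measure into
    convergence in $L^1$; with $t=1$ it bounds the weighted variation by the energy,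
    uniformly in $p$. *)
Lemma le_powR_rescaled (t s p : R) : 0 < t -> 0 <= s -> 1 <= p ->
  s <= t + t `^ (1 - p) * s `^ p.
Proof.
move=> t0 s0 p1; have c0 : 0 <= t `^ (1 - p) * s `^ p by rewrite mulr_ge0 ?powR_ge0.
have [st|ts] := leP s t; first by rewrite -[leLHS]addr0 lerD.
have {}s0 : 0 < s by exact: lt_trans ts.
rewrite -[leLHS]add0r lerD ?(ltW t0)//.
have -> : t `^ (1 - p) * s `^ p = s * ((s / t) `^ (p - 1)).
  have -> : s `^ p = s * s `^ (p - 1).
    by rewrite -{2}(powRr1 (ltW s0)) -powRD ?(gt_eqF s0) ?implybT// addrC subrK.
  rewrite powRM ?invr_ge0 ?(ltW t0) ?(ltW s0)// -powR_inv1 ?(ltW t0)// -powRrM mulN1r opprB.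
  by ring.
rewrite ler_peMr ?(ltW s0)//; apply: (@le_trans _ _ (1 `^ (p - 1))); first by rewrite powR1.
apply: ge0_ler_powR; rewrite ?nnegrE ?subr_ge0 ?divr_ge0 ?(ltW s0) ?(ltW t0)//.
by rewrite ler_pdivlMr// mul1r ltW.
Qed.

Lemma energy_abs p (H : V -> V) : (forall i, measurable_fun Om (fun x => H x 0 i)) ->
  energy Om a p H = (\int[lebV]_(x in Om) (`|a x| * enorm (H x) `^ p)%:E)%E.
Proof.
move=> mH; rewrite /energy.
have mp : measurable_fun Om (fun x => enorm (H x) `^ p).
  by apply: (measurableT_comp (measurable_powR _)); exact: measurable_enorm_fun.
apply: ae_eq_integral => //.
- by apply/measurable_EFinP; exact: measurable_funM.
- by apply/measurable_EFinP; apply: measurable_funM => //; exact: measurableT_comp.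
move: a_ge; rewrite /ae_in; apply: filterS => x ax Omx.
by rewrite ger0_norm// (le_trans (ltW mu0))//; exact: ax.
Qed.

Lemma weighted_enorm_le p (H : V -> V) : 1 <= p ->
  (forall i, measurable_fun Om (fun x => H x 0 i)) ->
  (\int[lebV]_(x in Om) (`|a x| * enorm (H x))%:E <=
   \int[lebV]_(x in Om) `|a x|%:E + energy Om a p H)%E.
Proof.
move=> p1 mH; rewrite energy_abs//.
have mE := measurable_enorm_fun mH.
have mabs : measurable_fun Om (fun x => `|a x|) by exact: measurableT_comp.
have mp : measurable_fun Om (fun x => enorm (H x) `^ p).
  exact: (measurableT_comp (measurable_powR _)).
rewrite -ge0_integralD//; last 3 first.
- exact/measurable_EFinP.
- by move=> x _; rewrite lee_fin mulr_ge0// powR_ge0.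
- by apply/measurable_EFinP; exact: measurable_funM.
apply: ge0_le_integral => //.
- by move=> x _; rewrite lee_fin mulr_ge0// enorm_ge0.
- by apply/measurable_EFinP; exact: measurable_funM.
- by apply: emeasurable_funD; [exact/measurable_EFinP|apply/measurable_EFinP; exact: measurable_funM].
move=> x _; rewrite -EFinD lee_fin -{2}[`|a x|]mulr1 -mulrDr ler_wpM2l//.
have := @le_powR_rescaled 1 (enorm (H x)) p ltr01 (enorm_ge0 _) p1.
by rewrite powR1 mul1r.
Qed.

Lemma W01p_smooth_limit p v G (E : R) : 1 < p -> (\int[lebV]_(x in Om) `|a x|%:E < +oo)%E ->
  W01p Om a p v G -> (energy Om a p G <= E%:E)%E ->
  smooth_limit Om a (2 * fine (\int[lebV]_(x in Om) `|a x|%:E) + 1 + E) v.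
Proof.
move=> p1 afin [mv mG [phi Cphi cvgphi]] GE; split => // e e0.
have p0 : 0 < p by exact: lt_trans p1.
have d0 : 0 <= fine (lebV Om) by apply: fine_ge0; exact: measure_ge0.
have dE : lebV Om = (fine (lebV Om))%:E by rewrite fineK// ge0_fin_numE.
set d := fine (lebV Om) in d0 dE.
pose t : R := e / 2 / (d + 1).
have t0 : 0 < t by rewrite !divr_gt0// ltr_wpDl.
have td : t * d <= e / 2.
  by rewrite /t mulrAC ler_pdivrMr ?ltr_wpDl// ler_pM2l ?divr_gt0// lerDl.
pose dl : R := Num.min 1 (e / 2 / t `^ (1 - p)).
have dl0 : 0 < dl by rewrite lt_min ltr01 !divr_gt0// powR_gt0.
have dl1 : dl <= 1 by rewrite /dl ge_min lexx.
have dle : t `^ (1 - p) * dl <= e / 2.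
  by rewrite mulrC -ler_pdivlMr ?powR_gt0// /dl ge_min lexx orbT.
have C1 k := Cc_infty_Ck1 (Cphi k).
have mphi k : measurable_fun Om (phi k) by exact: measurable_Cc_infty (Cphi k).
have mD k i : measurable_fun Om (fun x => (G x - grad (phi k) x) 0 i).
  rewrite (_ : (fun x => _) = fun x => G x 0 i - partial i (phi k) x).
    apply: measurable_funB => //; apply: measurable_funTS.
    by apply: continuous_measurable_mx; exact: Ck1_partial.
  by apply/funext => x; rewrite !mxE.
pose X k := (\int[lebV]_(x in Om) (`|v x - phi k x| `^ p)%:E +
   energy Om a p (fun x => G x - grad (phi k) x)%R)%E.
have en0 k : (0 <= energy Om a p (fun x => G x - grad (phi k) x)%R)%E.
  by rewrite energy_abs//; apply: integral_ge0 => x _; rewrite lee_fin mulr_ge0// powR_ge0.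
have vp0 k : (0 <= \int[lebV]_(x in Om) (`|v x - phi k x| `^ p)%:E)%E.
  by apply: integral_ge0 => x _; rewrite lee_fin powR_ge0.
have X0 k : (0 <= X k)%E by rewrite adde_ge0.
(* The norm is a power of $X_k$, so it has to be raised to the power $p$. *)
have [k Xk] : exists k, (X k <= dl%:E)%E.
  have n0 k : (0 <= X k `^ p^-1)%E by exact: poweR_ge0.
  have dp : 0 < dl `^ p^-1 by rewrite powR_gt0.
  have [m _ Hm] := (cvge0P n0).1 cvgphi _ dp.
  exists m; have := Hm m (leqnn m).
  move=> /= H.
  have : ((X m `^ p^-1) `^ p <= (dl `^ p^-1)%:E `^ p)%E.
    apply: gt0_ler_poweR => //; first exact: ltW.
    - by rewrite in_itv/= n0 leey.
    - by rewrite in_itv/= lee_fin powR_ge0 leey.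
  by rewrite -poweRrM mulVf ?gt_eqF// poweRe1 ?X0// poweR_EFin -powRrM mulVf ?gt_eqF// powRr1 ?(ltW dl0)//.
exists (phi k); split => //.
- have mabs : measurable_fun Om (fun x => `|a x|) by exact: measurableT_comp.
  apply: (@le_trans _ _ (\int[lebV]_(x in Om) (`|a x| * enorm (G x))%:E +
      \int[lebV]_(x in Om) (`|a x| * enorm (G x - grad (phi k) x))%:E)%E).
    rewrite -ge0_integralD//; last 4 first.
    - by move=> x _; rewrite lee_fin mulr_ge0// enorm_ge0.
    - by apply/measurable_EFinP; apply: measurable_funM => //; exact: measurable_enorm_fun.
    - by move=> x _; rewrite lee_fin mulr_ge0// enorm_ge0.
    - by apply/measurable_EFinP; apply: measurable_funM => //; apply: measurable_enorm_fun => i; exact: mD.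
    apply: ge0_le_integral => //.
    - by move=> x _; rewrite lee_fin mulr_ge0// enorm_ge0.
    - by apply/measurable_EFinP; apply: measurable_funM => //; exact: measurable_enorm_grad.
    - apply: emeasurable_funD; apply/measurable_EFinP; apply: measurable_funM => //.
        exact: measurable_enorm_fun.
      by apply: measurable_enorm_fun => i; exact: mD.
    move=> x _; rewrite -EFinD lee_fin -mulrDr ler_wpM2l//.
    rewrite -[enorm (G x - _)]enormN opprB.
    by rewrite -{1}(subrKC (G x) (grad (phi k) x)); exact: enormD.
  have A := weighted_enorm_le (ltW p1) mG.
  have B := weighted_enorm_le (ltW p1) (mD k).
  apply: le_trans (leeD A B) _.
  have aE : (\int[lebV]_(x in Om) `|a x|%:E = (fine (\int[lebV]_(x in Om) `|a x|%:E))%:E)%E.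
    by rewrite fineK// ge0_fin_numE//; exact: integral_ge0.
  set al := fine _ in aE *; rewrite aE.
  have D1 : (energy Om a p (fun x => G x - grad (phi k) x)%R <= 1%:E)%E.
    apply: (@le_trans _ _ (X k)); first by rewrite leeDr.
    by apply: le_trans Xk _; rewrite lee_fin.
  apply: le_trans (leeD (leeD2l _ GE) (leeD2l _ D1)) _.
  by rewrite -!EFinD lee_fin; lra.
have mabs : measurable_fun Om (fun x => `|v x - phi k x|).
  by apply: measurableT_comp => //; exact: measurable_funB.
have mpw : measurable_fun Om (fun x => `|v x - phi k x| `^ p).
  exact: (measurableT_comp (measurable_powR _)).
apply: (@le_trans _ _ (\int[lebV]_(x in Om) ((cst t%:E) x +
    (t `^ (1 - p))%:E * (`|v x - phi k x| `^ p)%:E))%E).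
  apply: ge0_le_integral => //.
  - exact/measurable_EFinP.
  - by apply: emeasurable_funD => //; apply: measurable_funeM; exact/measurable_EFinP.
  by move=> x _; rewrite /= -EFinM -EFinD lee_fin; apply: le_powR_rescaled => //; exact: ltW.
rewrite ge0_integralD//; last 3 first.
- by move=> x _; rewrite lee_fin ltW.
- by move=> x _; rewrite -EFinM lee_fin mulr_ge0 ?powR_ge0.
- by apply: measurable_funeM; exact/measurable_EFinP.
rewrite integral_cst// [X in (_ * X + _)%E]dE -EFinM ge0_integralZl_EFin ?powR_ge0//; last exact/measurable_EFinP.
rewrite [e in leRHS]splitr EFinD; apply: leeD; first by rewrite lee_fin.
apply: le_trans (_ : (_ <= (t `^ (1 - p) * dl)%:E)%E) _; last by rewrite lee_fin.
rewrite EFinM; apply: lee_pmul; rewrite ?lee_fin ?powR_ge0//.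
by apply: le_trans Xk; rewrite leeDl.
Qed.

End sobolev_class.

(** * Convergence of the eigenfunctions *)
Lemma bounded_set_coord (R : realType) (n : nat) (Om : set 'rV[R]_n) : bounded_set Om ->
  exists M : nat, forall x, Om x -> forall i, `|x 0 i| < M%:R.
Proof.
move=> [B [_ HB]]; exists (Num.truncn (`|B| + 1)).+1 => x Omx i.
have xB : `|x| <= `|B| + 1.
  by apply: HB => //; rewrite (le_lt_trans (ler_norm _))// ltrDl.
have : ball (0 : 'rV[R]_n) (Num.truncn (`|B| + 1)).+1%:R x.
  rewrite -ball_normE /= sub0r normrN; apply: le_lt_trans xB _.
  exact: truncnS_gt.
by move=> [_ /(_ 0 i)]; rewrite -ball_normE /= mxE sub0r normrN.
Qed.

Lemma powR_distB_le (R : realType) (x y q : R) : 0 <= q ->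
  `|x - y| `^ q <= 2 `^ q * (`|x| `^ q + `|y| `^ q).
Proof.
move=> q0.
wlog xy : x y / `|x| <= `|y|.
  move=> H; have [/H//|/ltW yx] := leP `|x| `|y|.
  by rewrite distrC [X in _ * X]addrC; exact: H.
apply: (@le_trans _ _ ((2 * `|y|) `^ q)).
  apply: ge0_ler_powR; rewrite ?nnegrE ?mulr_ge0//.
  by apply: le_trans (ler_normB _ _) _; rewrite mulr_natl mulr2n lerD2r.
by rewrite powRM// ler_wpM2l ?powR_ge0// lerDr powR_ge0.
Qed.

Section convergence.
Context (R : realType) (n M : nat).
Local Notation V := ('rV[R]_n.+2).
Local Notation lebV := (lebN R n.+2).
Variables (Om : set V) (oOm : open Om).
Hypothesis OmM : forall x, Om x -> forall i, `|x 0 i| < M%:R.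
Variables (a : V -> R) (mu : R).
Hypotheses (ma : measurable_fun Om a) (mu0 : 0 < mu) (a_ge : ae_in Om (fun x => mu <= a x)).

Let mOm : measurable Om. Proof. exact: open_measurable_mx. Qed.
Let finOm : (lebV Om < +oo)%E. Proof. exact: lebN_bounded_lt_pinfty oOm OmM. Qed.

Lemma smooth_limit_Lp K q (u : V -> R) : 0 <= K -> 1 <= q < n.+2%:R / n.+1%:R ->
  smooth_limit Om a K u -> Lp Om q u.
Proof.
move=> K0 qn Hu.
have [B HB] := smooth_limit_Lq oOm OmM ma mu0 a_ge (ltn0Sn n) K0 qn.
split; first by case: Hu.
by apply: le_lt_trans (HB u Hu) _; rewrite ltry.
Qed.

Lemma smooth_limit_cvg_Lp K q (u_ : nat -> V -> R) (u : V -> R) :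
  0 <= K -> 1 <= q < n.+2%:R / n.+1%:R ->
  (forall j, smooth_limit Om a K (u_ j)) -> smooth_limit Om a K u ->
  (forall j, (\int[lebV]_(x in Om) `|u_ j x - u x|%:E <= (2 * 2^-1 ^+ j)%:E)%E) ->
  cvg_Lp Om q u_ u.
Proof.
move=> K0 qn Hu_ Hu cvg1; split.
- by move=> j; exact: smooth_limit_Lp (Hu_ j).
- exact: smooth_limit_Lp Hu.
move: (qn) => /andP[q1 qN].
pose q' : R := (q + n.+2%:R / n.+1%:R) / 2.
have qq' : q < q' by rewrite /q' midf_lt.
have q'N : 1 <= q' < n.+2%:R / n.+1%:R.
  by rewrite (le_trans q1 (ltW qq'))//= /q' midf_lt.
have [B HB] := smooth_limit_Lq oOm OmM ma mu0 a_ge (ltn0Sn n) K0 q'N.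
have q'0 : 0 <= q' by lra.
have mu_ j : measurable_fun Om (u_ j) by case: (Hu_ j).
have mu' : measurable_fun Om u by case: Hu.
have mdist j : measurable_fun Om (fun x => u_ j x - u x) by exact: measurable_funB.
have mpw (f : V -> R) : measurable_fun Om f -> measurable_fun Om (fun x => (`|f x| `^ q')%:E).
  move=> mf; apply/measurable_EFinP; apply: (measurableT_comp (measurable_powR _)).
  exact: measurableT_comp.
apply: (@cvg_Lq_interpolation _ _ _ lebV Om mOm q q' (2 `^ q' * (B + B))) => //.
- by rewrite q1.
- apply/cvge0P => [j|e e0]; first exact: integral_ge0.
  have e20 : 0 < e / 2 by rewrite divr_gt0.
  have [k ke] := exists_mesh_le e20.
  exists k => // j /= kj; apply: le_trans (cvg1 j) _; rewrite lee_fin mulrC -ler_pdivlMr//.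
  by apply: le_trans ke; rewrite /mesh ler_wiXn2l ?invr_ge0// invf_le1// ler1n.
move=> j.
have p0 (f : V -> R) x : (0 <= (`|f x| `^ q')%:E)%E by rewrite lee_fin powR_ge0.
rewrite EFinM EFinD.
apply: (@le_trans _ _ ((2 `^ q')%:E * (\int[lebV]_(x in Om) (`|u_ j x| `^ q')%:E +
    \int[lebV]_(x in Om) (`|u x| `^ q')%:E))%E); last first.
  apply: lee_pmul; rewrite ?lee_fin ?powR_ge0//; last by apply: leeD; exact: HB.
  by apply: adde_ge0; apply: integral_ge0.
rewrite -ge0_integralD//; [|exact: mpw|exact: mpw].
have mS : measurable_fun Om (fun x => (`|u_ j x| `^ q')%:E + (`|u x| `^ q')%:E)%E.
  by apply: emeasurable_funD; exact: mpw.
rewrite -ge0_integralZl_EFin ?powR_ge0//; last by move=> x _; exact: adde_ge0.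
apply: ge0_le_integral => //; [exact: mpw|exact: measurable_funeM|].
by move=> x _; rewrite -EFinD -EFinM lee_fin; exact: powR_distB_le.
Qed.

End convergence.

Unset Implicit Arguments.
Set Strict Implicit.
Set Printing Implicit Defensive.

Theorem proposition4p4 (R : realType) (N : nat) (hN : (2 <= N)%N)
    (Om : set 'rV[R]_N)
    (Om_open : open Om) (Om_bounded : bounded_set Om)
    (Om_lip : lipschitz_boundary Om)
    (a : 'rV[R]_N -> R) (mu : R)
    (aW : W11 Om a) (mu_gt0 : 0 < mu) (a_ge : ae_in Om (fun x => mu <= a x))
    (b : 'rV[R]_N -> R) (r : R)
    (r_gt : N%:R < r) (bL : Lp Om r b)
    (b_ge0 : ae_in Om (fun x => 0 <= b x))
    (b_neq0 : ~ ae_in Om (fun x => b x = 0))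
    (p0 : R) (p0_bounds : 1 < p0 < 2)
    (lambda_bounded : exists C : R, forall q : R, 1 < q < p0 ->
      (`|first_eigenvalue Om a b q| <= C%:E)%E)
    (p : nat -> R)
    (p_bounds : forall m, 1 < p m < p0) (p_cvg : p m @[m --> \oo] --> (1 : R))
    (Lambda : R)
    (lambda_cvg : first_eigenvalue Om a b (p m) @[m --> \oo] --> Lambda%:E)
    (u_ : nat -> 'rV[R]_N -> R)
    (u_eigen : forall m, nonneg_eigenfunction Om a b (p m) (u_ m)) :
  exists u : 'rV[R]_N -> R,
    [/\ ae_in Om (fun x => 0 <= u x), BV Om a u &
      exists2 s : nat -> nat, {homo s : i j / (i < j)%N} &
        forall q : R, 1 <= q < N%:R / (N%:R - 1) ->
          cvg_Lp Om q (fun m => u_ (s m)) u].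
Proof.
case: N hN Om Om_open Om_bounded Om_lip a aW a_ge b r_gt bL b_ge0 b_neq0 lambda_bounded
  lambda_cvg u_ u_eigen => [//|[//|n]] _ Om Om_open Om_bounded _ a [[ma aint] _] a_ge b
  _ _ _ _ [C HC] _ u_ u_eigen.
have [M OmM] := bounded_set_coord Om_bounded.
have mOm : measurable Om by exact: open_measurable_mx.
have NE : n.+2%:R / (n.+2%:R - 1) = n.+2%:R / n.+1%:R :> R by rewrite -natr1 addrK.
have afin : (\int[lebN R n.+2]_(x in Om) `|a x|%:E < +oo)%E.
  by move: aint; under eq_integral do rewrite powRr1//.
have ia : (lebN R n.+2).-integrable Om (EFin \o a).
  by apply/integrableP; split; [exact/measurable_EFinP|].
have C0 : 0 <= C by rewrite -lee_fin; apply: le_trans (HC _ (p_bounds 0%N)); exact: abse_ge0.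
pose K := 2 * fine (\int[lebN R n.+2]_(x in Om) `|a x|%:E) + 1 + C.
have K0 : 0 <= K by rewrite !addr_ge0 ?mulr_ge0// fine_ge0// integral_ge0.
have Hu m : smooth_limit Om a K (u_ m).
  have [_ _ [G WG EG]] := u_eigen m; have /andP[p1 _] := p_bounds m.
  apply: (W01p_smooth_limit Om_open OmM ma mu_gt0 a_ge p1 afin WG).
  by rewrite EG; apply: le_trans (lee_abs _) _; exact: HC.
have [s [sinc Hlim Hcvg]] := smooth_limit_compact Om_open OmM ma mu_gt0 a_ge K0 Hu.
exists (pointwise_limsup (fun j => u_ (s j))); split.
- have : {ae lebN R n.+2, forall x, forall j, Om x -> 0 <= u_ (s j) x}.
    by apply/ae_foralln => j; have [] := u_eigen (s j).
  rewrite /ae_in; apply: filterS => x ux Omx.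
  by apply: pointwise_limsup_ge0 => j; exact: ux.
- split.
    apply: (smooth_limit_Lp Om_open OmM ma mu_gt0 a_ge K0 _ Hlim).
    by rewrite lexx/= ltr_pdivlMr// mul1r ltr_nat.
  apply: le_lt_trans (smooth_limit_var_le Om_open OmM ma ia Hlim) _.
  by rewrite ltry.
exists s => // q; rewrite NE => qN.
exact: (smooth_limit_cvg_Lp Om_open OmM ma mu_gt0 a_ge K0 qN (fun j => Hu (s j)) Hlim Hcvg).
Qed.
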